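(* Strong $\Delta$-equivalence is an equivalence relation on the class of operator algebras with contractive approximate identities.
   Context: An operator algebra $A$ is an operator space which is also a Banach algebra and for which there exist a Hilbert space $H$ and a completely isometric homomorphism $A\to B(H)$. A representation of $A$ is a completely contractive homomorphism $A\to B(H)$, $H$ a Hilbert space. A ternary ring of operators (TRO) is a linear subspace $M\subset B(H,K)$ ($H,K$ Hilbert spaces) with $MM^*M\subset M$. For a set $S$ of operators, $[S]^{-\|\cdot\|}$ is the norm closure of the linear span of $S$; products of sets denote sets of products and $M^*=\{m^*:m\in M\}$. Norm closed algebras $A\subset B(H)$ and $B\subset B(K)$ are strongly TRO equivalent if there is a TRO $M\subset B(H,K)$ with $A=[M^*BM]^{-\|\cdot\|}$ and $B=[MAM^*]^{-\|\cdot\|}$. Operator algebras $A,B$ are strongly $\Delta$-equivalent if they have completely isometric representations $\alpha$ and $\beta$, respectively, such that $\alpha(A)$ and $\beta(B)$ are strongly TRO equivalent. A contractive approximate identity is a (two-sided) approximate identity consisting of elements of norm at most $1$. *)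

(* Defs.v *)
From HB Require Import structures.
From mathcomp Require Import all_boot all_order all_algebra.
From mathcomp Require Import all_classical all_reals topology normedtype.
From mathcomp Require Import complex.

Set Implicit Arguments.
Unset Strict Implicit.
Unset Printing Implicit Defensive.

Import Order.TTheory GRing.Theory Num.Theory.
Import numFieldNormedType.Exports.
Local Open Scope classical_set_scope.
Local Open Scope ring_scope.
Local Open Scope complex_scope.

(* In a normed module over R[i] the norm `|x| is a (real, nonnegative) element
   of R[i]; rnorm x is the same number seen in R, where suprema exist. *)
Definition rnorm (R : realType) (V : normedModType R[i]) (x : V) : R :=
  complex.Re `|x|.

Section RealNorm.
Context (R : realType) (V : normedModType R[i]).
Implicit Types (x y : V) (c : R[i]).

Lemma rnormE x : (rnorm x)%:C = `|x|.
Proof. by apply: RRe_real; exact: normr_real. Qed.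

Lemma rnorm_ge0 x : 0 <= rnorm x.
Proof. by rewrite -lecR rnormE normr_ge0. Qed.

Lemma rnorm0 : rnorm (0 : V) = 0.
Proof. by apply: complexI; rewrite rnormE normr0. Qed.

Lemma rnorm0_eq0 x : rnorm x = 0 -> x = 0.
Proof. by move=> x0; apply/normr0_eq0; rewrite -rnormE x0. Qed.

Lemma rnormD x y : rnorm (x + y) <= rnorm x + rnorm y.
Proof. by rewrite -lecR rmorphD /= !rnormE ler_normD. Qed.

Lemma rnormZ c x : rnorm (c *: x) = complex.Re `|c| * rnorm x.
Proof.
apply: complexI; rewrite rmorphM /= !rnormE normrZ.
by rewrite (RRe_real (normr_real c)).
Qed.

End RealNorm.

(* Inner products are linear in the first variable. *)
Record hilbert (R : realType) := Hilbert {
  hilbert_sort :> completeNormedModType R[i];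
  inner : {dot hilbert_sort for Num.conj};
  inner_norm : forall x : hilbert_sort, `|x| ^+ 2 = inner x x }.

Section BoundedOperators.
Context (R : realType).
Implicit Types (H K L : hilbert R).

Definition bounded_op H K : {pred H -> K} := fun f =>
  `[< linear f /\ exists M : R, forall x, rnorm (f x) <= M * rnorm x >].

Lemma bounded_op_submod_closed H K : submod_closed (@bounded_op H K).
Proof.
split.
  apply/asboolP; split; first move=> c x y.
    by rewrite -[RHS]/(c *: 0 + 0) scaler0 addr0.
  by exists 0 => x; rewrite mul0r rnorm0.
move=> c f g /asboolP[lf [M fM]] /asboolP[lg [N gN]].
apply/asboolP; split.
  move=> a x y; rewrite !fctE lf lg !scalerDr !scalerA [c * a]mulrC.
  by rewrite addrACA.
exists (complex.Re `|c| * M + N) => x; rewrite !fctE.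
rewrite (le_trans (rnormD _ _))// rnormZ mulrDl lerD// -mulrA ler_wpM2l//.
by rewrite -lecR (RRe_real (normr_real c)) normr_ge0.
Qed.

HB.instance Definition _ H K := GRing.isSubmodClosed.Build R[i] (H -> K)
  (@bounded_op H K) (@bounded_op_submod_closed H K).

Record bop H K := Bop { bop_fun :> H -> K; bopP : bop_fun \in @bounded_op H K }.

HB.instance Definition _ H K := [isSub for @bop_fun H K].
HB.instance Definition _ H K := [Choice of bop H K by <:].
HB.instance Definition _ H K := [SubChoice_isSubLmodule of bop H K by <:].

Lemma bop_linear H K (T : bop H K) : linear T.
Proof. by case/asboolP: (bopP T). Qed.

Lemma bop_bounded H K (T : bop H K) :
  exists M : R, forall x, rnorm (T x) <= M * rnorm x.
Proof. by case/asboolP: (bopP T). Qed.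

HB.instance Definition _ H K (T : bop H K) :=
  GRing.isLinear.Build R[i] H K _ T (@bop_linear H K T).

Lemma bop_comp_subproof H K L (S : bop K L) (T : bop H K) :
  S \o T \in @bounded_op H L.
Proof.
apply/asboolP; split; first by move=> c x y /=; rewrite !linearP.
have [[M SM] [N TN]] := (bop_bounded S, bop_bounded T).
exists (`|M| * N) => x; rewrite (le_trans (SM _))//.
by rewrite (le_trans (ler_wpM2r (rnorm_ge0 _) (ler_norm M)))// -mulrA ler_wpM2l.
Qed.

Definition bop_comp H K L (S : bop K L) (T : bop H K) : bop H L :=
  Bop (bop_comp_subproof S T).

Definition opnorm H K (T : bop H K) : R :=
  sup [set rnorm (T x) | x in [set x : H | rnorm x <= 1]].

Lemma opnorm_has_sup H K (T : bop H K) :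
  has_sup [set rnorm (T x) | x in [set x : H | rnorm x <= 1]].
Proof.
split; first by exists (rnorm (T 0)), 0 => //=; rewrite rnorm0.
have [M TM] := bop_bounded T; exists `|M| => _ [x /= x1 <-].
rewrite (le_trans (TM x))// (le_trans (ler_wpM2r (rnorm_ge0 _) (ler_norm M)))//.
by rewrite ler_piMr.
Qed.

Lemma opnorm_ub H K (T : bop H K) x : rnorm x <= 1 -> rnorm (T x) <= opnorm T.
Proof. by move=> x1; apply: sup_upper_bound; [exact: opnorm_has_sup|exists x]. Qed.

Lemma opnorm_lub H K (T : bop H K) M :
  (forall x, rnorm x <= 1 -> rnorm (T x) <= M) -> opnorm T <= M.
Proof.
move=> TM; apply: ge_sup; first by case: (opnorm_has_sup T).
by move=> _ [x /= x1 <-]; exact: TM.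
Qed.

Lemma opnormD H K (S T : bop H K) : opnorm (S + T) <= opnorm S + opnorm T.
Proof.
apply: opnorm_lub => x x1; rewrite (le_trans (rnormD (S x) (T x)))// lerD//.
- exact: opnorm_ub.
- exact: opnorm_ub.
Qed.

Lemma opnorm_leZ H K c (T : bop H K) :
  opnorm (c *: T) <= complex.Re `|c| * opnorm T.
Proof.
apply: opnorm_lub => x x1; rewrite (rnormZ c (T x)) ler_wpM2l ?opnorm_ub//.
by rewrite -lecR (RRe_real (normr_real c)) normr_ge0.
Qed.

Lemma opnormZ H K c (T : bop H K) :
  opnorm (c *: T) = complex.Re `|c| * opnorm T.
Proof.
apply/eqP; rewrite eq_le opnorm_leZ andTb.
have [->|c0] := eqVneq c 0.
  rewrite normr0 mul0r.
  by apply: le_trans (rnorm_ge0 _) (@opnorm_ub _ _ _ 0 _); rewrite rnorm0.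
have cgt0 : 0 < complex.Re `|c|.
  by rewrite -ltcR (RRe_real (normr_real c)) normr_gt0.
rewrite -ler_pdivlMl//.
have := opnorm_leZ c^-1 (c *: T); rewrite scalerA mulVf// scale1r.
congr (_ <= _ * _); apply: complexI.
by rewrite fmorphV !RRe_real ?normr_real// normfV.
Qed.

Lemma opnorm0_eq0 H K (T : bop H K) : opnorm T = 0 -> T = 0.
Proof.
move=> T0; apply/val_inj/funext => x /=.
have [->|x0] := eqVneq x 0; first by rewrite linear0.
have nx0 : `|x| != 0 by rewrite normr_eq0.
suff : T (`|x|^-1 *: x) = 0.
  by move/eqP; rewrite linearZ scaler_eq0 invr_eq0 (negPf nx0) => /eqP.
apply: rnorm0_eq0; apply/eqP; rewrite eq_le rnorm_ge0 andbT -T0.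
apply: opnorm_ub; rewrite -lecR rnormE normrZ normfV normr_id.
by rewrite mulVf.
Qed.

Definition opnormC H K (T : bop H K) : R[i] := (opnorm T)%:C.

Lemma opnormC_D H K (S T : bop H K) :
  opnormC (S + T) <= opnormC S + opnormC T.
Proof. by rewrite /opnormC -rmorphD lecR opnormD. Qed.

Lemma opnormC_Z H K c (T : bop H K) : opnormC (c *: T) = `|c| * opnormC T.
Proof. by rewrite /opnormC opnormZ rmorphM /= (RRe_real (normr_real c)). Qed.

Lemma opnormC0_eq0 H K (T : bop H K) : opnormC T = 0 -> T = 0.
Proof. by move=> /complexI; exact: opnorm0_eq0. Qed.

HB.instance Definition _ H K := isPointed.Build (bop H K) 0.
HB.instance Definition _ H K := Lmodule_isNormed.Build R[i] (bop H K)
  (@opnormC_D H K) (@opnormC_Z H K) (@opnormC0_eq0 H K).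

(* Norm of (x_1, ..., x_n) in the Hilbert direct sum H^n. *)
Definition l2norm H n (x : 'I_n -> H) : R :=
  Num.sqrt (\sum_(i < n) rnorm (x i) ^+ 2).

(* Norm of a matrix of operators as an element of M_n(B(H, K)) = B(H^n, K^n). *)
Definition opmx_norm H K n (T : 'M[bop H K]_n) : R :=
  sup [set l2norm (fun i => \sum_(j < n) T i j (x j)) |
       x in [set x : 'I_n -> H | l2norm x <= 1]].

End BoundedOperators.

Section TRO.
Context (R : realType).
Implicit Types (H K L : hilbert R).

Definition is_adjoint H K (T : bop H K) (S : bop K H) : Prop :=
  forall (x : H) (y : K), inner K (T x) y = inner H x (S y).

Definition adjoint_set H K (M : set (bop H K)) : set (bop K H) :=
  [set S | exists2 T, M T & is_adjoint T S].

Definition mul_set H K L (X : set (bop K L)) (Y : set (bop H K)) :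
    set (bop H L) :=
  [set T | exists S1 S2, [/\ X S1, Y S2 & T = bop_comp S1 S2]].

Definition linear_subspace (V : lmodType R[i]) (M : set V) : Prop :=
  M 0 /\ forall (c : R[i]) x y, M x -> M y -> M (c *: x + y).

Definition lin_span (V : lmodType R[i]) (X : set V) : set V :=
  [set v | exists n (c : 'I_n -> R[i]) (x : 'I_n -> V),
    (forall i, X (x i)) /\ v = \sum_(i < n) c i *: x i].

Definition closed_span (V : normedModType R[i]) (X : set V) : set V :=
  closure (lin_span X).

Definition is_TRO H K (M : set (bop H K)) : Prop :=
  linear_subspace M /\ mul_set (mul_set M (adjoint_set M)) M `<=` M.

Definition closed_algebra H (A : set (bop H H)) : Prop :=
  [/\ linear_subspace A, mul_set A A `<=` A & closed A].

Definition strongly_TRO_equivalent H K (A : set (bop H H)) (B : set (bop K K)) :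
    Prop :=
  [/\ closed_algebra A, closed_algebra B &
    exists M : set (bop H K),
      [/\ is_TRO M,
          A = closed_span (mul_set (mul_set (adjoint_set M) B) M) &
          B = closed_span (mul_set (mul_set M A) (adjoint_set M))]].

End TRO.

(* A matrix normed structure on V is a family of functions N n on M_n(V). *)
Definition completely_isometric (R : realType) (V : normedModType R[i])
    (N : forall n, 'M[V]_n -> R) (H K : hilbert R)
    (u : {linear V -> bop H K}) : Prop :=
  forall n (a : 'M[V]_n), opmx_norm (map_mx u a) = N n a.

Definition completely_contractive (R : realType) (V : normedModType R[i])
    (N : forall n, 'M[V]_n -> R) (H K : hilbert R)
    (u : {linear V -> bop H K}) : Prop :=
  forall n (a : 'M[V]_n), opmx_norm (map_mx u a) <= N n a.

(* (Complete) abstract operator spaces: matrix norms coming from a linear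
   embedding in some B(H); on M_1(V) = V the matrix norm is the norm of V. *)
Record operator_space (R : realType) := OperatorSpace {
  os_sort :> completeNormedModType R[i];
  mxnorm : forall n, 'M[os_sort]_n -> R;
  mxnorm1 : forall a : 'M[os_sort]_1, mxnorm a = rnorm (a 0 0);
  os_embedding : exists (H : hilbert R) (u : {linear os_sort -> bop H H}),
    completely_isometric mxnorm u }.

Definition multiplicative (R : realType) (V : normedModType R[i])
    (mul : V -> V -> V) (H : hilbert R) (u : {linear V -> bop H H}) : Prop :=
  forall a b, u (mul a b) = bop_comp (u a) (u b).

(* Algebras are not assumed unital. *)
Record operator_algebra (R : realType) := OperatorAlgebra {
  oa_space :> operator_space R;
  oa_mul : {bilinear oa_space -> oa_space -> oa_space};
  oa_mulA : associative oa_mul;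
  oa_norm_mul : forall a b : oa_space, `|oa_mul a b| <= `|a| * `|b|;
  oa_embedding : exists (H : hilbert R) (u : {linear oa_space -> bop H H}),
    multiplicative oa_mul u /\ completely_isometric (@mxnorm R oa_space) u }.

Section OperatorAlgebras.
Context (R : realType).
Implicit Types A B : operator_algebra R.

Definition representation A (H : hilbert R) (u : {linear A -> bop H H}) : Prop :=
  multiplicative (oa_mul A) u /\ completely_contractive (@mxnorm R A) u.

Definition completely_isometric_representation A (H : hilbert R)
    (u : {linear A -> bop H H}) : Prop :=
  representation u /\ completely_isometric (@mxnorm R A) u.

Definition strongly_Delta_equivalent A B : Prop :=
  exists (H K : hilbert R)
    (alpha : {linear A -> bop H H}) (beta : {linear B -> bop K K}),
    [/\ completely_isometric_representation alpha,
        completely_isometric_representation beta &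
        strongly_TRO_equivalent (range alpha) (range beta)].

(* Directed (pre)ordered index sets of nets, and the filter of their tails:
   convergence of a net is convergence along this filter. *)
Definition directed (I : Type) (le : I -> I -> Prop) : Prop :=
  [/\ inhabited I, (forall i, le i i),
      (forall i j k, le i j -> le j k -> le i k) &
      (forall i j, exists k, le i k /\ le j k)].

Definition tails (I : Type) (le : I -> I -> Prop) : set_system I :=
  filter_from [set: I] (fun i => [set j | le i j]).

Definition has_contractive_approximate_identity A : Prop :=
  exists (I : Type) (le : I -> I -> Prop) (e : I -> A),
    [/\ directed le,
        (forall i, `|e i| <= 1),
        (forall a : A, oa_mul A (e i) a @[i --> tails le] --> a) &
        (forall a : A, oa_mul A a (e i) @[i --> tails le] --> a)].

End OperatorAlgebras.

(* Main.v *)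
From HB Require Import structures.
From mathcomp Require Import all_boot all_order all_algebra.
From mathcomp Require Import all_classical all_reals topology normedtype sequences.
From mathcomp Require Import complex ring lra.
Require Import Defs.

(** Reflexivity holds in any completely isometric representation, with the scalar
    operators as TRO, and symmetry follows from the existence of adjoints: replace
    the TRO [M] by [M^*].

    For transitivity, equivalences of [A] with [B] and of [B] with [C] come with two
    unrelated representations [beta] and [pi] of [B]. Two equivalences through the
    same concrete algebra [B] do compose ([strongly_TRO_trans]): if [M] and [N] are
    the two TROs and [E] is the diagonal of the idealizer of [B], then [M M^*] and
    [N^* N] are contained in [E], so that the span of [N E M] is a TRO, and it
    implements the equivalence of [A] with [C]. Hence it suffices to replace the
    representation of [A] by one which is adapted to [pi] ([induced_TRO]).

    As [A] is the closed span of [M^* B M], it should act on the tensor product over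
    [M M^*] of [M^*] with the space of [pi]. The inner product of [m^* (x) b x] and
    [n^* (x) c y] is [<pi (n m^* b) x, pi (c) y>], where [n m^* b] is in [B]. The
    difficulty is its positivity, since [M M^*] does not act on the space of [pi].
    It follows from a single principle ([transfer]): if a matrix [Z] of left
    multipliers of [B] is accretive in [beta], then it is accretive in [pi]. Indeed
    accretivity means that [|1 - s Z|^2 <= 1 + O(s^2)] as [s] decreases to [0], and
    approximate identities of [B] make this a statement about the matrix norms of
    [B], which both representations share. This is applied to the compressions
    [m_i Theta_pq m_j^*] of accretive matrices [Theta] of operators on the space of
    [A]. The identity gives the positivity of the form, the scalars [i] and [- i] its
    symmetry ([form1_Im], [form1_herm]). The two by two block matrix with rows
    [(C, 0)] and [(- 2 a, C)] is accretive exactly when [|a| <= C], so it gives the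
    complete contractivity of the induced representation of [A]. The same principle
    with [beta] and [pi] exchanged ([reverse_accretive]), together with an
    approximate identity of [A], makes it completely isometric ([induced_ci]).

    The induced Hilbert space is the reproducing kernel space of this form
    ([kolmogorov]). It is built as a space of bounded functionals, which is complete
    for free; that the functionals coming from vectors are dense in it
    ([sec_dense]) is seen by perturbing a vector where a functional nearly attains
    its norm. The same lemma gives the Riesz representation theorem, hence the
    existence of adjoints. *)

Set Implicit Arguments.
Unset Strict Implicit.
Unset Printing Implicit Defensive.

Import Order.TTheory GRing.Theory Num.Theory.
Import numFieldNormedType.Exports.
Local Open Scope classical_set_scope.
Local Open Scope ring_scope.
Local Open Scope complex_scope.

(** * Complex moduli as real numbers *)

Section Modulus.
Context (R : realType).
Implicit Types (z w c : R[i]).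

Definition cmod z : R := complex.Re `|z|.

Lemma cmodE z : (cmod z)%:C = `|z|.
Proof. by rewrite /cmod (RRe_real (normr_real z)). Qed.

Lemma cmod_ge0 z : 0 <= cmod z.
Proof. by rewrite -lecR cmodE normr_ge0. Qed.

Lemma cmod0 : cmod 0 = 0.
Proof. by apply: complexI; rewrite cmodE normr0. Qed.

Lemma cmodM z w : cmod (z * w) = cmod z * cmod w.
Proof. by apply: complexI; rewrite rmorphM /= !cmodE normrM. Qed.

Lemma cmodD z w : cmod (z + w) <= cmod z + cmod w.
Proof. by rewrite -lecR rmorphD /= !cmodE ler_normD. Qed.

Lemma cmodN z : cmod (- z) = cmod z.
Proof. by rewrite /cmod normrN. Qed.

Lemma cmod_distC z w : cmod (z - w) = cmod (w - z).
Proof. by rewrite /cmod distrC. Qed.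

Lemma cmodR (x : R) : cmod x%:C = `|x|.
Proof.
by rewrite /cmod normc_def /= expr0n /= addr0 sqrtr_sqr.
Qed.

Lemma cmod_conj z : cmod (conjc z) = cmod z.
Proof. by rewrite /cmod normcJ. Qed.

Lemma conjcM z w : conjc (z * w) = conjc z * conjc w.
Proof. exact: rmorphM. Qed.

Lemma conjcD z w : conjc (z + w) = conjc z + conjc w.
Proof. exact: rmorphD. Qed.

Lemma cmod_eq0 z : cmod z = 0 -> z = 0.
Proof. by move=> z0; apply/normr0_eq0; rewrite -cmodE z0. Qed.

Lemma Re_le_cmod z : complex.Re z <= cmod z.
Proof.
have := normc_ge_Re z; rewrite -cmodE lecR; apply: le_trans; exact: ler_norm.
Qed.

Lemma cmod_sum (I : Type) (r : seq I) (P : pred I) (F : I -> R[i]) :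
  cmod (\sum_(i <- r | P i) F i) <= \sum_(i <- r | P i) cmod (F i).
Proof.
elim/big_rec2 : _ => [|i y z _ H]; first by rewrite cmod0.
by rewrite (le_trans (cmodD _ _))// lerD2l.
Qed.

Lemma cmod_le (x y : R) : cmod (x +i* y) <= `|x| + `|y|.
Proof.
have -> : x +i* y = x%:C + 'i * y%:C by rewrite [LHS]complexE.
rewrite (le_trans (cmodD _ _))// cmodM !cmodR.
have -> : cmod ('i : R[i]) = 1.
  by rewrite /cmod normc_def /= expr0n /= add0r expr1n sqrtr1.
by rewrite mul1r.
Qed.

Lemma rotation z : exists2 c, cmod c = 1 & c * z = (cmod z)%:C.
Proof.
have [->|z0] := eqVneq z 0.
  by exists 1; rewrite ?mulr0 ?cmod0// /cmod normr1.
exists (`|z| / z).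
  apply: complexI; rewrite cmodE normrM normfV normr_id mulfV//.
  by rewrite normr_eq0.
by rewrite divfK// cmodE.
Qed.

Lemma ReZ (x : R) z : complex.Re (x%:C * z) = x * complex.Re z.
Proof. by case: z => a b; rewrite /= mul0r subr0. Qed.

Lemma ReD z w : complex.Re (z + w) = complex.Re z + complex.Re w.
Proof. by rewrite raddfD. Qed.

Lemma ReN z : complex.Re (- z) = - complex.Re z.
Proof. by rewrite raddfN. Qed.

Lemma Re_conj z : complex.Re (conjc z) = complex.Re z.
Proof. by case: z. Qed.

Lemma Re_sum (I : Type) (r : seq I) (P : pred I) (F : I -> R[i]) :
  complex.Re (\sum_(i <- r | P i) F i) = \sum_(i <- r | P i) complex.Re (F i).
Proof. by rewrite raddf_sum. Qed.

End Modulus.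

(** * Rapidly Cauchy sequences *)

Section Rapid.
Context (R : realType).

(** Approximations are chosen with error [1/(n+1)], so that Cauchy sequences and
    their limits come with explicit errors, and inequalities pass to the limit by
    [le_rate]. *)
Definition rate (n : nat) : R := n.+1%:R^-1.

Lemma rate_gt0 n : 0 < rate n. Proof. by rewrite invr_gt0. Qed.

Lemma rate_lt (e : R) : 0 < e -> exists n, rate n < e.
Proof.
move=> e0; exists (Num.truncn e^-1).
by rewrite /rate invf_plt ?posrE// truncnS_gt.
Qed.

Lemma rate_le (n m : nat) : (n <= m)%N -> rate m <= rate n.
Proof. by move=> nm; rewrite lef_pV2 ?posrE// ler_nat ltnS. Qed.

Lemma le_rate (x y c : R) : (forall n, x <= y + c * rate n) -> x <= y.
Proof.
move=> H; rewrite leNgt; apply/negP => yx.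
have c0 : 0 < `|c| + 1 by rewrite ltr_pwDr.
have [n] := @rate_lt ((x - y) / (`|c| + 1)) ltac:(by rewrite divr_gt0 ?subr_gt0).
rewrite ltr_pdivlMr// => h; have := H n; rewrite leNgt => /negP; apply.
rewrite -ltrBrDl (le_lt_trans _ h)// mulrC ler_pM2l ?rate_gt0//.
by rewrite (le_trans (ler_norm c))// lerDl.
Qed.

Lemma le_eps (x y : R) : (forall e, 0 < e -> x <= y + e) -> x <= y.
Proof. by move=> H; apply/ler_addgt0Pl => e e0; rewrite addrC H. Qed.

End Rapid.
Arguments rate {R}.

Section RapidComplete.
Context (R : realType).

Lemma rnormN (V : normedModType R[i]) (x : V) : rnorm (- x) = rnorm x.
Proof. by rewrite /rnorm normrN. Qed.

Lemma rnorm_distC (V : normedModType R[i]) (x y : V) :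
  rnorm (x - y) = rnorm (y - x).
Proof. by rewrite /rnorm distrC. Qed.

Lemma rnorm_triangle (V : normedModType R[i]) (y x z : V) :
  rnorm (x - z) <= rnorm (x - y) + rnorm (y - z).
Proof. by rewrite (le_trans _ (rnormD _ _))// addrA subrK. Qed.

Lemma ball_rnorm (V : normedModType R[i]) (x y : V) (e : R) :
  ball x e%:C y = (rnorm (x - y) < e) :> Prop.
Proof. by rewrite -ball_normE /ball_/= -rnormE ltcR. Qed.

Lemma gt0_realC (e : R[i]) : 0 < e -> e = (complex.Re e)%:C /\ 0 < complex.Re e.
Proof.
case: e => a b; rewrite ltcE /= => /andP[/eqP -> a0]; split => //.
Qed.

Lemma rapid_real (u : nat -> R) (c : R) :
  (forall n m, `|u n - u m| <= c * (rate n + rate m)) ->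
  exists l, forall n, `|u n - l| <= c * rate n.
Proof.
move=> H.
have : cauchy (u @ \oo).
  apply/cauchy_exP => e e0.
  have c0 : 0 <= c.
    have := le_trans (normr_ge0 _) (H 0%N 0%N).
    by rewrite pmulr_lge0// addr_gt0// rate_gt0.
  have [N hN] := @rate_lt R (e / (2 * (c + 1))) ltac:(by rewrite divr_gt0// mulr_gt0// ltr_wpDl).
  exists (u N); exists N => // n /= Nn.
  rewrite -ball_normE /= (le_lt_trans (H _ _))//.
  apply: (@le_lt_trans _ _ (c * (rate N + rate N))).
    by rewrite ler_wpM2l// lerD2l rate_le.
  move: hN; rewrite ltr_pdivlMr ?mulr_gt0 ?ltr_wpDl// => hN.
  have := rate_gt0 R N; nra.
move=> /cauchy_cvgP/cvg_ex[l ul]; exists l => n.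
apply: (@le_rate _ _ _ (c + 1)) => m.
have := (@cvgr_dist_lt _ _ _ _ _ _ _ ul (rate m) (rate_gt0 _ _)) => -[N _ hN].
have := hN (maxn N m) (leq_maxl _ _) => /=; set k := maxn N m => h.
have c0 : 0 <= c.
  have := le_trans (normr_ge0 _) (H 0%N 0%N).
  by rewrite pmulr_lge0// addr_gt0// rate_gt0.
rewrite distrC in h.
have := H n k; have : rate k <= rate m :> R by rewrite rate_le// leq_maxr.
have := ler_normD (u n - u k) (u k - l); rewrite addrA subrK.
move=> h1 h2 h3.
have h4 := ler_wpM2l c0 h2; lra.
Qed.

Lemma rapid_complete (V : completeNormedModType R[i]) (u : nat -> V) (c : R) :
  (forall n m, rnorm (u n - u m) <= c * (rate n + rate m)) ->
  exists l, forall n, rnorm (u n - l) <= c * rate n.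
Proof.
move=> H.
have c0 : 0 <= c.
  have := le_trans (rnorm_ge0 _) (H 0%N 0%N).
  by rewrite pmulr_lge0// addr_gt0// rate_gt0.
have : cauchy (u @ \oo).
  apply/cauchy_exP => e' /gt0_realC[-> e0]; set e := complex.Re e' in e0 *.
  have [N hN] := @rate_lt R (e / (2 * (c + 1))) ltac:(by rewrite divr_gt0// mulr_gt0// ltr_wpDl).
  exists (u N); exists N => // n /= Nn.
  rewrite /= ball_rnorm (le_lt_trans (H _ _))//.
  apply: (@le_lt_trans _ _ (c * (rate N + rate N))).
    by rewrite ler_wpM2l// lerD2l rate_le.
  move: hN; rewrite ltr_pdivlMr ?mulr_gt0 ?ltr_wpDl// => hN.
  have := rate_gt0 R N; nra.
move=> /cauchy_cvgP/cvg_ex[l ul]; exists l => n.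
apply: (@le_rate _ _ _ (c + 1)) => m.
have r0 : 0 < (rate m : R)%:C by rewrite ltcR rate_gt0.
have := (@cvgr_dist_lt _ _ _ _ _ _ _ ul _ r0) => -[N _ hN].
have := hN (maxn N m) (leq_maxl _ _) => /=; set k := maxn N m.
rewrite -rnormE ltcR rnorm_distC => h.
have := H n k; have : rate k <= rate m :> R by rewrite rate_le// leq_maxr.
have := rnorm_triangle (u k) (u n) l.
move=> h1 h2 h3.
have h4 := ler_wpM2l c0 h2; lra.
Qed.

Lemma rapid_complex (u : nat -> R[i]) (c : R) :
  (forall n m, cmod (u n - u m) <= c * (rate n + rate m)) ->
  exists l, forall n, cmod (u n - l) <= c * rate n.
Proof.
move=> H.
have c0 : 0 <= c.
  have := le_trans (cmod_ge0 _) (H 0%N 0%N).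
  by rewrite pmulr_lge0// addr_gt0// rate_gt0.
have [a ha] : exists l, forall n, `|complex.Re (u n) - l| <= c * rate n.
  apply: rapid_real => n m; apply: le_trans (H n m).
  rewrite -raddfB /=; move: (u n - u m) => z.
  by have := normc_ge_Re z; rewrite -cmodE lecR.
have [b hb] : exists l, forall n, `|complex.Im (u n) - l| <= c * rate n.
  apply: rapid_real => n m; apply: le_trans (H n m).
  rewrite -raddfB /=; move: (u n - u m) => z.
  have := normc_ge_Re ('i * z); rewrite -cmodE lecR mulrC ReiNIm normrN cmodM.
  by rewrite -[cmod 'i]/(cmod (0 +i* 1)) /cmod normc_def /= expr0n expr1n add0r sqrtr1 mulr1.
exists (a +i* b) => n; apply: (@le_rate _ _ _ (3 * c)) => m.
have := cmodD (u n - u m) (u m - (a +i* b)); rewrite addrA subrK => h.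
have := H n m; have := ha m; have := hb m => h1 h2 h3.
have : cmod (u m - (a +i* b)) <= 2 * c * rate m.
  case: (u m) h1 h2 => x y /= h1 h2.
  have := cmod_le (x - a) (y - b); rewrite -[(x - a) +i* (y - b)]/((x +i* y) - (a +i* b)).
  lra.
lra.
Qed.

End RapidComplete.

(** * Real inner products in Hilbert spaces *)

Section RealInner.
Context (R : realType).
Implicit Types (H K : hilbert R).

Lemma innerC H (x y : H) : inner H y x = conjc (inner H x y).
Proof. by rewrite [LHS](@hermC _ _ _ _ (inner H)) /= expr0 mul1r. Qed.

Lemma innerDl H (x y z : H) : inner H (x + y) z = inner H x z + inner H y z.
Proof. exact: linearDl. Qed.

Lemma innerZl H c (x z : H) : inner H (c *: x) z = c * inner H x z.
Proof. exact: linearZl_LR. Qed.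

Lemma inner0l H (z : H) : inner H 0 z = 0.
Proof. exact: linear0l. Qed.

Lemma innerBl H (x y z : H) : inner H (x - y) z = inner H x z - inner H y z.
Proof. by rewrite -scaleN1r innerDl innerZl mulN1r. Qed.

Lemma innerDr H (x y z : H) : inner H z (x + y) = inner H z x + inner H z y.
Proof. by rewrite innerC innerDl conjcD -!innerC. Qed.

Lemma innerZr H c (x z : H) : inner H z (c *: x) = conjc c * inner H z x.
Proof. by rewrite innerC innerZl conjcM -innerC. Qed.

Lemma inner0r H (z : H) : inner H z 0 = 0.
Proof. by rewrite innerC inner0l conjc0. Qed.

Definition rip H (x y : H) : R := complex.Re (inner H x y).

Lemma ripC H (x y : H) : rip x y = rip y x.
Proof. by rewrite /rip (innerC x y) Re_conj. Qed.

Lemma ripDl H (x y z : H) : rip (x + y) z = rip x z + rip y z.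
Proof. by rewrite /rip linearDl /= raddfD. Qed.

Lemma ripDr H (x y z : H) : rip z (x + y) = rip z x + rip z y.
Proof. by rewrite ripC ripDl !(ripC z). Qed.

Lemma ripNl H (x z : H) : rip (- x) z = - rip x z.
Proof. by rewrite /rip linearNl /= raddfN. Qed.

Lemma ripNr H (x z : H) : rip z (- x) = - rip z x.
Proof. by rewrite ripC ripNl ripC. Qed.

Lemma ripZl H (c : R) (x z : H) : rip (c%:C *: x) z = c * rip x z.
Proof. by rewrite /rip linearZl_LR /= ReZ. Qed.

Lemma ripZr H (c : R) (x z : H) : rip z (c%:C *: x) = c * rip z x.
Proof. by rewrite ripC ripZl ripC. Qed.

Lemma rip0l H (x : H) : rip 0 x = 0.
Proof. by rewrite /rip linear0l. Qed.

Lemma rip0r H (x : H) : rip x 0 = 0.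
Proof. by rewrite ripC rip0l. Qed.

Lemma rip_suml H (I : Type) (r : seq I) (P : pred I) (F : I -> H) z :
  rip (\sum_(i <- r | P i) F i) z = \sum_(i <- r | P i) rip (F i) z.
Proof. by elim/big_rec2 : _ => [|i y x _ <-]; rewrite ?rip0l// ripDl. Qed.

Lemma rip_sumr H (I : Type) (r : seq I) (P : pred I) (F : I -> H) z :
  rip z (\sum_(i <- r | P i) F i) = \sum_(i <- r | P i) rip z (F i).
Proof. by rewrite ripC rip_suml; apply: eq_bigr => i _; rewrite ripC. Qed.

Lemma rip_norm H (x : H) : rip x x = rnorm x ^+ 2.
Proof.
apply: complexI; rewrite rmorphXn /= rnormE inner_norm /rip.
by rewrite RRe_real// ger0_real// -inner_norm exprn_ge0.
Qed.

Lemma rnormD_sq H (x y : H) :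
  rnorm (x + y) ^+ 2 = rnorm x ^+ 2 + 2 * rip x y + rnorm y ^+ 2.
Proof. by rewrite -!rip_norm !ripDl !ripDr (ripC y x); ring. Qed.

Lemma rnormB_sq H (x y : H) :
  rnorm (x - y) ^+ 2 = rnorm x ^+ 2 - 2 * rip x y + rnorm y ^+ 2.
Proof. by rewrite rnormD_sq ripNr rnormN; ring. Qed.

Lemma rip_CS H (x y : H) : rip x y <= rnorm x * rnorm y.
Proof.
have [y0|y0] := eqVneq (rnorm y) 0.
  by rewrite y0 (rnorm0_eq0 y0) rip0r mulr0.
have := sqr_ge0 (rnorm ((rnorm y)%:C *: x - (rnorm x)%:C *: y)).
rewrite rnormB_sq !ripZl !ripZr !rnormZ -!/(cmod _) !cmodR !ger0_norm ?rnorm_ge0//.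
have y1 : 0 < rnorm y by rewrite lt_def y0 rnorm_ge0.
have [x0|x0] := eqVneq (rnorm x) 0.
  by move=> _; rewrite x0 (rnorm0_eq0 x0) rip0l mul0r.
have x1 : 0 < rnorm x by rewrite lt_def x0 rnorm_ge0.
have xy : 0 < rnorm x * rnorm y by rewrite mulr_gt0.
move: (rip x y) (rnorm x) (rnorm y) xy {x0 y0} x1 y1 => p a b ab a0 b0 h.
rewrite -subr_ge0 -(pmulr_rge0 _ ab); nra.
Qed.

Lemma inner_CS H (x y : H) : cmod (inner H x y) <= rnorm x * rnorm y.
Proof.
have [c c1 hc] := rotation (inner H x y).
have : rip (c *: x) y = cmod (inner H x y) by rewrite /rip linearZl_LR /= hc.
by move=> <-; rewrite (le_trans (rip_CS _ _))// rnormZ -/(cmod _) c1 mul1r.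
Qed.

End RealInner.

(** * Reproducing kernel Hilbert spaces *)

Record pos_kernel (R : realType) (X : Type) := PosKernel {
  ker :> X -> X -> R[i];
  ker_herm : forall x y, ker y x = conjc (ker x y);
  ker_pos : forall s : seq (R[i] * X),
    0 <= complex.Re (\sum_(p <- s) \sum_(q <- s) (conjc q.1) * (p.1 * ker p.2 q.2)) }.

Section FormalSums.
Context (R : realType) (X : Type) (k : pos_kernel R X).
Implicit Types (s t : seq (R[i] * X)) (phi psi : X -> R[i]) (c : R[i]).

(** A finite sequence [s] stands for a formal combination of points; functions
    on points extend to formal combinations antilinearly, as [f |-> <f, s>]. *)
Definition ev phi s : R[i] := \sum_(p <- s) (conjc p.1) * phi p.2.
Definition scl c s := [seq (c * p.1, p.2) | p <- s].
Definition sec s : X -> R[i] := fun y => \sum_(p <- s) p.1 * k p.2 y.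

Lemma ev_cat phi s t : ev phi (s ++ t) = ev phi s + ev phi t.
Proof. by rewrite /ev big_cat. Qed.

Lemma ev_scl phi c s : ev phi (scl c s) = conjc c * ev phi s.
Proof.
rewrite /ev big_map mulr_sumr; apply: eq_bigr => p _ /=.
by rewrite rmorphM /= mulrA.
Qed.

Lemma ev_lin phi psi c s : ev (fun x => c * phi x + psi x) s = c * ev phi s + ev psi s.
Proof.
rewrite /ev mulr_sumr -big_split; apply: eq_bigr => p _ /=; ring.
Qed.

Lemma sec_cat s t y : sec (s ++ t) y = sec s y + sec t y.
Proof. by rewrite /sec big_cat. Qed.

Lemma sec_scl c s y : sec (scl c s) y = c * sec s y.
Proof.
by rewrite /sec big_map mulr_sumr; apply: eq_bigr => p _ /=; rewrite mulrA.
Qed.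

Definition ksum s t := ev (sec s) t.

Lemma ksumC s t : ksum t s = conjc (ksum s t).
Proof.
rewrite /ksum /ev /sec.
transitivity (\sum_(q <- s) \sum_(p <- t) (conjc q.1) * (p.1 * k p.2 q.2)).
  by apply: eq_bigr => q _; rewrite mulr_sumr.
rewrite exchange_big rmorph_sum; apply: eq_bigr => p _ /=.
rewrite rmorphM /= conjcK rmorph_sum mulr_sumr; apply: eq_bigr => q _ /=.
by rewrite rmorphM /= -ker_herm mulrCA.
Qed.

Lemma ksum_catl s s' t : ksum (s ++ s') t = ksum s t + ksum s' t.
Proof.
by rewrite ksumC /ksum ev_cat rmorphD /= -!/(ksum _ _) -!ksumC.
Qed.

Lemma ksum_scll c s t : ksum (scl c s) t = c * ksum s t.
Proof.
by rewrite ksumC /ksum ev_scl rmorphM /= conjcK -/(ksum _ _) -ksumC.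
Qed.

Definition knorm2 s : R := complex.Re (ksum s s).

Lemma knorm2_ge0 s : 0 <= knorm2 s.
Proof.
have := ker_pos k s; rewrite exchange_big; congr (0 <= complex.Re _).
by apply: eq_bigr => q _; rewrite mulr_sumr.
Qed.

Lemma ksum_real s : ksum s s = (knorm2 s)%:C.
Proof.
have := ksumC s s; rewrite /knorm2; case: (ksum s s) => a b [] h.
by have -> : b = 0 by lra.
Qed.

Lemma knorm2_comb s t c :
  knorm2 (s ++ scl c t) =
  knorm2 s + 2 * complex.Re ((conjc c) * ksum s t) + cmod c ^+ 2 * knorm2 t.
Proof.
rewrite /knorm2 {1}/ksum ev_cat ev_scl -!/(ksum _ _) !ksum_catl !ksum_scll.
rewrite (ksumC s t) !ksum_real mulrDr mulrA.
have -> : conjc c * c = (cmod c ^+ 2)%:C.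
  by rewrite rmorphXn /= cmodE sqr_normc mulrC.
set z := conjc c * ksum s t.
have -> : c * (conjc (ksum s t)) = conjc z by rewrite /z rmorphM /= conjcK.
rewrite !raddfD /=; move: z => [a b]; simpl.
ring.
Qed.

Definition knorm s : R := Num.sqrt (knorm2 s).

Lemma knorm_ge0 s : 0 <= knorm s. Proof. exact: sqrtr_ge0. Qed.

Lemma knorm_sq s : knorm s ^+ 2 = knorm2 s.
Proof. by rewrite sqr_sqrtr// knorm2_ge0. Qed.

Lemma knorm_scl c s : knorm (scl c s) = cmod c * knorm s.
Proof.
rewrite /knorm /knorm2 /ksum ev_scl -/(ksum _ _) ksum_scll ksum_real mulrA.
have -> : conjc c * c = (cmod c ^+ 2)%:C.
  by rewrite rmorphXn /= cmodE sqr_normc mulrC.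
rewrite -rmorphM /= sqrtrM ?sqr_ge0// sqrtr_sqr ger0_norm ?cmod_ge0//.
Qed.

Lemma ev_rotate phi t :
  exists2 c, cmod c = 1 & (conjc c) * ev phi t = (cmod (ev phi t))%:C.
Proof.
have [c c1 hc] := rotation (ev phi t).
by exists (conjc c); rewrite ?cmod_conj ?conjcK.
Qed.

Lemma ksum_CS s t : cmod (ksum s t) <= knorm s * knorm t.
Proof.
rewrite -ler_sqr ?nnegrE ?mulr_ge0 ?cmod_ge0 ?knorm_ge0// exprMn !knorm_sq.
have [c c1 hc] := ev_rotate (sec s) t; rewrite -/(ksum _ _) in hc *.
have Q r : 0 <= knorm2 s + 2 * r * cmod (ksum s t) + r ^+ 2 * knorm2 t.
  have := knorm2_ge0 (s ++ scl (r%:C * c) t).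
  rewrite knorm2_comb conjcM -[_ * conjc c * _]mulrA hc.
  by rewrite conjc_real -rmorphM /= cmodM c1 mulr1 cmodR real_normK ?num_real// mulrA.
have := knorm2_ge0 s; have := knorm2_ge0 t; have := cmod_ge0 (ksum s t).
move: (cmod _) (knorm2 s) (knorm2 t) Q => p a b Q p0 b0 a0.
have [b00|bn] := eqVneq b 0.
  have [->|pn] := eqVneq p 0; first by rewrite expr0n /= mulr_ge0.
  have p1 : 0 < p by rewrite lt_def pn.
  have := Q (- (a + 1) / (2 * p)); rewrite b00 mulr0 addr0.
  have -> : 2 * (- (a + 1) / (2 * p)) * p = - (a + 1) by field.
  by move=> h; exfalso; move: h; lra.
have b1 : 0 < b by rewrite lt_def bn.
have := Q (- p / b).
have -> : a + 2 * (- p / b) * p + (- p / b) ^+ 2 * b = (a * b - p ^+ 2) / b by field.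
by rewrite pmulr_lge0 ?invr_gt0// subr_ge0.
Qed.

Definition kbounded : {pred X -> R[i]} := fun phi =>
  `[< exists M : R, forall t, cmod (ev phi t) <= M * knorm t >].

Lemma kbounded_submod : submod_closed kbounded.
Proof.
split.
  apply/asboolP; exists 0 => t; rewrite mul0r /ev big1 ?cmod0// => p _.
  by rewrite mulr0.
move=> c f g /asboolP[M fM] /asboolP[N gN].
apply/asboolP; exists (cmod c * M + N) => t.
rewrite -[c *: f + g]/(fun x => c * f x + g x) ev_lin.
by rewrite (le_trans (cmodD _ _))// cmodM mulrDl lerD// -mulrA ler_wpM2l// cmod_ge0.
Qed.

Lemma sec_kbounded s : sec s \in kbounded.
Proof. by apply/asboolP; exists (knorm s) => t; exact: ksum_CS. Qed.

Definition rknorm phi : R := sup [set cmod (ev phi t) | t in [set t | knorm t <= 1]].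

Lemma knorm_nil : knorm [::] = 0.
Proof. by rewrite /knorm /knorm2 /ksum /ev big_nil sqrtr0. Qed.

Lemma rknorm_has_sup phi : phi \in kbounded ->
  has_sup [set cmod (ev phi t) | t in [set t | knorm t <= 1]].
Proof.
move=> /asboolP[M phiM]; split.
  by exists (cmod (ev phi [::])), [::] => //=; rewrite knorm_nil.
exists `|M| => _ [t /= t1 <-].
rewrite (le_trans (phiM t))// (le_trans (ler_wpM2r (knorm_ge0 _) (ler_norm M)))//.
by rewrite ler_piMr.
Qed.

Lemma rknorm_ge0 phi : phi \in kbounded -> 0 <= rknorm phi.
Proof.
move=> bphi; apply: le_trans (cmod_ge0 (ev phi [::])) _.
apply: sup_upper_bound; first exact: rknorm_has_sup.
by exists [::] => //=; rewrite knorm_nil.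
Qed.

Lemma ev_le phi t : phi \in kbounded -> cmod (ev phi t) <= rknorm phi * knorm t.
Proof.
move=> bphi; have [t0|t0] := eqVneq (knorm t) 0.
  by case/asboolP: bphi => M phiM; rewrite (le_trans (phiM t))// t0 !mulr0.
have t1 : 0 < knorm t by rewrite lt_def t0 knorm_ge0.
have : cmod (ev phi (scl ((knorm t)^-1)%:C t)) <= rknorm phi.
  apply: sup_upper_bound; first exact: rknorm_has_sup.
  exists (scl ((knorm t)^-1)%:C t) => //=.
  by rewrite knorm_scl cmodR ger0_norm ?invr_ge0 ?knorm_ge0// mulVf.
rewrite ev_scl cmodM conjc_real cmodR ger0_norm ?invr_ge0 ?knorm_ge0//.
by rewrite ler_pdivrMl// mulrC.
Qed.

Lemma rknorm_lub phi M : 0 <= M ->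
  (forall t, cmod (ev phi t) <= M * knorm t) -> rknorm phi <= M.
Proof.
move=> M0 phiM; apply: ge_sup.
  by exists (cmod (ev phi [::])), [::] => //=; rewrite knorm_nil.
by move=> _ [t /= t1 <-]; rewrite (le_trans (phiM t))// ler_piMr.
Qed.

(** A functional nearly attains its norm at some formal sum, and perturbing
    that sum in every direction shows that it nearly represents the functional:
    hence sections are dense among the bounded functionals. *)
Lemma sec_dense phi (e : R) : phi \in kbounded -> 0 < e ->
  exists s, forall t, cmod (ev phi t - ksum s t) <= e * knorm t.
Proof.
move=> bphi e0; pose L := rknorm phi.
have L0 : 0 <= L by exact: rknorm_ge0.
have phiL t : cmod (ev phi t) <= L * knorm t by exact: ev_le.
(* With this [eta], the defect [eta * e / 2] of [v] and the second-order term
   [L * eta ^+ 2 / 2] add up to at most [eta * e]. *)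
pose eta := e / (1 + L).
have L1 : 0 < 1 + L by rewrite ltr_pwDl.
have eta0 : 0 < eta by rewrite divr_gt0.
have [_ [u /= u1 <-]] := @sup_adherent _ _ (eta * e / 2)
  ltac:(by rewrite !mulr_gt0// invr_gt0) (rknorm_has_sup bphi).
rewrite -/(rknorm phi) -/L => uL.
have [c c1 hc] := ev_rotate phi u.
pose v := scl c u.
have v1 : knorm2 v <= 1.
  by rewrite -knorm_sq knorm_scl c1 mul1r expr_le1// knorm_ge0.
have phiv : ev phi v = (cmod (ev phi u))%:C by rewrite ev_scl hc.
exists (scl L%:C v) => t; rewrite ksum_scll.
have [d d1 hd] := rotation (ev phi t - L%:C * ksum v t).
set D := cmod _ in hd *.
have D0 : 0 <= D by exact: cmod_ge0.
(* One-sided difference quotient of the norm at v in the rotated direction. *)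
have key (tau : R) : 0 < tau ->
    tau * D <= eta * e / 2 + L * tau ^+ 2 * knorm2 t / 2.
  move=> tau0; set t' := scl (tau%:C * conjc d) t.
  have := phiL (v ++ t').
  set m := knorm (v ++ t'); set q := complex.Re (tau%:C * d * ksum v t).
  have m2 : m ^+ 2 <= 1 + 2 * q + tau ^+ 2 * knorm2 t.
    rewrite knorm_sq knorm2_comb conjcM conjc_real conjcK.
    rewrite cmodM cmodR cmod_conj d1 mulr1 ger0_norm ?(ltW tau0)// -/q; lra.
  have m1 : m <= 1 + q + tau ^+ 2 * knorm2 t / 2.
    by have := sqr_ge0 (m - 1); nra.
  move=> h1; have h2 := le_trans (Re_le_cmod _) (le_trans h1 (ler_wpM2l L0 m1)).
  have : tau * D = complex.Re (tau%:C * d * ev phi t) - L * q.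
    have -> : L * q = complex.Re (L%:C * (tau%:C * d * ksum v t)) by rewrite ReZ.
    have -> : tau * D = complex.Re (tau%:C * D%:C) by rewrite ReZ.
    by rewrite -hd -ReN -ReD; congr complex.Re; ring.
  move: h2; rewrite ev_cat raddfD /= phiv ev_scl conjcM conjc_real conjcK.
  lra.
have [t0|t0] := eqVneq (knorm t) 0.
  rewrite t0 mulr0; have [//|D1] := leP D 0.
  have := key (eta * e / D) ltac:(by rewrite !mulr_gt0// invr_gt0).
  rewrite -knorm_sq t0 expr0n /= divfK ?gt_eqF//.
  have := mulr_gt0 eta0 e0; lra.
have t1 : 0 < knorm t by rewrite lt_def t0 knorm_ge0.
have := key (eta / knorm t) ltac:(by rewrite divr_gt0).
rewrite -knorm_sq.
have -> : L * (eta / knorm t) ^+ 2 * knorm t ^+ 2 / 2 = L * eta ^+ 2 / 2 by field.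
rewrite mulrAC ler_pdivrMr// => h.
have he : eta * (1 + L) = e by rewrite divfK// gt_eqF.
have h3 : eta * e / 2 + L * eta ^+ 2 / 2 <= eta * e by nra.
have h2 : eta * D <= eta * (e * knorm t).
  by apply: (le_trans h); rewrite mulrA; apply: ler_wpM2r h3; exact: ltW.
by move: h2; rewrite ler_pM2l.
Qed.

(** The functionals on formal sums that are bounded for the kernel seminorm,
    known by their values on points. A dual is complete, and formal sums are
    dense in this one by [sec_dense]: this is the completion of the formal sums,
    without any quotient. *)
Record rkhs := Rkhs { rk_fun :> X -> R[i]; rkP : rk_fun \in kbounded }.

HB.instance Definition _ := GRing.isSubmodClosed.Build R[i] (X -> R[i])
  kbounded kbounded_submod.
HB.instance Definition _ := [isSub for rk_fun].
HB.instance Definition _ := [Choice of rkhs by <:].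
HB.instance Definition _ := [SubChoice_isSubLmodule of rkhs by <:].

Definition rknormC (f : rkhs) : R[i] := (rknorm f)%:C.

Lemma rknormC_D (f g : rkhs) : rknormC (f + g) <= rknormC f + rknormC g.
Proof.
rewrite /rknormC -rmorphD lecR; apply: rknorm_lub => [|t].
  by rewrite addr_ge0// rknorm_ge0// rkP.
have -> : ev (f + g : rkhs) t = ev f t + ev g t.
  rewrite -[ev f t]mul1r -ev_lin; congr ev; apply/funext => x.
  by rewrite mul1r.
by rewrite (le_trans (cmodD _ _))// mulrDl lerD// ev_le// rkP.
Qed.

Lemma rk_ev0 t : ev (0 : rkhs) t = 0.
Proof. by rewrite /ev big1// => p _; rewrite mulr0. Qed.

Lemma rk_evlin (c : R[i]) (f g : rkhs) t :
  ev (c *: f + g : rkhs) t = c * ev f t + ev g t.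
Proof. exact: (ev_lin f g). Qed.

Lemma rknormC_leZ c (f : rkhs) : rknorm (c *: f : rkhs) <= cmod c * rknorm f.
Proof.
apply: rknorm_lub => [|t]; first by rewrite mulr_ge0 ?cmod_ge0 ?rknorm_ge0 ?rkP.
rewrite -[c *: f]addr0 rk_evlin rk_ev0 addr0 cmodM -mulrA ler_wpM2l ?cmod_ge0//.
by rewrite ev_le ?rkP.
Qed.

Lemma rknormC_Z c (f : rkhs) : rknormC (c *: f) = `|c| * rknormC f.
Proof.
rewrite /rknormC -cmodE -rmorphM /=; congr _%:C.
apply/eqP; rewrite eq_le rknormC_leZ andTb.
have [->|c0] := eqVneq c 0.
  by rewrite cmod0 mul0r (rknorm_ge0 (rkP (0 *: f))).
have c1 : 0 < cmod c.
  by rewrite lt_def cmod_ge0 andbT; apply: contra_neq c0 => /cmod_eq0.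
rewrite -ler_pdivlMl//; have := rknormC_leZ c^-1 (c *: f).
rewrite scalerA mulVf// scale1r; congr (_ <= _ * _); apply: complexI.
by rewrite fmorphV /= !cmodE normfV.
Qed.

Lemma rk_evE (f : rkhs) x : f x = ev f [:: (1, x)].
Proof. by rewrite /ev big_seq1 [conjc _]rmorph1 mul1r. Qed.

Lemma rknormC0_eq0 (f : rkhs) : rknormC f = 0 -> f = 0.
Proof.
move=> /complexI f0; apply/val_inj/funext => x /=.
apply: cmod_eq0; apply/eqP; rewrite eq_le cmod_ge0 andbT rk_evE.
by rewrite (le_trans (ev_le _ (rkP f)))// f0 mul0r.
Qed.

HB.instance Definition _ := isPointed.Build rkhs 0.
HB.instance Definition _ := Lmodule_isNormed.Build R[i] rkhs
  rknormC_D rknormC_Z rknormC0_eq0.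

Lemma rk_rnormE (f : rkhs) : rnorm f = rknorm f.
Proof. by []. Qed.

Lemma rk_ev_le (f : rkhs) t : cmod (ev f t) <= rnorm f * knorm t.
Proof. by rewrite rk_rnormE ev_le ?rkP. Qed.

Lemma rk_norm_lub (f : rkhs) M : 0 <= M ->
  (forall t, cmod (ev f t) <= M * knorm t) -> rnorm f <= M.
Proof. exact: rknorm_lub. Qed.

Definition rksec s : rkhs := Rkhs (sec_kbounded s).

Lemma rk_evB (f g : rkhs) t : ev (f - g : rkhs) t = ev f t - ev g t.
Proof.
by rewrite -[f - g]/(f + (- g)) addrC -scaleN1r rk_evlin mulN1r addrC.
Qed.

Lemma rksec_norm s : rnorm (rksec s) = knorm s.
Proof.
apply/eqP; rewrite eq_le rk_norm_lub ?knorm_ge0//=; last exact: ksum_CS.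
have := rk_ev_le (rksec s) s; rewrite -/(ksum _ _) ksum_real cmodR ger0_norm ?knorm2_ge0//.
rewrite -knorm_sq expr2; have [->|s0] := eqVneq (knorm s) 0.
  by rewrite rnorm_ge0.
by rewrite ler_pM2r// lt_def s0 knorm_ge0.
Qed.

Lemma rksec_dense (f : rkhs) e : 0 < e -> exists s, rnorm (f - rksec s) <= e.
Proof.
move=> e0; have [s hs] := sec_dense (rkP f) e0; exists s.
by apply: rk_norm_lub; [exact: ltW|move=> t; rewrite rk_evB; exact: hs].
Qed.

Lemma rk_rapid (u : nat -> rkhs) (c : R) :
  (forall n m, rnorm (u n - u m) <= c * (rate n + rate m)) ->
  exists l, forall n, rnorm (u n - l) <= c * rate n.
Proof.
move=> H.
have c0 : 0 <= c.
  have := le_trans (rnorm_ge0 _) (H 0%N 0%N).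
  by rewrite pmulr_lge0// addr_gt0// rate_gt0.
have /choice[l hl] : forall x, exists l, forall n,
    cmod (u n x - l) <= c * knorm [:: (1, x)] * rate n.
  move=> x; apply: rapid_complex => n m.
  rewrite !rk_evE -rk_evB (le_trans (rk_ev_le _ _))// mulrAC.
  by rewrite ler_wpM2r ?knorm_ge0.
have lev n t : cmod (ev (u n) t - ev l t) <= c * rate n * knorm t.
  pose a := \sum_(p <- t) cmod p.1 * (c * knorm [:: (1, p.2)]).
  apply: (@le_rate _ _ _ (c * knorm t + a)) => m.
  have -> : ev (u n) t - ev l t = ev (u n - u m : rkhs) t + (ev (u m) t - ev l t).
    by rewrite rk_evB addrA subrK.
  rewrite (le_trans (cmodD _ _))//.
  have h1 : cmod (ev (u m) t - ev l t) <= a * rate m.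
    rewrite /ev -sumrB (le_trans (cmod_sum _ _ _))// mulr_suml.
    apply: ler_sum => p _; rewrite -mulrBr cmodM cmod_conj -mulrA.
    by rewrite ler_wpM2l ?cmod_ge0.
  have h2 := le_trans (rk_ev_le (u n - u m) t) (ler_wpM2r (knorm_ge0 t) (H n m)).
  nra.
have bl : l \in kbounded.
  apply/asboolP; exists (c * rate 0 + rnorm (u 0%N)) => t.
  have := cmodD (ev (u 0%N) t) (ev l t - ev (u 0%N) t).
  rewrite [_ + (_ - _)]addrC subrK => h; rewrite (le_trans h)// mulrDl addrC.
  by rewrite lerD ?rk_ev_le// cmod_distC.
exists (Rkhs bl) => n; apply: rk_norm_lub => [|t].
  by rewrite mulr_ge0// ltW// rate_gt0.
by rewrite rk_evB.
Qed.

Lemma rk_complete (F : set_system rkhs) : ProperFilter F -> cauchy F -> cvg F.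
Proof.
move=> FF /cauchyP Fc.
have /choice[u hu] : forall n, exists x : rkhs, F (ball x (rate n : R)%:C).
  by move=> n; apply: Fc; rewrite ltcR rate_gt0.
have [|l hl] := @rk_rapid u 1.
  move=> n m; rewrite mul1r.
  have [x []] := filter_ex (filterI (hu n) (hu m)).
  rewrite !ball_rnorm => h1 h2.
  rewrite (le_trans (rnorm_triangle x _ _))// lerD ?ltW//.
  by rewrite rnorm_distC.
apply/cvg_ex; exists l; apply/cvgrPdist_lt => e' /gt0_realC[-> e0].
set e := complex.Re e' in e0 *.
have [n hn] := @rate_lt R (e / 2) ltac:(by rewrite divr_gt0).
apply: filterS (hu n) => x; rewrite ball_rnorm => h.
rewrite -rnormE ltcR (le_lt_trans (rnorm_triangle (u n) _ _))//.
have := hl n; rewrite mul1r rnorm_distC; lra.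
Qed.

HB.instance Definition _ := Uniform_isComplete.Build rkhs rk_complete.

End FormalSums.

Section RkhsInner.
Context (R : realType) (X : Type) (k : pos_kernel R X).
Implicit Types (s t : seq (R[i] * X)) (f g : rkhs k) (c : R[i]).

Lemma rksec_comb s t c : rksec k (s ++ scl c t) = rksec k s + c *: rksec k t.
Proof.
by apply/val_inj/funext => y /=; rewrite sec_cat sec_scl.
Qed.

(** The values of [f] at sections that approximate [g] form a Cauchy family. The
    estimate characterizes the inner product, and everything about it follows by
    approximation from the case of sections. *)
Lemma rk_inner_ex f g :
  exists z, forall s, cmod (z - ev f s) <= rnorm f * rnorm (g - rksec k s).
Proof.
have /choice[s hs] : forall n, exists s, rnorm (g - rksec k s) <= rate n.
  by move=> n; apply: rksec_dense; exact: rate_gt0.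
have diff t t' : cmod (ev f t - ev f t') <=
    rnorm f * (rnorm (g - rksec k t) + rnorm (g - rksec k t')).
  have -> : ev f t - ev f t' = ev f (t ++ scl (-1) t').
    by rewrite ev_cat ev_scl [conjc _]rmorphN1 mulN1r.
  rewrite (le_trans (rk_ev_le f _))// ler_wpM2l ?rnorm_ge0//.
  rewrite -rksec_norm rksec_comb scaleN1r.
  by rewrite (le_trans (rnorm_triangle g _ _))// lerD2r rnorm_distC.
have [|l hl] := @rapid_complex _ (fun n => ev f (s n)) (rnorm f).
  move=> n m; apply: (le_trans (diff _ _)).
  by rewrite ler_wpM2l ?rnorm_ge0// lerD.
exists l => t; apply: (@le_rate _ _ _ (2 * rnorm f)) => n.
have := cmodD (l - ev f (s n)) (ev f (s n) - ev f t).
rewrite addrA subrK [cmod (l - ev f (s n))]cmod_distC.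
have := hl n; rewrite /=; have := diff (s n) t; have := ler_wpM2l (rnorm_ge0 f) (hs n).
lra.
Qed.

Definition rk_inner f g : R[i] := sval (cid (rk_inner_ex f g)).

Lemma rk_innerP f g s :
  cmod (rk_inner f g - ev f s) <= rnorm f * rnorm (g - rksec k s).
Proof. by rewrite /rk_inner; case: cid => z /=; exact. Qed.

Lemma rk_inner_sec f s : rk_inner f (rksec k s) = ev f s.
Proof.
apply/eqP; rewrite -subr_eq0; apply/eqP/cmod_eq0/eqP.
rewrite eq_le cmod_ge0 andbT (le_trans (rk_innerP _ _ s))//.
by rewrite subrr rnorm0 mulr0.
Qed.

Lemma cmod_eq_small (z w : R[i]) (C : R) :
  (forall e, 0 < e -> e <= 1 -> cmod (z - w) <= C * e) -> z = w.
Proof.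
move=> h; apply/eqP; rewrite -subr_eq0; apply/eqP/cmod_eq0/eqP.
rewrite eq_le cmod_ge0 andbT; apply: (@le_rate _ _ _ C) => n; rewrite add0r.
by apply: h; rewrite ?rate_gt0// invf_le1 ?ler1n.
Qed.

Lemma rk_inner_lin c f f' g : rk_inner (c *: f + f') g = c * rk_inner f g + rk_inner f' g.
Proof.
apply: (@cmod_eq_small _ _ (rnorm (c *: f + f') + cmod c * rnorm f + rnorm f')) => e e0 _.
have [s hs] := rksec_dense g e0.
have h1 := rk_innerP (c *: f + f') g s.
have h2 := rk_innerP f g s; have h3 := rk_innerP f' g s.
have b (x : rkhs k) := ler_wpM2l (rnorm_ge0 x) hs.
have := b (c *: f + f'); have := b f; have := b f' => b3 b2 b1.
have -> : rk_inner (c *: f + f') g - (c * rk_inner f g + rk_inner f' g) =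
    (rk_inner (c *: f + f') g - ev (c *: f + f' : rkhs k) s) -
    (c * (rk_inner f g - ev f s) + (rk_inner f' g - ev f' s)).
  by rewrite rk_evlin; ring.
rewrite (le_trans (cmodD _ _))// cmodN.
have := cmodD (c * (rk_inner f g - ev f s)) (rk_inner f' g - ev f' s).
rewrite cmodM.
have := ler_wpM2l (cmod_ge0 c) (le_trans h2 b2); lra.
Qed.

Lemma rk_inner_approx f g s t (e : R) : e <= 1 ->
  rnorm (f - rksec k s) <= e -> rnorm (g - rksec k t) <= e ->
  cmod (rk_inner f g - ksum k s t) <= (rnorm f + rnorm g + 1) * e.
Proof.
move=> e1 hs ht.
have -> : rk_inner f g - ksum k s t =
    (rk_inner f g - ev f t) + ev (f - rksec k s : rkhs k) t.
  by rewrite rk_evB addrA subrK.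
have h1 := le_trans (rk_innerP f g t) (ler_wpM2l (rnorm_ge0 f) ht).
have h2 := rk_ev_le (f - rksec k s) t; rewrite -rksec_norm in h2.
have h3 : rnorm (rksec k t) <= rnorm g + 1.
  have := rnorm_triangle g (rksec k t) 0; rewrite !subr0 rnorm_distC; lra.
have h4 := ler_pM (rnorm_ge0 _) (rnorm_ge0 _) hs h3.
rewrite (le_trans (cmodD _ _))//; lra.
Qed.

Lemma rk_inner_herm f g : rk_inner g f = conjc (rk_inner f g).
Proof.
apply: (@cmod_eq_small _ _ (2 * (rnorm f + rnorm g + 1))) => e e0 e1.
have [s hs] := rksec_dense f e0; have [t ht] := rksec_dense g e0.
have h1 := rk_inner_approx e1 hs ht.
have h2 := rk_inner_approx e1 ht hs.
have -> : rk_inner g f - conjc (rk_inner f g) =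
   (rk_inner g f - ksum k t s) - conjc (rk_inner f g - ksum k s t).
  by rewrite [conjc (_ - _)]rmorphB /= -ksumC; ring.
rewrite (le_trans (cmodD _ _))// cmodN cmod_conj; lra.
Qed.

Lemma rk_inner_norm f : rk_inner f f = `|f| ^+ 2.
Proof.
rewrite -rnormE -rmorphXn /=.
apply: (@cmod_eq_small _ _ (2 * (2 * rnorm f + 1))) => e e0 e1.
have [s hs] := rksec_dense f e0.
have h1 := rk_inner_approx e1 hs hs.
have -> : rk_inner f f - (rnorm f ^+ 2)%:C =
    (rk_inner f f - ksum k s s) + (knorm k s ^+ 2 - rnorm f ^+ 2)%:C.
  by rewrite ksum_real knorm_sq rmorphB /=; ring.
rewrite (le_trans (cmodD _ _))// cmodR.
have h2 : `|knorm k s - rnorm f| <= e.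
  rewrite -rksec_norm ler_norml; apply/andP; split.
    have := rnorm_triangle (rksec k s) f 0; rewrite !subr0; lra.
  have := rnorm_triangle f (rksec k s) 0; rewrite !subr0 rnorm_distC; lra.
have h3 : `|knorm k s ^+ 2 - rnorm f ^+ 2| <= e * (2 * rnorm f + 1).
  rewrite subr_sqr normrM ler_pM//.
  have := knorm_ge0 k s; have := rnorm_ge0 f => f0 s0.
  rewrite ger0_norm ?addr_ge0//; move: h2; rewrite ler_norml => /andP[]; lra.
lra.
Qed.

Lemma rk_inner_bilinear : bilinear_for *%R (Num.conj \; *%R) (rk_inner).
Proof.
split => [g c x y|f c x y] /=; first by rewrite rk_inner_lin.
rewrite (rk_inner_herm _ f) rk_inner_lin [conjc _]rmorphD /= (rk_inner_herm f) conjcM.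
by rewrite !(rk_inner_herm f) !conjcK.
Qed.

Lemma rk_inner_hermitian f g : rk_inner f g = (-1) ^+ false * Num.conj (rk_inner g f).
Proof. by rewrite expr0 mul1r rk_inner_herm. Qed.

Lemma rk_inner_gt0 f : f != 0 -> 0 < rk_inner f f.
Proof. by move=> f0; rewrite rk_inner_norm exprn_gt0// normr_gt0. Qed.

HB.instance Definition _ := bilinear_isBilinear.Build R[i] (rkhs k) (rkhs k) R[i]
  *%R (Num.conj \; *%R) rk_inner rk_inner_bilinear.
HB.instance Definition _ := isHermitianSesquilinear.Build R[i] (rkhs k) false
  Num.conj rk_inner rk_inner_hermitian.
HB.instance Definition _ := isDotProduct.Build R[i] (rkhs k) rk_inner rk_inner_gt0.

Definition rk_hilbert : hilbert R :=
  @Hilbert R (rkhs k) rk_inner (fun f => esym (rk_inner_norm f)).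

End RkhsInner.

(** * Total families *)

Section Total.
Context (R : realType).
Implicit Types (H K : hilbert R) (X Y : Type).

Definition lcomb (V : lmodType R[i]) X (v : X -> V) (s : seq (R[i] * X)) : V :=
  \sum_(p <- s) p.1 *: v p.2.

Definition in_span (V : normedModType R[i]) X (v : X -> V) (h : V) : Prop :=
  forall e : R, 0 < e -> exists s, rnorm (h - lcomb v s) <= e.

Definition total (V : normedModType R[i]) X (v : X -> V) : Prop :=
  forall h, in_span v h.

Lemma lcomb_cat (V : lmodType R[i]) X (v : X -> V) s t :
  lcomb v (s ++ t) = lcomb v s + lcomb v t.
Proof. by rewrite /lcomb big_cat. Qed.

Lemma lcomb_scl (V : lmodType R[i]) X (v : X -> V) c s :
  lcomb v (scl c s) = c *: lcomb v s.
Proof.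
by rewrite /lcomb big_map scaler_sumr; apply: eq_bigr => p _; rewrite scalerA.
Qed.

Lemma inner_lcombl H X (v : X -> H) s z :
  inner H (lcomb v s) z = \sum_(p <- s) p.1 * inner H (v p.2) z.
Proof.
rewrite /lcomb; elim/big_rec2 : _ => [|p y x _ <-]; first by rewrite inner0l.
by rewrite innerDl innerZl.
Qed.

Lemma inner_lcombr H X (v : X -> H) s z :
  inner H z (lcomb v s) = ev (fun x => inner H z (v x)) s.
Proof.
rewrite innerC inner_lcombl rmorph_sum /=; apply: eq_bigr => p _.
by rewrite conjcM -innerC.

Qed.

Theorem kolmogorov X (k : pos_kernel R X) :
  exists (H : hilbert R) (v : X -> H),
    (forall x y, inner H (v x) (v y) = k x y) /\ total v.
Proof.
exists (rk_hilbert k), (fun x => rksec k [:: (1, x)]); split => [x y|f e e0].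
  rewrite -[LHS]/(rk_inner (rksec k [:: (1, x)]) (rksec k [:: (1, y)])).
  by rewrite rk_inner_sec -rk_evE /= /sec big_seq1 mul1r.
have [s hs] := rksec_dense f e0; exists s.
suff -> : lcomb (fun x => rksec k [:: (1, x)]) s = rksec k s by [].
elim: s {hs} => [|p s IH].
  rewrite /lcomb big_nil; apply/val_inj/funext => y /=.
  by rewrite /sec big_nil.
rewrite -cat1s lcomb_cat IH /lcomb big_seq1.
apply/val_inj/funext => y /=; rewrite -[sec k (p :: s) y]/(sec k ([:: p] ++ s) y) sec_cat; congr (_ + _).
by rewrite -[LHS]/(p.1 * sec k [:: (1, p.2)] y) /sec !big_seq1 /= mul1r.
Qed.

(** * Riesz representation on total families *)

Lemma orth_span H X (v : X -> H) (z : H) : in_span v z ->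
  (forall i, inner H z (v i) = 0) -> z = 0.
Proof.
move=> vz h; apply/rnorm0_eq0/eqP; rewrite eq_le rnorm_ge0 andbT.
apply: le_eps => e e0; rewrite add0r; have [s hs] := vz e e0.
have z0 : inner H z (lcomb v s) = 0.
  by rewrite inner_lcombr /ev big1// => p _; rewrite h mulr0.
have [->|zn] := eqVneq (rnorm z) 0; first exact: ltW.
have z1 : 0 < rnorm z by rewrite lt_def zn rnorm_ge0.
rewrite -(ler_pM2l z1) -expr2 -rip_norm.
have -> : rip z z = rip z (z - lcomb v s).
  by rewrite ripDr ripNr /rip z0 subr0.
by rewrite (le_trans (rip_CS _ _))// ler_wpM2l ?rnorm_ge0.
Qed.

Lemma inner_eq_total H X (v : X -> H) (x y : H) : total v ->
  (forall i, inner H x (v i) = inner H y (v i)) -> x = y.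
Proof.
move=> tv h; apply/eqP; rewrite -subr_eq0; apply/eqP.
by apply: (orth_span (tv _)) => i; rewrite innerBl h subrr.
Qed.

Lemma total_id H : total (fun x : H => x).
Proof.
move=> h e e0; exists [:: (1, h)].
by rewrite /lcomb big_seq1 scale1r subrr rnorm0 ltW.
Qed.

Lemma gram_herm H X (v : X -> H) x y :
  inner H (v y) (v x) = conjc (inner H (v x) (v y)).
Proof. exact: innerC. Qed.

Lemma gram_pos H X (v : X -> H) (s : seq (R[i] * X)) :
  0 <= complex.Re (\sum_(p <- s) \sum_(q <- s)
    (conjc q.1) * (p.1 * inner H (v p.2) (v q.2))).
Proof.
suff -> : \sum_(p <- s) \sum_(q <- s)
    (conjc q.1) * (p.1 * inner H (v p.2) (v q.2)) = inner H (lcomb v s) (lcomb v s).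
  by rewrite -/(rip _ _) rip_norm sqr_ge0.
rewrite inner_lcombl; apply: eq_bigr => p _.
rewrite inner_lcombr /ev mulr_sumr; apply: eq_bigr => q _.
by rewrite mulrCA.
Qed.

Definition gram H X (v : X -> H) : pos_kernel R X :=
  PosKernel (gram_herm v) (gram_pos v).

Lemma gram_ksum H X (v : X -> H) s t :
  ksum (gram v) s t = inner H (lcomb v s) (lcomb v t).
Proof.
rewrite inner_lcombr; apply: eq_bigr => p _.
by rewrite inner_lcombl.
Qed.

Lemma gram_knorm H X (v : X -> H) s : knorm (gram v) s = rnorm (lcomb v s).
Proof.
rewrite /knorm /knorm2 gram_ksum -/(rip _ _) rip_norm sqrtr_sqr.
by rewrite ger0_norm ?rnorm_ge0.
Qed.

(** A bounded functional on a total family is a bounded functional for the Gram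
    kernel; by [sec_dense] it is a limit of sections, and the corresponding
    combinations of the family converge to the representing vector. *)
Lemma riesz_total H X (v : X -> H) (g : X -> R[i]) (M : R) :
  (forall s, cmod (ev g s) <= M * rnorm (lcomb v s)) ->
  exists w, forall x, inner H w (v x) = g x.
Proof.
move=> gM.
have bg : g \in kbounded (gram v).
  by apply/asboolP; exists M => s; rewrite gram_knorm.
have /choice[s hs] : forall n, exists s, forall t,
    cmod (ev g t - ksum (gram v) s t) <= rate n * knorm (gram v) t.
  by move=> n; apply: sec_dense => //; exact: rate_gt0.
have [|w hw] := @rapid_complete _ _ (fun n => lcomb v (s n)) 1.
  move=> n m; rewrite mul1r.
  have -> : lcomb v (s n) - lcomb v (s m) = lcomb v (s n ++ scl (-1) (s m)).
    by rewrite lcomb_cat lcomb_scl scaleN1r.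
  set t := _ ++ _.
  have h : rnorm (lcomb v t) ^+ 2 <= (rate n + rate m) * rnorm (lcomb v t).
    rewrite -rip_norm /rip -gram_ksum.
    rewrite {1}/t ksum_catl ksum_scll mulN1r (le_trans (Re_le_cmod _))//.
    have -> : ksum (gram v) (s n) t - ksum (gram v) (s m) t =
      (ev g t - ksum (gram v) (s m) t) - (ev g t - ksum (gram v) (s n) t) by ring.
    rewrite (le_trans (cmodD _ _))// cmodN mulrDl addrC -gram_knorm.
    by rewrite lerD.
  have [->|t0] := eqVneq (rnorm (lcomb v t)) 0; first by rewrite addr_ge0// ltW// rate_gt0.
  by move: h; rewrite expr2 ler_pM2r// lt_def t0 rnorm_ge0.
exists w => x.
apply/eqP; rewrite -subr_eq0; apply/eqP/cmod_eq0/eqP.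
rewrite eq_le cmod_ge0 andbT.
apply: (@le_rate _ _ _ (2 * rnorm (v x))) => n; rewrite add0r.
have := hs n [:: (1, x)].
have e1 (f : X -> R[i]) : ev f [:: (1, x)] = f x.
  by rewrite /ev big_seq1 [conjc _]rmorph1 mul1r.
have e2 : lcomb v [:: (1, x)] = v x by rewrite /lcomb big_seq1 scale1r.
rewrite gram_ksum gram_knorm e1 e2 => h1.
have h2 := inner_CS (w - lcomb v (s n)) (v x).
have h3 := hw n; rewrite /= mul1r rnorm_distC in h3.
have -> : inner H w (v x) - g x =
  inner H (w - lcomb v (s n)) (v x) - (g x - inner H (lcomb v (s n)) (v x)).
  by rewrite innerBl; ring.
rewrite (le_trans (cmodD _ _))// cmodN.
have h4 := ler_wpM2r (rnorm_ge0 (v x)) h3; lra.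
Qed.

Lemma rnorm_le_total H X (v : X -> H) (w : H) (C : R) : total v -> 0 <= C ->
  (forall s, cmod (inner H w (lcomb v s)) <= C * rnorm (lcomb v s)) -> rnorm w <= C.
Proof.
move=> tv C0 h.
have [->|wn] := eqVneq (rnorm w) 0; first by [].
have w1 : 0 < rnorm w by rewrite lt_def wn rnorm_ge0.
rewrite -(ler_pM2l w1) -expr2 -rip_norm.
apply: (@le_rate _ _ _ (rnorm w + C)) => n.
have [s hs] := tv w _ (rate_gt0 R n).
have -> : rip w w = rip w (w - lcomb v s) + rip w (lcomb v s).
  by rewrite -ripDr subrK.
have h1 := le_trans (rip_CS w (w - lcomb v s)) (ler_wpM2l (rnorm_ge0 w) hs).
have h2 := le_trans (Re_le_cmod _) (h s); rewrite -/(rip _ _) in h2.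
have h3 : rnorm (lcomb v s) <= rnorm w + rate n.
  have := rnorm_triangle w (lcomb v s) 0; rewrite !subr0 rnorm_distC; lra.
have h4 := ler_wpM2l C0 h3; lra.
Qed.

Lemma bop_of_form H K X (v : X -> H) (F : K -> X -> R[i]) (C : R) :
  total v -> (forall x, linear_for *%R (F ^~ x)) ->
  (forall y s, cmod (ev (F y) s) <= C * rnorm y * rnorm (lcomb v s)) ->
  exists S : bop K H, forall y x, inner H (S y) (v x) = F y x.
Proof.
move=> tv linF FC.
have /choice[S hS] : forall y, exists w, forall x, inner H w (v x) = F y x.
  by move=> y; apply: (@riesz_total H X v (F y) (C * rnorm y)) => s; exact: FC.
have bS : S \in @bounded_op R K H.
  apply/asboolP; split.
    move=> c x y; apply: (inner_eq_total tv) => i.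
    by rewrite innerDl innerZl /= !hS linF.
  exists `|C| => y; apply: (rnorm_le_total tv); first by rewrite mulr_ge0// rnorm_ge0.
  move=> s; rewrite inner_lcombr.
  have -> : ev (fun x => inner H (S y) (v x)) s = ev (F y) s.
    by apply: eq_bigr => p _; rewrite hS.
  rewrite (le_trans (FC _ _))// ler_wpM2r ?rnorm_ge0// ler_wpM2r ?rnorm_ge0//.
  exact: ler_norm.
by exists (Bop bS) => y x /=.
Qed.

Lemma bop_bounded_ge0 H K (T : bop H K) :
  exists2 M : R, 0 <= M & forall x, rnorm (T x) <= M * rnorm x.
Proof.
have [M TM] := bop_bounded T; exists `|M| => // x.
by rewrite (le_trans (TM x))// ler_wpM2r ?rnorm_ge0// ler_norm.
Qed.

Lemma adjoint_ex H K (T : bop H K) : exists S : bop K H, is_adjoint T S.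
Proof.
have [M M0 TM] := bop_bounded_ge0 T.
have [||S hS] := @bop_of_form H K H id (fun y x => inner K y (T x)) M (total_id (H:=H)).
- by move=> x c y z /=; rewrite innerDl innerZl.
- move=> y s.
  have -> : ev (fun x => inner K y (T x)) s = inner K y (T (lcomb id s)).
    rewrite /lcomb linear_sum.
    under eq_bigr do rewrite linearZ /=.
    by rewrite -/(lcomb (fun x => T x) s) inner_lcombr.
  by rewrite (le_trans (inner_CS _ _))// (mulrC M) -mulrA ler_wpM2l ?rnorm_ge0.
exists S => x y; by rewrite innerC -hS -innerC.
Qed.

Lemma bop_eq H K (S T : bop H K) : (forall x, S x = T x) -> S = T.
Proof. by move=> h; apply/val_inj/funext. Qed.

(** The extension is the adjoint of the operator representing [<y, w x>]: this
    replaces the definition of the extension by limits. *)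
Lemma bop_ext H K X (v : X -> H) (w : X -> K) (C : R) : total v ->
  (forall s, rnorm (lcomb w s) <= C * rnorm (lcomb v s)) ->
  exists T : bop H K, forall x, T (v x) = w x.
Proof.
move=> tv wC.
have [||S hS] := @bop_of_form H K X v (fun y x => inner K y (w x)) C tv.
- by move=> x c y z /=; rewrite innerDl innerZl.
- move=> y s; rewrite -inner_lcombr (le_trans (inner_CS _ _))//.
  by rewrite (mulrC C) -mulrA ler_wpM2l ?rnorm_ge0.
have [T hT] := adjoint_ex S; exists T => x.
apply: (inner_eq_total (total_id (H:=K))) => y /=.
by rewrite innerC -hT hS -innerC.
Qed.

Lemma bop_of_total_form H K X Y (v : X -> H) (u : Y -> K) (f : X -> Y -> R[i]) (C : R) :
  total v -> total u -> 0 <= C ->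
  (forall s t, cmod (\sum_(p <- s) p.1 * ev (f p.2) t) <=
     C * rnorm (lcomb v s) * rnorm (lcomb u t)) ->
  exists T : bop H K, forall x y, inner K (T (v x)) (u y) = f x y.
Proof.
move=> tv tu C0 fC.
have /choice[w hw] : forall x, exists w, forall y, inner K w (u y) = f x y.
  move=> x; apply: (@riesz_total K Y u (f x) (C * rnorm (v x))) => t.
  by have := fC [:: (1, x)] t; rewrite big_seq1 mul1r /lcomb big_seq1 scale1r.
have [|T hT] := @bop_ext H K X v w C tv.
  move=> s; apply: (rnorm_le_total tu); first by rewrite mulr_ge0// rnorm_ge0.
  move=> t; rewrite inner_lcombl.
  under eq_bigr do rewrite inner_lcombr.
  have -> : \sum_(p <- s) p.1 * ev (fun y => inner K (w p.2) (u y)) t =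
            \sum_(p <- s) p.1 * ev (f p.2) t; last exact: fC.
  apply: eq_bigr => p _; congr (_ * _); apply: eq_bigr => q _.
  by rewrite hw.
by exists T => x y; rewrite hT hw.
Qed.

Lemma bop_eq_total H K X (v : X -> H) (S T : bop H K) : total v ->
  (forall x, S (v x) = T (v x)) -> S = T.
Proof.
move=> tv h; apply: bop_eq => x.
have [S' hS] := adjoint_ex S; have [T' hT] := adjoint_ex T.
apply: (inner_eq_total (total_id (H:=K))) => y /=.
rewrite hS hT; congr (inner H x _).
apply: (inner_eq_total tv) => i.
by rewrite innerC -hS h hT -innerC.
Qed.

End Total.

(** * Bounded operators and their adjoints *)

Section Operators.
Context (R : realType).
Implicit Types (H K L : hilbert R).

Lemma opnorm_le H K (T : bop H K) x : rnorm (T x) <= rnorm T * rnorm x.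
Proof.
have [x0|x0] := eqVneq (rnorm x) 0.
  by rewrite (rnorm0_eq0 x0) linear0 !rnorm0 mulr0.
have x1 : 0 < rnorm x by rewrite lt_def x0 rnorm_ge0.
have := @opnorm_ub _ _ _ T ((rnorm x)^-1%:C *: x).
rewrite linearZ /= !rnormZ -!/(cmod _) !cmodR ger0_norm ?invr_ge0 ?rnorm_ge0//.
by rewrite mulVf// lexx ler_pdivrMl// mulrC; apply.
Qed.

Lemma opnorm_bound H K (T : bop H K) M : 0 <= M ->
  (forall x, rnorm (T x) <= M * rnorm x) -> rnorm T <= M.
Proof.
move=> M0 TM; apply: opnorm_lub => x x1.
by rewrite (le_trans (TM x))// ler_piMr.
Qed.

Lemma opnorm_comp H K L (S : bop K L) (T : bop H K) :
  rnorm (bop_comp S T) <= rnorm S * rnorm T.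
Proof.
apply: opnorm_bound => [|x]; first by rewrite mulr_ge0 ?rnorm_ge0.
rewrite (le_trans (opnorm_le S (T x)))// -mulrA ler_wpM2l ?rnorm_ge0//.
exact: opnorm_le.
Qed.

Lemma bop_subE H K (S T : bop H K) x : (S - T) x = S x - T x.
Proof. by []. Qed.

Lemma bop_scaleE H K c (T : bop H K) x : (c *: T) x = c *: T x.
Proof. by []. Qed.

Lemma bop_linZ H K c (T : bop H K) x : T (c *: x) = c *: T x.
Proof. by rewrite linearZ. Qed.

Lemma bop_linB H K (T : bop H K) x y : T (x - y) = T x - T y.
Proof. by rewrite linearB. Qed.

Lemma bop_linD H K (T : bop H K) x y : T (x + y) = T x + T y.
Proof. by rewrite linearD. Qed.

Lemma bop_lin0 H K (T : bop H K) : T 0 = 0.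
Proof. by rewrite linear0. Qed.

Lemma bop_lcomb H K X (v : X -> H) s (T : bop H K) :
  T (lcomb v s) = lcomb (fun x => T (v x)) s.
Proof. by rewrite /lcomb linear_sum; apply: eq_bigr => p _; rewrite linearZ. Qed.

Lemma bop_combE H K c (S T : bop H K) x : (c *: S + T) x = c *: S x + T x.
Proof. by []. Qed.

Lemma bop_compE H K L (S : bop K L) (T : bop H K) x : bop_comp S T x = S (T x).
Proof. by []. Qed.

Lemma bop_compA H K L G (S : bop L G) (T : bop K L) (U : bop H K) :
  bop_comp (bop_comp S T) U = bop_comp S (bop_comp T U).
Proof. exact: bop_eq. Qed.

Lemma bop_comp_combl H K L c (S S' : bop K L) (T : bop H K) :
  bop_comp (c *: S + S') T = c *: bop_comp S T + bop_comp S' T.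
Proof. exact: bop_eq. Qed.

Lemma bop_comp_combr H K L c (S : bop K L) (T T' : bop H K) :
  bop_comp S (c *: T + T') = c *: bop_comp S T + bop_comp S T'.
Proof. by apply: bop_eq => x; rewrite bop_combE !bop_compE bop_combE linearP. Qed.

Lemma bop_id_subproof H : @id H \in @bounded_op R H H.
Proof. by apply/asboolP; split => //; exists 1 => x; rewrite mul1r. Qed.

Definition bop_id H : bop H H := Bop (bop_id_subproof H).

Lemma bop_comp1l H K (T : bop H K) : bop_comp (bop_id K) T = T.
Proof. exact: bop_eq. Qed.

Lemma bop_comp1r H K (T : bop H K) : bop_comp T (bop_id H) = T.
Proof. exact: bop_eq. Qed.

Definition adj H K (T : bop H K) : bop K H := sval (cid (adjoint_ex T)).

Lemma adjP H K (T : bop H K) : is_adjoint T (adj T).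
Proof. by rewrite /adj; case: cid. Qed.

Lemma adj_uniq H K (T : bop H K) (S : bop K H) : is_adjoint T S -> S = adj T.
Proof.
move=> TS; apply: bop_eq => y; apply: (inner_eq_total (total_id (H:=H))) => x /=.
by rewrite innerC -TS adjP -innerC.
Qed.

Lemma adjK H K (T : bop H K) : adj (adj T) = T.
Proof.
by apply/esym/adj_uniq => x y; rewrite innerC -adjP -innerC.
Qed.

Lemma adj_comp H K L (S : bop K L) (T : bop H K) :
  adj (bop_comp S T) = bop_comp (adj T) (adj S).
Proof. by apply/esym/adj_uniq => x y; rewrite bop_compE !adjP. Qed.

Lemma adj_comb H K c (S T : bop H K) :
  adj (c *: S + T) = conjc c *: adj S + adj T.
Proof.
apply/esym/adj_uniq => x y.
by rewrite !bop_combE innerDl innerDr innerZl innerZr conjcK !adjP.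
Qed.

Lemma adj0 H K : adj (0 : bop H K) = 0.
Proof. by apply/esym/adj_uniq => x y; rewrite inner0l inner0r. Qed.

Lemma adj_id H : adj (bop_id H) = bop_id H.
Proof. by apply/esym/adj_uniq => x y. Qed.

Lemma rip_adjr H K (T : bop H K) x y : rip (T x) y = rip x (adj T y).
Proof. by rewrite /rip adjP. Qed.

Lemma adjoint_setP H K (M : set (bop H K)) S :
  adjoint_set M S <-> M (adj S).
Proof.
split => [[T MT /adj_uniq ->]|MS]; first by rewrite adjK.
by exists (adj S) => //; rewrite -{2}[S]adjK; exact: adjP.
Qed.

End Operators.

(** * Matrix norms *)

Section MatrixNorms.
Context (R : realType).
Implicit Types (H K : hilbert R).

Definition sqn H (I : finType) (h : I -> H) : R := \sum_i rnorm (h i) ^+ 2.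

Lemma sqn_ge0 H (I : finType) (h : I -> H) : 0 <= sqn h.
Proof. by apply: sumr_ge0 => i _; rewrite sqr_ge0. Qed.

Lemma sqn_ge H (I : finType) (h : I -> H) i : rnorm (h i) ^+ 2 <= sqn h.
Proof.
rewrite /sqn (bigD1 i)//= lerDl; apply: sumr_ge0 => j _; exact: sqr_ge0.
Qed.

Lemma sqn_rip H (I : finType) (h : I -> H) : sqn h = \sum_i rip (h i) (h i).
Proof. by apply: eq_bigr => i _; rewrite rip_norm. Qed.

(** Matrices are indexed by arbitrary finite types, so that block matrices and
    families of vectors over several indices need no renumbering. *)
Definition mxapp H K (I J : finType) (z : I -> J -> bop H K) (h : J -> H) : I -> K :=
  fun i => \sum_j z i j (h j).

Lemma mxapp_bounded H K (I J : finType) (z : I -> J -> bop H K) :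
  exists2 C : R, 0 <= C & forall h, sqn (mxapp z h) <= C * sqn h.
Proof.
pose M := \sum_i \sum_j rnorm (z i j).
have M0 : 0 <= M.
  by apply: sumr_ge0 => i _; apply: sumr_ge0 => j _; exact: rnorm_ge0.
exists (#|I|%:R * M ^+ 2); first by rewrite mulr_ge0 ?sqr_ge0.
move=> h; pose r := Num.sqrt (sqn h).
have r0 : 0 <= r by exact: sqrtr_ge0.
have rr : r ^+ 2 = sqn h by rewrite sqr_sqrtr// sqn_ge0.
have hj j : rnorm (h j) <= r.
  by rewrite -ler_sqr ?nnegrE ?rnorm_ge0// rr sqn_ge.
rewrite -rr -mulrA -exprMn mulr_natl /sqn.
rewrite -sumr_const; apply: ler_sum => i _.
rewrite ler_sqr ?nnegrE ?rnorm_ge0 ?mulr_ge0// /mxapp.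
apply: (@le_trans _ _ (\sum_j rnorm (z i j) * r)).
  elim/big_rec2 : _ => [|j x y _ xy]; first by rewrite rnorm0.
  rewrite (le_trans (rnormD _ _))// lerD// (le_trans (opnorm_le _ _))//.
  by rewrite ler_wpM2l ?rnorm_ge0.
rewrite -mulr_suml ler_wpM2r// /M (bigD1 i)//= lerDl.
by apply: sumr_ge0 => k _; apply: sumr_ge0 => j _; exact: rnorm_ge0.
Qed.

Lemma l2norm_sqn H n (h : 'I_n -> H) : l2norm h ^+ 2 = sqn h.
Proof. by rewrite /l2norm sqr_sqrtr//; exact: sqn_ge0. Qed.

Lemma l2norm_ge0 H n (h : 'I_n -> H) : 0 <= l2norm h.
Proof. exact: sqrtr_ge0. Qed.

Lemma l2norm_le H K n m (h : 'I_n -> H) (k : 'I_m -> K) C : 0 <= C ->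
  sqn h <= C ^+ 2 * sqn k -> l2norm h <= C * l2norm k.
Proof.
move=> C0 hk; rewrite -ler_sqr ?nnegrE ?mulr_ge0 ?l2norm_ge0//.
by rewrite exprMn !l2norm_sqn.
Qed.

Lemma opmx_has_sup H K n (T : 'M[bop H K]_n) :
  has_sup [set l2norm (fun i => \sum_(j < n) T i j (x j)) |
       x in [set x : 'I_n -> H | l2norm x <= 1]].
Proof.
have z1 : l2norm (fun _ : 'I_n => 0 : H) <= 1.
  by rewrite /l2norm big1 ?sqrtr0// => i _; rewrite rnorm0 expr0n.
split; first by exists (l2norm (fun i => \sum_(j < n) T i j 0)), (fun=> 0).
have [C C0 hC] := mxapp_bounded (fun i j => T i j).
exists (Num.sqrt C) => _ [x /= x1 <-].
apply: (@le_trans _ _ (Num.sqrt C * l2norm x)).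
  by apply: l2norm_le; rewrite ?sqrtr_ge0// sqr_sqrtr//; exact: hC.
by rewrite ler_piMr// sqrtr_ge0.
Qed.

Lemma opmx_norm_ge0 H K n (T : 'M[bop H K]_n) : 0 <= opmx_norm T.
Proof.
apply: le_trans (l2norm_ge0 (fun i => \sum_(j < n) T i j 0)) _.
apply: sup_upper_bound; first exact: opmx_has_sup.
exists (fun=> 0) => //=.
by rewrite /l2norm big1 ?sqrtr0// => i _; rewrite rnorm0 expr0n.
Qed.

Lemma opmx_norm_le H K n (T : 'M[bop H K]_n) (h : 'I_n -> H) :
  sqn (mxapp (fun i j => T i j) h) <= opmx_norm T ^+ 2 * sqn h.
Proof.
have [h0|h0] := eqVneq (l2norm h) 0.
  have [C C0 hC] := mxapp_bounded (fun i j => T i j).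
  by rewrite (le_trans (hC h))// -l2norm_sqn h0 expr0n /= !mulr0.
have h1 : 0 < l2norm h by rewrite lt_def h0 l2norm_ge0.
set c := (l2norm h)^-1; have c0 : 0 < c by rewrite invr_gt0.
have sqZ (L : hilbert R) (k : 'I_n -> L) : sqn (fun i => c%:C *: k i) = c ^+ 2 * sqn k.
  rewrite /sqn mulr_sumr; apply: eq_bigr => i _.
  by rewrite rnormZ -/(cmod _) cmodR ger0_norm ?(ltW c0)// exprMn.
have : l2norm (fun i => \sum_(j < n) T i j (c%:C *: h j)) <= opmx_norm T.
  apply: sup_upper_bound; first exact: opmx_has_sup.
  exists (fun j => c%:C *: h j) => //=.
  rewrite -ler_sqr ?nnegrE ?l2norm_ge0// l2norm_sqn sqZ -l2norm_sqn.
  by rewrite /c exprVn mulVf ?expf_neq0// expr1n.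
rewrite -ler_sqr ?nnegrE ?l2norm_ge0 ?opmx_norm_ge0// l2norm_sqn.
have -> : (fun i => \sum_(j < n) T i j (c%:C *: h j)) =
  (fun i => c%:C *: mxapp (fun i j => T i j) h i).
  apply/funext => i; rewrite /mxapp scaler_sumr; apply: eq_bigr => j _.
  by rewrite linearZ.
rewrite sqZ -l2norm_sqn /c exprVn ler_pdivrMl ?exprn_gt0//.
by rewrite [_ * opmx_norm _ ^+ 2]mulrC !l2norm_sqn.
Qed.

Lemma opmx_norm_lub H K n (T : 'M[bop H K]_n) C : 0 <= C ->
  (forall h, sqn (mxapp (fun i j => T i j) h) <= C ^+ 2 * sqn h) ->
  opmx_norm T <= C.
Proof.
move=> C0 hC; apply: ge_sup; first by case: (opmx_has_sup T).
move=> _ [x /= x1 <-]; apply: (@le_trans _ _ (C * l2norm x)).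
  by apply: l2norm_le => //; exact: hC.
by rewrite ler_piMr.
Qed.

Lemma opmx_norm1 H K (T : 'M[bop H K]_1) : opmx_norm T = rnorm (T 0 0).
Proof.
apply/eqP; rewrite eq_le; apply/andP; split.
  apply: opmx_norm_lub => [|h]; first exact: rnorm_ge0.
  rewrite /sqn /mxapp !big_ord1 -exprMn ler_sqr ?nnegrE ?mulr_ge0 ?rnorm_ge0//.
  exact: opnorm_le.
apply: opnorm_bound => [|x]; first exact: opmx_norm_ge0.
have := opmx_norm_le T (fun=> x); rewrite /sqn /mxapp !big_ord1 -exprMn.
by rewrite ler_sqr ?nnegrE ?mulr_ge0 ?rnorm_ge0 ?opmx_norm_ge0.
Qed.

(** The factor [r = 1/C] gives the bound. Only multiples of the image are tested,
    because the form is sometimes controlled on a subspace only. *)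
Lemma sqn_form_bound1 H K (I J : finType) (z : I -> J -> bop H K) C h : 0 <= C ->
  (forall r : R, 2 * \sum_i rip (mxapp z h i) (r%:C *: mxapp z h i) <=
    C * (sqn h + sqn (fun i => r%:C *: mxapp z h i))) ->
  sqn (mxapp z h) <= C ^+ 2 * sqn h.
Proof.
move=> C0 hC; set k := mxapp z h.
have hr (r : R) : 2 * (r * sqn k) <= C * (sqn h + r ^+ 2 * sqn k).
  have := hC r; congr (2 * _ <= C * (_ + _)).
    rewrite sqn_rip mulr_sumr; apply: eq_bigr => i _; exact: ripZr.
  rewrite /sqn mulr_sumr; apply: eq_bigr => i _.
  by rewrite rnormZ -/(cmod _) cmodR exprMn real_normK ?num_real.
have k0 := sqn_ge0 k; have h0 := sqn_ge0 h.
have [C1|C1] := eqVneq C 0.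
  have := hr 1; rewrite C1 !mul0r; nra.
have C2 : 0 < C by rewrite lt_def C1.
have := hr C^-1.
have -> : C * (sqn h + C^-1 ^+ 2 * sqn k) = C * sqn h + C^-1 * sqn k by field.
move=> h1; have : C^-1 * sqn k <= C * sqn h by lra.
by rewrite mulrC ler_pdivrMr// expr2 mulrAC.
Qed.

Lemma sqn_form_bound H K (I J : finType) (z : I -> J -> bop H K) C : 0 <= C ->
  (forall h k, 2 * \sum_i rip (mxapp z h i) (k i) <= C * (sqn h + sqn k)) ->
  forall h, sqn (mxapp z h) <= C ^+ 2 * sqn h.
Proof. by move=> C0 hC h; apply: sqn_form_bound1 => // r; exact: hC. Qed.

Lemma sqn_approx H (I : finType) (f : I -> H) (G D : R) : 0 <= G -> 0 <= D ->
  (forall n, exists2 g : I -> H, sqn g <= G &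
     forall i, rnorm (f i) <= rnorm (g i) + D * rate n) ->
  sqn f <= G.
Proof.
move=> G0 D0 hf.
apply: (@le_rate _ _ _ (#|I|%:R * (2 * D * (1 + G) + D ^+ 2))) => n.
have [w wG near] := hf n.
have r0 := rate_gt0 R n.
have r1 : rate n <= 1 :> R by rewrite invf_le1 ?ler1n.
have wi i : rnorm (w i) <= 1 + G.
  have := le_trans (sqn_ge w i) wG; have := rnorm_ge0 (w i); nra.
apply: (@le_trans _ _ (\sum_i (rnorm (w i) ^+ 2 +
    (2 * D * (1 + G) + D ^+ 2) * rate n))).
  apply: ler_sum => i _.
  have h1 : rnorm (f i) ^+ 2 <= (rnorm (w i) + D * rate n) ^+ 2.
    by rewrite ler_sqr ?nnegrE ?rnorm_ge0// addr_ge0 ?rnorm_ge0// mulr_ge0// ltW.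
  apply: (le_trans h1); rewrite sqrrD -addrA lerD2l.
  have h2 := ler_wpM2l (mulr_ge0 D0 (ltW r0)) (wi i).
  have h3 : (D * rate n) ^+ 2 <= D ^+ 2 * rate n.
    by rewrite exprMn ler_wpM2l ?sqr_ge0// expr2 ler_piMr// ltW.
  rewrite -[_ *+ 2]mulr_natl; lra.
rewrite big_split /= sumr_const -[X in _ + X <= _]mulr_natl mulrA.
by rewrite lerD2r.
Qed.

Lemma sqn_CS H K (I J : finType) (z : I -> J -> bop H K) C h k : 0 <= C ->
  sqn (mxapp z h) <= C ^+ 2 * sqn h ->
  2 * \sum_i rip (mxapp z h i) (k i) <= C * (sqn h + sqn k).
Proof.
move=> C0 hC.
have [C1|C1] := eqVneq C 0.
  have hC0 : sqn (mxapp z h) <= 0 by move: hC; rewrite C1 expr0n mul0r.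
  have z0 i : mxapp z h i = 0.
    apply: rnorm0_eq0; apply/eqP; rewrite -sqrf_eq0 eq_le sqr_ge0 andbT.
    by rewrite (le_trans (sqn_ge _ i)).
  rewrite C1 mul0r.
  by rewrite big1 ?mulr0// => i _; rewrite z0 rip0l.
have C2 : 0 < C by rewrite lt_def C1.
have : 0 <= \sum_i rnorm (mxapp z h i - C%:C *: k i) ^+ 2.
  by apply: sumr_ge0 => i _; exact: sqr_ge0.
have -> : \sum_i rnorm (mxapp z h i - C%:C *: k i) ^+ 2 =
    sqn (mxapp z h) - 2 * C * \sum_i rip (mxapp z h i) (k i) + C ^+ 2 * sqn k.
  rewrite /sqn !mulr_sumr -sumrB -big_split; apply: eq_bigr => i _ /=.
  by rewrite rnormB_sq ripZr rnormZ -/(cmod _) cmodR exprMn real_normK ?num_real//; ring.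
move=> h1; rewrite -(ler_pM2l C2); nra.
Qed.

End MatrixNorms.

(** * Transfer of accretivity along completely isometric representations *)

Lemma subrACA (V : zmodType) (a b c d : V) : (a - b) - (c - d) = (a - c) - (b - d).
Proof. by rewrite !opprB addrACA [RHS]addrACA [- b - c]addrC. Qed.

Section CompleteIsometries.
Context (R : realType).
Implicit Types (A B : operator_algebra R) (H K : hilbert R).

Lemma ci_rnorm B K (u : {linear B -> bop K K}) b :
  completely_isometric (@mxnorm R B) u -> rnorm (u b) = rnorm b.
Proof.
move=> /(_ 1%N (const_mx b)); rewrite opmx_norm1 mxnorm1 !mxE.
by [].
Qed.

Lemma ci_inj B K (u : {linear B -> bop K K}) :
  completely_isometric (@mxnorm R B) u -> injective u.
Proof.
move=> ci a b ab; apply/eqP; rewrite -subr_eq0; apply/eqP/rnorm0_eq0.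
by rewrite -(ci_rnorm _ ci) linearB ab subrr rnorm0.
Qed.

Lemma sqn_reindex H (I : finType) (h : I -> H) :
  sqn (fun i : 'I_#|I| => h (enum_val i)) = sqn h.
Proof.
by rewrite /sqn [RHS](reindex (@enum_val I I))//; exact: onW_bij (@enum_val_bij I).
Qed.

Lemma mxapp_reindex H K (I : finType) (z : I -> I -> bop H K) h i :
  mxapp (fun i j : 'I_#|I| => z (enum_val i) (enum_val j))
    (fun j => h (enum_val j)) i = mxapp z h (enum_val i).
Proof.
by rewrite /mxapp [RHS](reindex (@enum_val I I))//; exact: onW_bij (@enum_val_bij I).
Qed.

Lemma ci_transfer B H K (u : {linear B -> bop H H}) (v : {linear B -> bop K K})
    (I : finType) (b : I -> I -> B) C : 0 <= C ->
  completely_isometric (@mxnorm R B) u -> completely_isometric (@mxnorm R B) v ->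
  (forall h, sqn (mxapp (fun i j => u (b i j)) h) <= C ^+ 2 * sqn h) ->
  forall h, sqn (mxapp (fun i j => v (b i j)) h) <= C ^+ 2 * sqn h.
Proof.
move=> C0 ciu civ hC h.
pose a := \matrix_(i, j < #|I|) b (enum_val i) (enum_val j).
have : opmx_norm (map_mx v a) <= C.
  rewrite civ -ciu; apply: opmx_norm_lub => // k.
  have := hC (fun i => k (enum_rank i)); congr (_ <= _ * _).
    rewrite -sqn_reindex; apply: eq_bigr => i _; congr (rnorm _ ^+ 2).
    rewrite -mxapp_reindex; apply: eq_bigr => j _.
    by rewrite !mxE enum_valK.
  rewrite -sqn_reindex; apply: eq_bigr => i _.
  by rewrite enum_valK.
move=> aC; have := opmx_norm_le (map_mx v a) (fun i => h (enum_val i)).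
rewrite sqn_reindex.
have -> : mxapp (fun i j => map_mx v a i j) (fun i => h (enum_val i)) =
  (fun i => mxapp (fun i j => v (b i j)) h (enum_val i)).
  apply/funext => i; rewrite -mxapp_reindex; apply: eq_bigr => j _.
  by rewrite !mxE.
rewrite sqn_reindex => /le_trans; apply.
by rewrite ler_wpM2r ?sqn_ge0// ler_sqr ?nnegrE ?opmx_norm_ge0.
Qed.

Lemma tails_filter (I : Type) (le : I -> I -> Prop) : directed le ->
  ProperFilter (tails le).
Proof.
move=> [[i0] refl trans dir]; apply: filter_from_proper => [|i _].
  apply: filter_from_filter; first by exists i0.
  move=> i j _ _; have [k [ik jk]] := dir i j; exists k => // l /= kl.
  by split; [apply: trans kl|apply: trans kl].
by exists i => /=; exact: refl.
Qed.

Lemma cai_finite B (I : finType) (b : I -> B) (d : R) :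
  has_contractive_approximate_identity B -> 0 < d ->
  exists e, [/\ rnorm e <= 1,
    forall i, rnorm (oa_mul B e (b i) - b i) <= d &
    forall i, rnorm (oa_mul B (b i) e - b i) <= d].
Proof.
move=> [J [le [e [dir e1 eL eR]]]] d0.
have PF := tails_filter dir.
have d0c : 0 < d%:C by rewrite ltcR.
have hL : \forall j \near tails le, forall i, rnorm (oa_mul B (e j) (b i) - b i) <= d.
  apply: filter_forall => i; have := eL (b i) => /cvgrPdist_lt/(_ _ d0c).
  by apply: filterS => j; rewrite -rnormE ltcR rnorm_distC => /ltW.
have hR : \forall j \near tails le, forall i, rnorm (oa_mul B (b i) (e j) - b i) <= d.
  apply: filter_forall => i; have := eR (b i) => /cvgrPdist_lt/(_ _ d0c).
  by apply: filterS => j; rewrite -rnormE ltcR rnorm_distC => /ltW.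
have [j [hj1 hj2]] := filter_ex (filterI hL hR).
exists (e j); split => //.
by have := e1 j; rewrite -rnormE lecR.
Qed.

End CompleteIsometries.

Section Transfer.
Context (R : realType) (B : operator_algebra R).
Hypothesis caiB : has_contractive_approximate_identity B.
Context (K L : hilbert R) (u : {linear B -> bop K K}) (v : {linear B -> bop L L}).
Hypotheses (um : Defs.multiplicative (oa_mul B) u) (vm : Defs.multiplicative (oa_mul B) v).
Hypotheses (ciu : completely_isometric (@mxnorm R B) u)
  (civ : completely_isometric (@mxnorm R B) v).

Definition accretive (H : hilbert R) (I : finType) (z : I -> I -> bop H H) :=
  forall h, 0 <= \sum_i rip (mxapp z h i) (h i).

Lemma oa_multiplier (z : bop K K) (t : B -> B) :
  (forall b, u (t b) = bop_comp z (u b)) ->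
  [/\ forall a b, t (oa_mul B a b) = oa_mul B (t a) b,
      forall a b, t (a - b) = t a - t b &
      forall b, rnorm (t b) <= rnorm z * rnorm b].
Proof.
move=> ht; split => [a b|a b|b].
- by apply: (ci_inj ciu); rewrite ht um um ht bop_compA.
- apply: (ci_inj ciu); rewrite ht !linearB /= !ht.
  by apply: bop_eq => x; rewrite /= linearB.
- by rewrite -!(ci_rnorm _ ciu) ht opnorm_comp.
Qed.

(** An accretive matrix [z] of left multipliers of [B] satisfies
    [|1 - s z|^2 <= 1 + s^2 |z|^2]; cutting down by an approximate identity moves
    this estimate into matrices over [B], where it only depends on the matrix
    norms of [B]. In the second representation, [s -> 0] gives accretivity back. *)
Lemma transfer (I : finType) (z : I -> I -> bop K K) (t : I -> I -> B -> B) :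
  (forall i j b, u (t i j b) = bop_comp (z i j) (u b)) -> accretive z ->
  forall (b : I -> B) (x : I -> L),
  0 <= \sum_i \sum_j rip (v (t i j (b j)) (x j)) (v (b i) (x i)).
Proof.
move=> ht acc b x.
have [C C0 zC] := mxapp_bounded z.
pose eta i := v (b i) (x i).
pose zeta i := \sum_j v (t i j (b j)) (x j).
have -> : \sum_i \sum_j rip (v (t i j (b j)) (x j)) (v (b i) (x i)) =
          \sum_i rip (zeta i) (eta i).
  by apply: eq_bigr => i _; rewrite rip_suml.
have eta0 := sqn_ge0 eta.
(* The estimate of [1 - s z], cut down by [e] and moved to the second
   representation. *)
have cut s e : 0 < s -> rnorm e <= 1 ->
    sqn (fun i => v (oa_mul B e (b i)) (x i) -
      s%:C *: \sum_j v (t i j (oa_mul B e (b j))) (x j)) <= (1 + s ^+ 2 * C) * sqn eta.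
  move=> s0 e1.
  pose y i j : B := (if i == j then e else 0) - s%:C *: t i j e.
  have c1 : 0 <= 1 + s ^+ 2 * C by rewrite addr_ge0// mulr_ge0// sqr_ge0.
  have yE (G : hilbert R) (w : {linear B -> bop G G}) g i :
      mxapp (fun i j => w (y i j)) g i =
      w e (g i) - s%:C *: \sum_j w (t i j e) (g j).
    rewrite /mxapp /y scaler_sumr.
    transitivity (\sum_j ((if i == j then w e (g j) else 0) - s%:C *: w (t i j e) (g j))).
      apply: eq_bigr => j _; rewrite linearB linearZ /=.
      by case: ifP => _; rewrite ?linear0.
    rewrite sumrB -big_mkcond /= (bigD1 i)//= big1 ?addr0// => j.
    by case/andP => /eqP ->; rewrite eqxx.
  have := @ci_transfer _ B _ _ u v I y (Num.sqrt (1 + s ^+ 2 * C)) (sqrtr_ge0 _) ciu civ.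
  rewrite sqr_sqrtr// => /(_ _ eta); set W := sqn (mxapp _ eta).
  have -> : W = sqn (fun i => v (oa_mul B e (b i)) (x i) -
      s%:C *: \sum_j v (t i j (oa_mul B e (b j))) (x j)).
    apply: eq_bigr => i _; congr (rnorm _ ^+ 2); rewrite yE /eta.
    congr (_ - _ *: _); first by rewrite vm.
    apply: eq_bigr => j _; have [tm _ _] := oa_multiplier (ht i j).
    by rewrite tm vm.
  apply => h.
  pose g i := u e (h i).
  have -> : mxapp (fun i j => u (y i j)) h = fun i => g i - s%:C *: mxapp z g i.
    apply/funext => i; rewrite yE; congr (_ - _ *: _).
    by apply: eq_bigr => j _; rewrite ht.
  have g1 : sqn g <= sqn h.
    apply: ler_sum => i _; rewrite ler_sqr ?nnegrE ?rnorm_ge0//.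
    by rewrite (le_trans (opnorm_le _ _))// ler_piMl ?rnorm_ge0// (ci_rnorm _ ciu).
  apply: (@le_trans _ _ ((1 + s ^+ 2 * C) * sqn g)); last by rewrite ler_wpM2l.
  have -> : sqn (fun i => g i - s%:C *: mxapp z g i) =
      sqn g - 2 * s * \sum_i rip (mxapp z g i) (g i) + s ^+ 2 * sqn (mxapp z g).
    rewrite /sqn !mulr_sumr -sumrB -big_split; apply: eq_bigr => i _ /=.
    rewrite rnormB_sq ripZr rnormZ -/(cmod _) cmodR exprMn real_normK ?num_real//.
    by rewrite (ripC (g i)); ring.
  have := zC g; have := acc g; set p := \sum_i _; set q := sqn (mxapp z g).
  move=> p0 qC; have s2 := sqr_ge0 s.
  have := mulr_ge0 (ltW s0) p0; have := ler_wpM2l s2 qC; lra.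
(* The approximate identity is now removed. *)
have lim s : 0 < s -> sqn (fun i => eta i - s%:C *: zeta i) <= (1 + s ^+ 2 * C) * sqn eta.
  move=> s0.
  set G := (1 + s ^+ 2 * C) * sqn eta.
  have G0 : 0 <= G by rewrite mulr_ge0// addr_ge0// mulr_ge0// sqr_ge0.
  pose D := \sum_i (rnorm (x i) + s * \sum_j rnorm (z i j) * rnorm (x j)).
  have Dpos i : 0 <= rnorm (x i) + s * \sum_j rnorm (z i j) * rnorm (x j).
    rewrite addr_ge0 ?rnorm_ge0// mulr_ge0 ?(ltW s0)//.
    by apply: sumr_ge0 => j _; rewrite mulr_ge0 ?rnorm_ge0.
  have D0 : 0 <= D by apply: sumr_ge0.
  apply: (sqn_approx G0 D0) => n.
  have [e [e1 eL _]] := cai_finite b caiB (rate_gt0 R n).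
  have := cut s e s0 e1; rewrite -/G; set w := (w in sqn w) => wG.
  exists w => // i.
  have -> : eta i - s%:C *: zeta i = w i - (w i - (eta i - s%:C *: zeta i)) by rewrite subKr.
  rewrite (le_trans (rnormD _ _))// rnormN lerD2l.
  have -> : w i - (eta i - s%:C *: zeta i) =
      v (oa_mul B e (b i) - b i) (x i) +
      - (s%:C *: \sum_j v (t i j (oa_mul B e (b j) - b j)) (x j)).
    rewrite /w /eta /zeta (linearB v) bop_subE.
    have -> : \sum_j v (t i j (oa_mul B e (b j) - b j)) (x j) =
      \sum_j v (t i j (oa_mul B e (b j))) (x j) - \sum_j v (t i j (b j)) (x j).
      rewrite -sumrB; apply: eq_bigr => j _.
      by have [_ tB _] := oa_multiplier (ht i j); rewrite tB linearB.
    by rewrite scalerBr subrACA.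
  apply: (@le_trans _ _ ((rnorm (x i) + s * \sum_j rnorm (z i j) * rnorm (x j)) * rate n)); last first.
    rewrite ler_wpM2r ?(ltW (rate_gt0 _ _))// /D [leRHS](bigD1 i)//= lerDl.
    by apply: sumr_ge0.
  rewrite (le_trans (rnormD _ _))// rnormN mulrDl; apply: lerD.
    rewrite (le_trans (opnorm_le _ _))// mulrC ler_wpM2l ?rnorm_ge0//.
    by rewrite (ci_rnorm _ civ).
  rewrite rnormZ -/(cmod _) cmodR (gtr0_norm s0) -mulrA ler_wpM2l ?(ltW s0)//.
  rewrite mulr_suml; elim/big_rec2 : _ => [|j y1 y2 _ IH]; first by rewrite rnorm0.
  rewrite (le_trans (rnormD _ _))// lerD// (le_trans (opnorm_le _ _))//.
  rewrite (ci_rnorm _ civ) mulrAC ler_wpM2r ?rnorm_ge0//.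
  have [_ _ tN] := oa_multiplier (ht i j).
  by rewrite (le_trans (tN _))// ler_wpM2l ?rnorm_ge0.
rewrite leNgt; apply/negP => p0.
have key s : 0 < s -> 0 <= 2 * \sum_i rip (zeta i) (eta i) + s * (C * sqn eta).
  move=> s0; have := lim s s0.
  have -> : sqn (fun i => eta i - s%:C *: zeta i) =
      sqn eta - 2 * s * \sum_i rip (zeta i) (eta i) + s ^+ 2 * sqn zeta.
    rewrite /sqn !mulr_sumr -sumrB -big_split; apply: eq_bigr => i _ /=.
    rewrite rnormB_sq ripZr rnormZ -/(cmod _) cmodR exprMn real_normK ?num_real//.
    by rewrite (ripC (eta i)); ring.
  have := mulr_ge0 (sqr_ge0 s) (sqn_ge0 zeta).
  move=> h1 h2; rewrite -(pmulr_rge0 _ s0); nra.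
move: p0; set p := \sum_i _ => p0.
have : 0 <= 2 * p.
  apply: (@le_rate _ _ _ (C * sqn eta)) => n.
  by have := key (rate n) (rate_gt0 R n); rewrite -/p; lra.
lra.
Qed.

(** Let [e] and [f] be contractions with [f e] close to [f]. Then [f] sends
    [k + s e k] close to [(1 + s) f k], whereas the norm of [k + s e k] is
    Pythagorean since [e k] is orthogonal to [k]. Iterating the estimate of [|f k|] obtained in this way gives
    [|f k|^2 <= |k|^2 / (n + 1)] for all [n]. *)
Lemma orth_essential k : (forall b x, inner L k (v b x) = 0) -> forall b, v b k = 0.
Proof.
move=> orth.
have step n : forall f : B, rnorm f <= 1 -> rnorm (v f k) ^+ 2 <= rate n * rnorm k ^+ 2.
  elim: n => [|n IH] f f1.
    rewrite /rate invr1 mul1r ler_sqr ?nnegrE ?rnorm_ge0//.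
    by rewrite (le_trans (opnorm_le _ _))// ler_piMl ?rnorm_ge0// (ci_rnorm _ civ).
  (* This [s] turns the bound [|k|^2 / (n + 1)] into [|k|^2 / (n + 2)]. *)
  pose s : R := n.+1%:R; have s0 : 0 < s by rewrite ltr0n.
  pose P := Num.sqrt (rnorm k ^+ 2 + s ^+ 2 * (rate n * rnorm k ^+ 2)).
  have P0 : 0 <= rnorm k ^+ 2 + s ^+ 2 * (rate n * rnorm k ^+ 2).
    by rewrite addr_ge0 ?sqr_ge0// mulr_ge0 ?sqr_ge0// mulr_ge0 ?sqr_ge0// ltW// rate_gt0.
  have PP : P ^+ 2 = (1 + s) * rnorm k ^+ 2.
    rewrite sqr_sqrtr//.
    by rewrite /rate -/s; field; rewrite nat1r pnatr_eq0.
  have main : (1 + s) * rnorm (v f k) <= P.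
    apply: (@le_rate _ _ _ (s * rnorm k)) => m.
    have [e [e1 _ eR]] := cai_finite (fun _ : 'I_1 => f) caiB (rate_gt0 R m).
    have {}eR := eR ord0.
    pose y := k + s%:C *: v e k.
    have y1 : rnorm y <= P.
      rewrite -ler_sqr ?nnegrE ?rnorm_ge0 ?sqrtr_ge0// rnormD_sq ripZr.
      rewrite {1}/rip orth /= mulr0 mulr0 addr0 rnormZ -/(cmod _) cmodR gtr0_norm// exprMn.
      rewrite sqr_sqrtr//.
      by rewrite lerD2l ler_wpM2l ?sqr_ge0// IH.
    have fy : v f y = (1 + s%:C) *: v f k + s%:C *: v (oa_mul B f e - f) k.
      rewrite /y bop_linD bop_linZ (linearB v) bop_subE vm bop_compE scalerDl scale1r.
      by rewrite scalerBr -addrA addrC [s%:C *: v f k + _]addrC subrK addrC.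
    have h1 : rnorm (v f y) <= P.
      apply: le_trans y1; rewrite (le_trans (opnorm_le _ _))// ler_piMl ?rnorm_ge0//.
      by rewrite (ci_rnorm _ civ).
    have h2 : rnorm (v (oa_mul B f e - f) k) <= rate m * rnorm k.
      by rewrite (le_trans (opnorm_le _ _))// ler_wpM2r ?rnorm_ge0// (ci_rnorm _ civ).
    have -> : (1 + s) * rnorm (v f k) = rnorm ((1 + s%:C) *: v f k).
      rewrite rnormZ -/(cmod _) -[1 + s%:C]/((1 : R)%:C + s%:C) -rmorphD /= cmodR.
      by rewrite gtr0_norm// addr_gt0.
    have -> : (1 + s%:C) *: v f k = v f y - s%:C *: v (oa_mul B f e - f) k by rewrite fy addrK.
    rewrite (le_trans (rnormD _ _))// rnormN rnormZ -/(cmod _) cmodR gtr0_norm//.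
    have := ler_wpM2l (ltW s0) h2; lra.
  have main2 : (1 + s) ^+ 2 * rnorm (v f k) ^+ 2 <= (1 + s) * rnorm k ^+ 2.
    rewrite -PP -exprMn ler_sqr ?nnegrE ?sqrtr_ge0 ?mulr_ge0 ?rnorm_ge0//.
    by rewrite addr_ge0// ltW.
  have s1 : 0 < 1 + s by rewrite addr_gt0.
  have -> : rate n.+1 = (1 + s)^-1 :> R by rewrite /rate /s nat1r.
  move: main2; rewrite expr2 -mulrA ler_pM2l// => main2.
  by rewrite mulrC ler_pdivlMr// mulrC.
have zero f : rnorm f <= 1 -> v f k = 0.
  move=> f1; apply: rnorm0_eq0; apply/eqP; rewrite -sqrf_eq0 eq_le sqr_ge0 andbT.
  apply: (@le_rate _ _ _ (rnorm k ^+ 2)) => n; rewrite add0r mulrC; exact: step.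
move=> b; have [b0|b0] := eqVneq (rnorm b) 0.
  by rewrite (rnorm0_eq0 b0) linear0.
have b1 : 0 < rnorm b by rewrite lt_def b0 rnorm_ge0.
have -> : b = (rnorm b)%:C *: ((rnorm b)^-1%:C *: b).
  by rewrite scalerA -rmorphM /= mulfV// scale1r.
rewrite linearZ bop_scaleE zero ?scaler0//.
by rewrite rnormZ -/(cmod _) cmodR ger0_norm ?invr_ge0 ?rnorm_ge0// mulVf.
Qed.

End Transfer.

(** * Closed spans *)

Section ClosedSpans.
Context (R : realType).
Implicit Types (V W : normedModType R[i]).

Lemma closureP V (S : set V) x :
  closure S x <-> (forall e : R, 0 < e -> exists2 y, S y & rnorm (x - y) <= e).
Proof.
split => [cS e e0|h B /nbhs_ballP[e' /= /gt0_realC[-> e0]] eB].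
  have e0c : 0 < e%:C by rewrite ltcR.
  have [y [Sy]] := cS (ball x e%:C) (nbhsx_ballx x _ e0c).
  by rewrite ball_rnorm => /ltW; exists y.
set e := complex.Re e' in e0 eB *.
have [y Sy xy] := h (e / 2) ltac:(by rewrite divr_gt0).
exists y; split => //; apply: eB; rewrite ball_rnorm (le_lt_trans xy)//; lra.
Qed.

Lemma lin_span_subspace (V : lmodType R[i]) (X : set V) : linear_subspace (lin_span X).
Proof.
split; first by exists 0%N, (fun=> 0), (fun=> 0); split => [[]//|]; rewrite big_ord0.
move=> c _ _ [n [a [x [Xx ->]]]] [m [b [y [Yy ->]]]].
exists (n + m)%N, (fun i => match fintype.split i with inl j => c * a j | inr j => b j end),
  (fun i => match fintype.split i with inl j => x j | inr j => y j end); split.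
  by move=> i; case: fintype.split.
rewrite big_split_ord /= scaler_sumr; congr (_ + _); apply: eq_bigr => i _.
  by rewrite -/(lshift m i) (unsplitK (inl i)) scalerA.
by rewrite -/(rshift n i) (unsplitK (inr i)).
Qed.

Lemma sub_lin_span (V : lmodType R[i]) (X : set V) : X `<=` lin_span X.
Proof.
move=> x Xx; exists 1%N, (fun=> 1), (fun=> x); split => //.
by rewrite big_ord1 scale1r.
Qed.

Lemma subspace_sum (V : lmodType R[i]) (S : set V) (I : Type) (r : seq I) (F : I -> V) :
  linear_subspace S -> (forall i, S (F i)) -> S (\sum_(i <- r) F i).
Proof.
move=> [S0 SD] SF; elim/big_rec : _ => // i x _ Sx.
by rewrite -[F i]scale1r; exact: SD.
Qed.

Lemma subspaceZ (V : lmodType R[i]) (S : set V) c x :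
  linear_subspace S -> S x -> S (c *: x).
Proof. by move=> [S0 SD] Sx; rewrite -[c *: x]addr0; exact: SD. Qed.

Lemma lin_span_min (V : lmodType R[i]) (X S : set V) :
  linear_subspace S -> X `<=` S -> lin_span X `<=` S.
Proof.
move=> lS XS _ [n [c [x [Xx ->]]]]; apply: subspace_sum => // i.
by apply: subspaceZ => //; exact: XS.
Qed.

Lemma closure_subspace V (S : set V) : linear_subspace S -> linear_subspace (closure S).
Proof.
move=> [S0 SD]; split; first exact: subset_closure.
move=> c x y /closureP Sx /closureP Sy; apply/closureP => e e0.
have c0 : 0 < cmod c + 1 by rewrite ltr_wpDl// cmod_ge0.
have [x' Sx' hx] := Sx (e / 2 / (cmod c + 1)) ltac:(by rewrite !divr_gt0).
have [y' Sy' hy] := Sy (e / 2) ltac:(by rewrite divr_gt0).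
exists (c *: x' + y'); first exact: SD.
rewrite opprD addrACA -scalerBr (le_trans (rnormD _ _))// rnormZ -/(cmod _).
have h : cmod c * rnorm (x - x') <= e / 2.
  move: hx; rewrite ler_pdivlMr//; have := rnorm_ge0 (x - x'); nra.
lra.
Qed.

Lemma closed_span_subspace V (X : set V) : linear_subspace (closed_span X).
Proof. by apply: closure_subspace; exact: lin_span_subspace. Qed.

Lemma closed_span_closed V (X : set V) : closed (closed_span X).
Proof. exact: closed_closure. Qed.

Lemma sub_closed_span V (X : set V) : X `<=` closed_span X.
Proof. by move=> x /sub_lin_span; exact: subset_closure. Qed.

Lemma closed_span_map V W (f : V -> W) (C : R) (X : set V) (S : set W) :
  linear f -> (forall x, rnorm (f x) <= C * rnorm x) ->
  linear_subspace S -> closed S -> (forall x, X x -> S (f x)) ->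
  forall x, closed_span X x -> S (f x).
Proof.
move=> lf fC lS cS XS x /closureP hx; apply: cS; apply/closureP => e e0.
have C0 : 0 < `|C| + 1 by rewrite ltr_wpDl.
have [y [n [c [z [Xz ->]]]] xy] := hx (e / (`|C| + 1)) ltac:(by rewrite divr_gt0).
have f0 : f 0 = 0.
  have := lf (-1) 0 0; rewrite scaler0 addr0 scaleN1r => ->.
  by rewrite addNr.
have fB u v : f (u - v) = f u - f v.
  by rewrite -[u - v]addrC -scaleN1r lf scaleN1r addrC.
have fS : f (\sum_(i < n) c i *: z i) = \sum_(i < n) c i *: f (z i).
  by elim/big_rec2 : _ => [//|i u v _ <-]; rewrite lf.
exists (f (\sum_(i < n) c i *: z i)).
  by rewrite fS; apply: subspace_sum => // i; apply: subspaceZ => //; exact: XS.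
rewrite -fB (le_trans (fC _))//; move: xy; rewrite ler_pdivlMr// => h.
have := rnorm_ge0 (x - \sum_(i < n) c i *: z i); have := ler_norm C.
set r := rnorm _ in h *; nra.
Qed.

Lemma closed_span_min V (X S : set V) :
  linear_subspace S -> closed S -> X `<=` S -> closed_span X `<=` S.
Proof.
move=> lS cS XS x Xx.
by apply: (@closed_span_map _ _ idfun 1 X S) => // y; rewrite mul1r.
Qed.

Lemma linear_bop_compl (H K L : hilbert R) (S : bop K L) : linear (@bop_comp R H K L S).
Proof. by move=> c T T'; exact: bop_comp_combr. Qed.

Lemma linear_bop_compr (H K L : hilbert R) (T : bop H K) :
  linear (fun S : bop K L => bop_comp S T).
Proof. by move=> c S S'; exact: bop_comp_combl. Qed.

Lemma range_subspace (V W : lmodType R[i]) (u : {linear V -> W}) : linear_subspace (range u).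
Proof.
split; first by exists 0 => //; rewrite linear0.
by move=> c _ _ [x _ <-] [y _ <-]; exists (c *: x + y) => //; rewrite linearP.
Qed.

Lemma isometry_range_closed (V : completeNormedModType R[i]) W (u : {linear V -> W}) :
  (forall x, rnorm (u x) = rnorm x) -> closed (range u).
Proof.
move=> iso y /closureP hy.
have /choice[x hx] : forall n, exists x, rnorm (y - u x) <= rate n.
  by move=> n; have [_ [x _ <-] h] := hy _ (rate_gt0 R n); exists x.
have [|l hl] := @rapid_complete _ _ x 1.
  move=> n m; rewrite mul1r -iso linearB /=.
  rewrite (le_trans (rnorm_triangle y _ _))// lerD//.
  by rewrite rnorm_distC.
exists l => //; apply/eqP; rewrite -subr_eq0; apply/eqP/rnorm0_eq0/eqP.
rewrite eq_le rnorm_ge0 andbT; apply: (@le_rate _ _ _ 2) => n; rewrite add0r.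
rewrite rnorm_distC (le_trans (rnorm_triangle (u (x n)) _ _))//.
rewrite -linearB iso; have := hl n; have := hx n; lra.
Qed.

Lemma closed_zero V : closed [set (0 : V)].
Proof.
move=> x /closureP h; apply/rnorm0_eq0/eqP; rewrite eq_le rnorm_ge0 andbT.
by apply: le_eps => e e0; have [_ ->] := h e e0; rewrite subr0 add0r.
Qed.

Lemma subspace_zero V : linear_subspace [set (0 : V)].
Proof. by split => // c x y -> ->; rewrite scaler0 addr0. Qed.

Lemma closed_span_zero V W (f : V -> W) (C : R) (X : set V) :
  linear f -> (forall x, rnorm (f x) <= C * rnorm x) ->
  (forall x, X x -> f x = 0) -> forall x, closed_span X x -> f x = 0.
Proof.
move=> lf fC X0; apply: (closed_span_map lf fC (@subspace_zero W) (@closed_zero W)).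
exact: X0.
Qed.

Lemma isometry_span (V : completeNormedModType R[i]) W (u : {linear V -> W}) (X : set W) :
  (forall x, rnorm (u x) = rnorm x) -> range u = closed_span X ->
  forall a, closed_span (u @^-1` X) a.
Proof.
move=> iso uX a.
have : closed_span X (u a) by rewrite -uX; exists a.
move=> /closureP ha; apply/closureP => e e0.
have [_ [n [c [x [Xx ->]]]] h] := ha e e0.
have /choice[y hy] : forall i, exists y, u y = x i.
  by move=> i; have := sub_closed_span (Xx i); rewrite -uX => -[y _ <-]; exists y.
exists (\sum_(i < n) c i *: y i).
  by exists n, c, y; split => // i; rewrite /preimage /= hy.
rewrite -iso linearB linear_sum; under eq_bigr do rewrite linearZ /= hy.
exact: h.
Qed.

Lemma in_spanP V Y (v : Y -> V) h : in_span v h <-> closed_span (range v) h.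
Proof.
split=> [hv|/closureP hv e e0].
  apply/closureP => e e0; have [s hs] := hv e e0; exists (lcomb v s) => //.
  apply: subspace_sum; first exact: lin_span_subspace.
  move=> p; apply: subspaceZ; first exact: lin_span_subspace.
  by apply: sub_lin_span; exists p.2.
have [_ [n [c [x [Xx ->]]]] hs] := hv e e0.
have /choice[y hy] : forall i, exists y, v y = x i.
  by move=> i; have [y _ <-] := Xx i; exists y.
exists [seq (c i, y i) | i <- index_enum 'I_n].
rewrite /lcomb big_map /=; under eq_bigr do rewrite hy.
exact: hs.
Qed.

End ClosedSpans.

(** * Ternary rings of operators *)

Section TROFacts.
Context (R : realType).
Implicit Types (H K L : hilbert R).

Lemma TRO_mul H K (M : set (bop H K)) m1 m2 m3 : is_TRO M -> M m1 -> M m2 -> M m3 ->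
  M (bop_comp (bop_comp m1 (adj m2)) m3).
Proof.
move=> [_ MMM] M1 M2 M3; apply: MMM; exists (bop_comp m1 (adj m2)), m3; split => //.
exists m1, (adj m2); split => //; exists m2 => //; exact: adjP.
Qed.

Lemma mul3 H K L G (X : set (bop L G)) (Y : set (bop K L)) (Z : set (bop H K)) x y z :
  X x -> Y y -> Z z -> mul_set (mul_set X Y) Z (bop_comp (bop_comp x y) z).
Proof. by move=> Xx Yy Zz; exists (bop_comp x y), z; split => //; exists x, y. Qed.

Lemma mul3P H K L G (X : set (bop L G)) (Y : set (bop K L)) (Z : set (bop H K)) T :
  mul_set (mul_set X Y) Z T ->
  exists x y z, [/\ X x, Y y, Z z & T = bop_comp (bop_comp x y) z].
Proof.
by move=> [_ [z [[x [y [Xx Yy ->]]] Zz ->]]]; exists x, y, z.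
Qed.

Lemma adjoint_set_adj H K (M : set (bop H K)) m : M m -> adjoint_set M (adj m).
Proof. by move=> Mm; apply/adjoint_setP; rewrite adjK. Qed.

Lemma adjoint_setK H K (M : set (bop H K)) : adjoint_set (adjoint_set M) = M.
Proof.
apply/seteqP; split => m.
  by move/adjoint_setP/adjoint_setP; rewrite adjK.
by move=> Mm; apply/adjoint_setP/adjoint_setP; rewrite adjK.
Qed.

Lemma TRO_adjoint H K (M : set (bop H K)) : is_TRO M -> is_TRO (adjoint_set M).
Proof.
move=> tM; have [[M0 MD] _] := tM; split.
  split; first by apply/adjoint_setP; rewrite adj0.
  by move=> c S T /adjoint_setP MS /adjoint_setP MT; apply/adjoint_setP; rewrite adj_comb; exact: MD.
move=> t /mul3P[x [y [z [/adjoint_setP Mx]]]]; rewrite adjoint_setK => My /adjoint_setP Mz ->.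
apply/adjoint_setP; rewrite !adj_comp -bop_compA.
by have := TRO_mul tM Mz _ Mx => /(_ y My).
Qed.

Lemma strongly_TRO_sym H K (A : set (bop H H)) (B : set (bop K K)) :
  strongly_TRO_equivalent A B -> strongly_TRO_equivalent B A.
Proof.
move=> [cA cB [M [tM hA hB]]]; split => //; exists (adjoint_set M); split.
- exact: TRO_adjoint.
- by rewrite adjoint_setK.
- by rewrite adjoint_setK.
Qed.

Section Corner.
Context (H K : hilbert R) (A : set (bop H H)) (B : set (bop K K)) (M : set (bop H K)).
Hypotheses (tM : is_TRO M)
  (hB : B = closed_span (mul_set (mul_set M A) (adjoint_set M))).

Lemma corner_mem m1 m2 a : M m1 -> M m2 -> A a ->
  B (bop_comp (bop_comp m1 a) (adj m2)).
Proof.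
move=> M1 M2 Aa; rewrite hB; apply: sub_closed_span; apply: mul3 => //.
exact: adjoint_set_adj.
Qed.

Lemma corner_mull m1 m2 b : M m1 -> M m2 -> B b ->
  B (bop_comp (bop_comp m1 (adj m2)) b).
Proof.
move=> M1 M2 Bb.
have lB : linear_subspace B by rewrite hB; exact: closed_span_subspace.
have kB : closed B by rewrite hB; exact: closed_span_closed.
rewrite hB in Bb.
apply: (closed_span_map (linear_bop_compl (bop_comp m1 (adj m2))) _ lB kB _ Bb).
  by move=> x; exact: opnorm_comp.
move=> t /mul3P[x [y [z [Mx Ay /adjoint_setP Mz ->]]]].
have := corner_mem (TRO_mul tM M1 M2 Mx) Mz Ay.
by rewrite adjK !bop_compA.
Qed.

Lemma corner_mulr m1 m2 b : M m1 -> M m2 -> B b ->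
  B (bop_comp b (bop_comp m1 (adj m2))).
Proof.
move=> M1 M2 Bb.
have lB : linear_subspace B by rewrite hB; exact: closed_span_subspace.
have kB : closed B by rewrite hB; exact: closed_span_closed.
rewrite hB in Bb.
apply: (closed_span_map (linear_bop_compr (bop_comp m1 (adj m2))) _ lB kB _ Bb).
  by move=> x; rewrite mulrC; exact: opnorm_comp.
move=> t /mul3P[x [y [z [Mx Ay /adjoint_setP Mz ->]]]].
have := corner_mem Mx (TRO_mul tM M2 M1 Mz) Ay.
by rewrite !adj_comp !adjK !bop_compA.
Qed.

End Corner.

End TROFacts.

(** * Accretive operator matrices *)

Section FamToSeq.
Context (R : realType) (J : finType) (X : Type) (sc : R[i] -> X -> X).
Context (Phi : J -> J -> X -> X -> R[i]).
Hypothesis PhiZ : forall q q' c d x y,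
  Phi q q' (sc c x) (sc d y) = conjc d * (c * Phi q q' x y).
Hypothesis Phi_ge0 : forall (I : finType) (p : I -> J) (x : I -> X),
  0 <= \sum_i \sum_j complex.Re (Phi (p i) (p j) (x j) (x i)).

(** A formal combination is a family indexed by its positions, once its
    coefficients are absorbed into the points; the disjoint union over [J] of
    these positions is again a finite index type. *)
Lemma fam_to_seq (s : J -> seq (R[i] * X)) :
  0 <= \sum_q \sum_q' complex.Re (\sum_(r <- s q') r.1 * ev (Phi q q' r.2) (s q)).
Proof.
pose T q := 'I_(size (s q)).
pose g (i : {q : J & T q}) := tnth (in_tuple (s (tag i))) (tagged i).
have := Phi_ge0 (fun i : {q : J & T q} => tag i) (fun i => sc (g i).1 (g i).2).
congr (0 <= _).
rewrite -(sig_big_dep xpredT (fun q => xpredT) (fun q (i : T q) => \sum_j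
   complex.Re (Phi q (tag j) (sc (g j).1 (g j).2)
      (sc (tnth (in_tuple (s q)) i).1 (tnth (in_tuple (s q)) i).2)))) /=.
apply: eq_bigr => q _; rewrite exchange_big /=.
rewrite -(sig_big_dep xpredT (fun q => xpredT) (fun q' (j : T q') => \sum_i
   complex.Re (Phi q q' (sc (tnth (in_tuple (s q')) j).1 (tnth (in_tuple (s q')) j).2)
      (sc (tnth (in_tuple (s q)) i).1 (tnth (in_tuple (s q)) i).2)))) /=.
apply: eq_bigr => q' _; rewrite [RHS]Re_sum [RHS]big_tnth; apply: eq_bigr => j _.
rewrite /ev mulr_sumr [RHS]Re_sum [RHS]big_tnth; apply: eq_bigr => i _.
by rewrite PhiZ mulrCA.
Qed.

End FamToSeq.

Section Accretive.
Context (R : realType).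
Implicit Types (H K : hilbert R).

Lemma mxapp_le H K (I J : finType) (z : I -> J -> bop H K) :
  exists2 C : R, 0 <= C & forall h (d : R), (forall j, rnorm (h j) <= d) ->
    forall i, rnorm (mxapp z h i) <= C * d.
Proof.
exists (\sum_i \sum_j rnorm (z i j)).
  by apply: sumr_ge0 => i _; apply: sumr_ge0 => j _; exact: rnorm_ge0.
move=> h d hd i.
apply: (@le_trans _ _ (\sum_j rnorm (z i j) * d)).
  rewrite /mxapp; elim/big_rec2 : _ => [|j x y _ xy]; first by rewrite rnorm0.
  rewrite (le_trans (rnormD _ _))// lerD// (le_trans (opnorm_le _ _))//.
  by rewrite ler_wpM2l ?rnorm_ge0.
case: (pickP J) => [j0 _|J0]; last first.
  have e (F : J -> R) : \sum_j F j = 0 by rewrite big1// => j _; have := J0 j.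
  by rewrite e big1 ?mul0r// => k _; exact: e.
have d0 : 0 <= d := le_trans (rnorm_ge0 _) (hd j0).
rewrite -mulr_suml ler_wpM2r// [leRHS](bigD1 i)//= lerDl.
by apply: sumr_ge0 => k _; apply: sumr_ge0 => j _; exact: rnorm_ge0.
Qed.

Lemma acc_closure H X (u : X -> H) (J : finType) (z : J -> J -> bop H H) :
  (forall s : J -> seq (R[i] * X),
     0 <= \sum_i rip (mxapp z (fun j => lcomb u (s j)) i) (lcomb u (s i))) ->
  forall h, (forall j, in_span u (h j)) -> 0 <= \sum_i rip (mxapp z h i) (h i).
Proof.
move=> acc h hu; have [Z Z0 hZ] := mxapp_le z.
pose N := \sum_j rnorm (h j).
have N0 : 0 <= N by apply: sumr_ge0 => j _; exact: rnorm_ge0.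
have hN j : rnorm (h j) <= N.
  by rewrite /N [leRHS](bigD1 j)//= lerDl; apply: sumr_ge0 => k _; exact: rnorm_ge0.
apply: (@le_rate _ _ _ (#|J|%:R * (Z * N + Z * (N + 1)))) => n.
have r0 := rate_gt0 R n.
have /choice[s hs] : forall j, exists s, rnorm (h j - lcomb u s) <= rate n.
  by move=> j; exact: hu.
have := acc s; set h' := fun j => lcomb u (s j) => h1.
have r1 : rate n <= 1 :> R by rewrite invf_le1 ?ler1n.
have hN' j : rnorm (h' j) <= N + 1.
  have := rnorm_triangle (h j) (h' j) 0; rewrite !subr0 rnorm_distC.
  have := hs j; have := hN j; rewrite -/(h' j); lra.
apply: (le_trans h1); rewrite -lerBlDl.
rewrite -sumrB -mulrA mulr_natl -sumr_const; apply: ler_sum => i _.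
have -> : rip (mxapp z h' i) (h' i) - rip (mxapp z h i) (h i) =
   - rip (mxapp z (fun j => h j - h' j) i) (h i) - rip (mxapp z h' i) (h i - h' i).
  have -> : mxapp z (fun j => h j - h' j) i = mxapp z h i - mxapp z h' i.
    by rewrite /mxapp -sumrB; apply: eq_bigr => j _; rewrite linearB.
  rewrite ripDl ripDr !ripNl !ripNr; ring.
have a1 := hZ (fun j => h j - h' j) (rate n) hs i.
have a2 := hZ h' (N + 1) hN' i.
have b1 := rip_CS (- mxapp z (fun j => h j - h' j) i) (h i).
have b2 := rip_CS (- mxapp z h' i) (h i - h' i).
rewrite !ripNl !rnormN in b1 b2.
have c1 := ler_pM (rnorm_ge0 _) (rnorm_ge0 _) a1 (hN i).
have c2 := ler_pM (rnorm_ge0 _) (rnorm_ge0 _) a2 (hs i).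
rewrite -/(h' i) in c2; lra.
Qed.

(** The block matrix with rows [(C, 0)] and [(- 2 z, C)], which is accretive exactly
    when [z] has norm at most [C]: norm estimates become instances of
    accretivity. *)
Definition blk H (I : finType) (C : R) (z : I -> I -> bop H H)
    (p q : bool * I) : bop H H :=
  if p.1 == q.1 then (if p.2 == q.2 then C%:C *: bop_id H else 0)
  else if p.1 then (- 2%:R : R)%:C *: z p.2 q.2 else 0.

Lemma sum_bool_pair (V : nmodType) (I : finType) (F : bool * I -> V) :
  \sum_p F p = \sum_i F (true, i) + \sum_i F (false, i).
Proof.
rewrite -[RHS]/((fun b => \sum_i F (b, i)) true + (fun b => \sum_i F (b, i)) false).
by rewrite -big_bool pair_bigA; apply: eq_bigr => -[].
Qed.

Lemma blk_form H (I : finType) C (z : I -> I -> bop H H) h :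
  \sum_p rip (mxapp (blk C z) h p) (h p) =
  C * (sqn (fun i => h (false, i)) + sqn (fun i => h (true, i))) -
  2 * \sum_i rip (mxapp z (fun i => h (false, i)) i) (h (true, i)).
Proof.
have row b i : mxapp (blk C z) h (b, i) = C%:C *: h (b, i) +
    (if b then (- 2%:R : R)%:C *: mxapp z (fun i => h (false, i)) i else 0).
  rewrite /mxapp sum_bool_pair.
  have diag : \sum_j blk C z (b, i) (b, j) (h (b, j)) = C%:C *: h (b, i).
    rewrite (bigD1 i)//= /blk !eqxx /= big1 ?addr0// => j.
    by rewrite eq_sym => /negbTE ->.
  case: b diag => diag.
    by rewrite diag; congr (_ + _); rewrite scaler_sumr; apply: eq_bigr.
  by rewrite diag addrC; congr (_ + _); rewrite big1.
rewrite sum_bool_pair mulrDr /sqn !mulr_sumr addrC -addrA; congr (_ + _).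
  by apply: eq_bigr => i _; rewrite row addr0 ripZl rip_norm.
rewrite -sumrB; apply: eq_bigr => i _.
by rewrite row ripDl !ripZl rip_norm mulNr.
Qed.

Lemma accretive_blk H (I : finType) C (z : I -> I -> bop H H) : 0 <= C ->
  (forall h, sqn (mxapp z h) <= C ^+ 2 * sqn h) -> accretive (blk C z).
Proof.
move=> C0 zC h; rewrite blk_form subr_ge0.
exact: sqn_CS.
Qed.

Lemma blk_bound H (I : finType) C (z : I -> I -> bop H H) : 0 <= C ->
  accretive (blk C z) -> forall h, sqn (mxapp z h) <= C ^+ 2 * sqn h.
Proof.
move=> C0 acc; apply: sqn_form_bound => // h k.
have := acc (fun p => if p.1 then k p.2 else h p.2).
by rewrite blk_form subr_ge0.
Qed.

Definition middle H K (m m1 : bop H K) (theta : bop H H) : bop K K :=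
  bop_comp (bop_comp m theta) (adj m1).

(** Columns over the same index of [J] add up under the [(m i)^*], which is why the
    rows and columns of [Theta] may be repeated. *)
Lemma compress_accretive H K (J I : finType) (p : I -> J) (m : I -> bop H K)
    (Theta : J -> J -> bop H H) :
  accretive Theta -> accretive (fun i j => middle (m i) (m j) (Theta (p i) (p j))).
Proof.
move=> acc k; pose g i := adj (m i) (k i).
have := acc (fun q => \sum_(i | p i == q) g i); congr (0 <= _).
transitivity (\sum_q \sum_(i | p i == q) \sum_j rip (Theta q (p j) (g j)) (g i)).
  apply: eq_bigr => q _; rewrite rip_sumr; apply: eq_bigr => i _.
  rewrite /mxapp rip_suml [RHS](partition_big p xpredT)//=.
  apply: eq_bigr => q' _; rewrite linear_sum rip_suml.
  by apply: eq_bigr => j /eqP ->.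
rewrite [RHS](partition_big p xpredT)//=; apply: eq_bigr => q _.
apply: eq_bigr => i /eqP piq; rewrite rip_suml; apply: eq_bigr => j _.
by rewrite /middle !bop_compE [RHS]rip_adjr piq.
Qed.

End Accretive.

(** * Induced representations *)

Section LinMap.
Context (S : pzRingType) (V W : lmodType S) (f : V -> W) (lf : linear f).

Definition linmap & linear f := f.

HB.instance Definition _ := GRing.isLinear.Build S V W *:%R (linmap lf) lf.

End LinMap.

Section Induced.
Context (R : realType) (A B : operator_algebra R).
Hypotheses (caiA : has_contractive_approximate_identity A)
  (caiB : has_contractive_approximate_identity B).
Context (H K G : hilbert R).
Context (alpha : {linear A -> bop H H}) (beta : {linear B -> bop K K}).
Context (pi : {linear B -> bop G G}).
Hypotheses (am : Defs.multiplicative (oa_mul A) alpha)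
  (bm : Defs.multiplicative (oa_mul B) beta)
  (pm : Defs.multiplicative (oa_mul B) pi).
Hypotheses (cia : completely_isometric (@mxnorm R A) alpha)
  (cib : completely_isometric (@mxnorm R B) beta)
  (cip : completely_isometric (@mxnorm R B) pi).
Context (M : set (bop H K)).
Hypotheses (tM : is_TRO M)
  (hA : range alpha = closed_span (mul_set (mul_set (adjoint_set M) (range beta)) M))
  (hB : range beta = closed_span (mul_set (mul_set M (range alpha)) (adjoint_set M))).

(** Left multiplication by an operator on the first space, as an operation on the
    abstract algebra [B]: in this form it can be read in other representations. *)
Definition lmul (z : bop K K) (b : B) : B :=
  xget 0 [set b' | beta b' = bop_comp z (beta b)].

Definition admissible (theta : bop H H) := forall m m1, M m -> M m1 ->
  forall b, exists b', beta b' = bop_comp (middle m m1 theta) (beta b).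

Definition act (theta : bop H H) (m m1 : bop H K) (b : B) : B :=
  lmul (middle m m1 theta) b.

Lemma actP theta m m1 b : admissible theta -> M m -> M m1 ->
  beta (act theta m m1 b) = bop_comp (middle m m1 theta) (beta b).
Proof.
by move=> adm Mm Mm1; have := xgetPex 0 (adm m m1 Mm Mm1 b).
Qed.

Lemma middle_comb (m m1 : bop H K) c (t t' : bop H H) :
  middle m m1 (c *: t + t') = c *: middle m m1 t + middle m m1 t'.
Proof. by rewrite /middle bop_comp_combr bop_comp_combl. Qed.

Lemma adm_comb c t t' : admissible t -> admissible t' -> admissible (c *: t + t').
Proof.
move=> at1 at2 m m1 Mm Mm1 b.
have [b1 h1] := at1 m m1 Mm Mm1 b; have [b2 h2] := at2 m m1 Mm Mm1 b.
by exists (c *: b1 + b2); rewrite linearP h1 h2 middle_comb bop_comp_combl.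
Qed.

Lemma adm0 : admissible 0.
Proof.
move=> m m1 _ _ b; exists 0; rewrite linear0; apply: bop_eq => x.
by rewrite !bop_compE -[(0 : bop H H) _]/(0 : H) linear0.
Qed.

Lemma admZ c t : admissible t -> admissible (c *: t).
Proof. by move=> at1; rewrite -[c *: t]addr0; apply: adm_comb => //; exact: adm0. Qed.

Lemma adm1 : admissible (bop_id H).
Proof.
move=> m m1 Mm Mm1 b; rewrite /middle bop_comp1r.
have := corner_mull tM hB Mm Mm1 (ex_intro2 _ _ b I erefl : range beta (beta b)).
by move=> [b' _ hb]; exists b'.
Qed.

Lemma adm_MM n n1 : M n -> M n1 -> admissible (bop_comp (adj n) n1).
Proof.
move=> Mn Mn1 m m1 Mm Mm1 b.
have [b1 h1] := adm1 Mn1 Mm1 b; have [b2 h2] := adm1 Mm Mn b1.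
exists b2; rewrite h2 h1 /middle !bop_comp1r.
by rewrite !bop_compA.
Qed.

Lemma corner_alpha m m1 a : M m -> M m1 -> exists b, beta b = middle m m1 (alpha a).
Proof.
move=> Mm Mm1.
have := corner_mem hB Mm Mm1 (ex_intro2 _ _ a I erefl : range alpha (alpha a)).
by move=> [b _ hb]; exists b.
Qed.

Lemma adm_alpha a : admissible (alpha a).
Proof.
move=> m m1 Mm Mm1 b; have [b0 h0] := corner_alpha a Mm Mm1.
by exists (oa_mul B b0 b); rewrite bm h0.
Qed.

Lemma act_comb c t t' m m1 b : admissible t -> admissible t' -> M m -> M m1 ->
  act (c *: t + t') m m1 b = c *: act t m m1 b + act t' m m1 b.
Proof.
move=> at1 at2 Mm Mm1; apply: (ci_inj cib).
rewrite linearP !actP//; last exact: adm_comb.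
by rewrite middle_comb bop_comp_combl.
Qed.

Lemma act_middle_comb t c m m' m1 b : admissible t -> M m -> M m' -> M m1 ->
  act t (c *: m + m') m1 b = c *: act t m m1 b + act t m' m1 b.
Proof.
move=> at1 Mm Mm' Mm1; apply: (ci_inj cib).
have Mc : M (c *: m + m') by case: tM => -[_ MD] _; exact: MD.
by rewrite linearP !actP// /middle !bop_comp_combl.
Qed.

(** The symbol [(m, b, x)] stands for the tensor of [m^*] with the vector [b x]. Only
    vectors of the form [b x] are used because products such as [n m^* b] lie in
    [B], so that they have a meaning in every representation of [B]. *)
Record sym (V : Type) := Sym {
  s_op : bop H K; s_in : M s_op; s_alg : B; s_vec : V }.

Definition ssc (V : lmodType R[i]) (c : R[i]) (x : sym V) : sym V :=
  Sym (s_in x) (s_alg x) (c *: s_vec x).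

(** On tensors this is [<theta (m^* b x), n^* c y>], with [n theta m^* b] computed in
    [B] and then represented by [pi]. *)
Definition form (theta : bop H H) (x y : sym G) : R[i] :=
  inner G (pi (act theta (s_op y) (s_op x) (s_alg x)) (s_vec x))
    (pi (s_alg y) (s_vec y)).

Lemma form_ssc theta c d x y :
  form theta (ssc c x) (ssc d y) = conjc d * (c * form theta x y).
Proof. by rewrite /form /= !bop_linZ innerZl innerZr mulrCA. Qed.

Lemma form_comb c t t' x y : admissible t -> admissible t' ->
  form (c *: t + t') x y = c * form t x y + form t' x y.
Proof.
move=> at1 at2; rewrite /form act_comb ?(s_in x) ?(s_in y)//; try exact: s_in.
by rewrite linearP bop_combE innerDl innerZl.
Qed.

Lemma form0 x y : form 0 x y = 0.
Proof.
have := form_comb (-1) x y adm0 adm0.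
by rewrite scaler0 addr0 mulN1r addNr.
Qed.

Lemma form_fam (J : finType) (Theta : J -> J -> bop H H) :
  (forall q q', admissible (Theta q q')) -> accretive Theta ->
  forall (I : finType) (p : I -> J) (x : I -> sym G),
  0 <= \sum_i \sum_j complex.Re (form (Theta (p i) (p j)) (x j) (x i)).
Proof.
move=> adm acc I p x.
apply: (transfer caiB bm pm cib cip
  (t := fun i j => act (Theta (p i) (p j)) (s_op (x i)) (s_op (x j))) _
  (compress_accretive p (fun i => s_op (x i)) acc)).
by move=> i j b; apply: actP => //; exact: s_in.
Qed.

Definition forms theta (s t : seq (R[i] * sym G)) : R[i] :=
  \sum_(r <- s) r.1 * ev (form theta r.2) t.

Lemma form_seq (J : finType) (Theta : J -> J -> bop H H) :
  (forall q q', admissible (Theta q q')) -> accretive Theta ->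
  forall s : J -> seq (R[i] * sym G),
  0 <= \sum_q \sum_q' complex.Re (forms (Theta q q') (s q') (s q)).
Proof.
move=> adm acc; apply: (@fam_to_seq _ J _ (@ssc G) (fun q q' => form (Theta q q'))).
  by move=> *; exact: form_ssc.
exact: form_fam.
Qed.

Lemma form1_pos (s : seq (R[i] * sym G)) :
  0 <= complex.Re (\sum_(p <- s) \sum_(q <- s)
    (conjc q.1) * (p.1 * form (bop_id H) p.2 q.2)).
Proof.
have acc : accretive (fun _ _ : 'I_1 => bop_id H).
  by move=> h; rewrite big_ord1 /mxapp big_ord1 rip_norm sqr_ge0.
have := form_seq (fun _ _ => adm1) acc (fun=> s).
rewrite !big_ord1; congr (0 <= complex.Re _).
apply: eq_bigr => p _; rewrite /ev mulr_sumr; apply: eq_bigr => q _.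
by rewrite mulrCA.
Qed.

(** For a purely imaginary [c], both [c] and [- c] are accretive, hence the real
    part of the corresponding form vanishes. *)
Lemma form1_Im (I : finType) (x : I -> sym G) :
  \sum_i \sum_j complex.Im (form (bop_id H) (x j) (x i)) = 0.
Proof.
have acc (c : R[i]) : complex.Re c = 0 -> accretive (fun _ _ : 'I_1 => c *: bop_id H).
  move=> c0 h; rewrite big_ord1 /mxapp big_ord1 bop_scaleE /rip innerZl.
  rewrite -inner_norm -rnormE -rmorphXn /= mulrC ReZ c0 mulr0//.
have S c : complex.Re c = 0 ->
    0 <= \sum_i \sum_j complex.Re (c * form (bop_id H) (x j) (x i)).
  move=> c0; have := form_fam (fun _ _ => admZ c adm1) (acc c c0) (fun=> 0) x.
  congr (0 <= _); apply: eq_bigr => i _; apply: eq_bigr => j _.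
  rewrite -[c *: _]addr0 (form_comb _ _ _ adm1 adm0).
  by rewrite form0 addr0.
have e (d : R) : \sum_i \sum_j complex.Re ((0 +i* d) * form (bop_id H) (x j) (x i)) =
    - d * \sum_i \sum_j complex.Im (form (bop_id H) (x j) (x i)).
  rewrite mulr_sumr; apply: eq_bigr => i _; rewrite mulr_sumr; apply: eq_bigr => j _.
  by case: (form _ (x j) (x i)) => a b /=; rewrite mul0r sub0r mulNr.
have := S (0 +i* 1) erefl; have := S (0 +i* (-1)) erefl; rewrite !e; lra.
Qed.

Lemma form1_herm x y : form (bop_id H) y x = conjc (form (bop_id H) x y).
Proof.
have im0 x0 : complex.Im (form (bop_id H) x0 x0) = 0.
  by have := form1_Im (fun _ : 'I_1 => x0); rewrite !big_ord1.
have im x0 y0 : complex.Im (form (bop_id H) x0 y0) + complex.Im (form (bop_id H) y0 x0) = 0.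
  have := form1_Im (fun b : bool => if b then x0 else y0).
  by rewrite !big_bool /= !im0; lra.
have := im x y; have := im (ssc 'i x) (ssc 1 y).
rewrite !form_ssc conjc1 !mul1r.
case: (form _ x y) => a b; case: (form _ y x) => c d /=.
by move=> h1 h2; congr (_ +i* _); lra.
Qed.

Definition ind_kernel : pos_kernel R (sym G) := PosKernel form1_herm form1_pos.

(** This is the hermitian symmetry of the kernel. It makes left multiplications by
    [m n^*] and [n m^*] mutually adjoint in [pi], which is not assumed to extend to
    any self-adjoint algebra. *)
Lemma act_swap m n b c x y : M m -> M n ->
  inner G (pi (act (bop_id H) n m c) x) (pi b y) =
  inner G (pi c x) (pi (act (bop_id H) m n b) y).
Proof.
move=> Mm Mn; have := form1_herm (Sym Mn b y) (Sym Mm c x).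
by rewrite /form /= -innerC.
Qed.

Section InducedSpace.
Context (H1 : hilbert R) (v : sym G -> H1).
Hypotheses (vE : forall x y, inner H1 (v x) (v y) = form (bop_id H) x y)
  (tv : total v).

Lemma inner_lcomb s t : inner H1 (lcomb v s) (lcomb v t) = forms (bop_id H) s t.
Proof.
rewrite inner_lcombl; apply: eq_bigr => p _; rewrite inner_lcombr.
by congr (_ * _); apply: eq_bigr => q _; rewrite vE.
Qed.

Lemma forms_comb c t t' s s' : admissible t -> admissible t' ->
  forms (c *: t + t') s s' = c * forms t s s' + forms t' s s'.
Proof.
move=> at1 at2; rewrite /forms mulr_sumr -big_split; apply: eq_bigr => p _ /=.
rewrite mulrCA -mulrDr -ev_lin; congr (_ * _); apply: eq_bigr => q _.
by rewrite form_comb.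
Qed.

Lemma forms0 s s' : forms 0 s s' = 0.
Proof. by rewrite /forms big1// => p _; rewrite /ev big1 ?mulr0// => q _; rewrite form0 mulr0. Qed.

Lemma formsZ c t s s' : admissible t -> forms (c *: t) s s' = c * forms t s s'.
Proof.
by move=> at1; rewrite -[c *: t]addr0 (forms_comb _ _ _ at1 adm0) forms0 addr0.
Qed.

Lemma forms_scll theta c s t : forms theta (scl c s) t = c * forms theta s t.
Proof.
by rewrite /forms big_map mulr_sumr; apply: eq_bigr => p _ /=; rewrite mulrA.
Qed.

Lemma adm_blk (I : finType) C (z : I -> I -> bop H H) :
  (forall i j, admissible (z i j)) -> forall p q, admissible (blk C z p q).
Proof.
move=> az p q; rewrite /blk; case: ifP => _; case: ifP => _.
- exact: admZ adm1.
- exact: adm0.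
- exact: admZ.
- exact: adm0.
Qed.

(** Rescaling one argument of a sesquilinear form turns a bound by a quadratic
    mean into a bound by a product. *)
Lemma amgm (g p q C : R) : 0 <= g -> 0 <= p -> 0 <= q -> 0 <= C ->
  (forall r, 0 < r -> 2 * (r * g) <= C * (r ^+ 2 * p ^+ 2 + q ^+ 2)) ->
  g <= C * p * q.
Proof.
move=> g0 p0 q0 C0 h.
have [p1|p1] := eqVneq p 0.
  rewrite p1 mulr0 mul0r; apply: (@le_rate _ _ _ (C * q ^+ 2)) => n; rewrite add0r.
  have r0 := rate_gt0 R n; have := h (rate n)^-1 ltac:(by rewrite invr_gt0).
  rewrite p1 expr0n /= mulr0 add0r [_^-1 * g]mulrC mulrA ler_pdivrMr// => h1.
  by nra.
have p2 : 0 < p by rewrite lt_def p1.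
have [q1|q1] := eqVneq q 0.
  rewrite q1 mulr0; apply: (@le_rate _ _ _ (C * p ^+ 2)) => n; rewrite add0r.
  have r0 := rate_gt0 R n; have := h (rate n) r0.
  rewrite q1 expr0n /= addr0 => h1.
  have h2 := mulr_ge0 C0 (mulr_ge0 (sqr_ge0 (rate n)) (sqr_ge0 p)).
  have : rate n * g <= rate n * (C * p ^+ 2 * rate n) by lra.
  by rewrite ler_pM2l.
have q2 : 0 < q by rewrite lt_def q1.
have := h (q / p) ltac:(by rewrite divr_gt0).
have -> : C * ((q / p) ^+ 2 * p ^+ 2 + q ^+ 2) = 2 * (q / p * (C * p * q)) by field.
by rewrite ler_pM2l// ler_pM2l// divr_gt0.
Qed.

Lemma forms_bound theta C s t : admissible theta -> 0 <= C -> rnorm theta <= C ->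
  cmod (forms theta s t) <= C * rnorm (lcomb v s) * rnorm (lcomb v t).
Proof.
move=> at1 C0 tC.
have [c c1 hc] := rotation (forms theta s t).
apply: amgm; rewrite ?cmod_ge0 ?rnorm_ge0// => r r0.
have acc : accretive (blk C (fun _ _ : 'I_1 => theta)).
  apply: accretive_blk => // h; rewrite /sqn /mxapp !big_ord1 -exprMn.
  rewrite ler_sqr ?nnegrE ?mulr_ge0 ?rnorm_ge0//.
  by rewrite (le_trans (opnorm_le _ _))// ler_wpM2r ?rnorm_ge0.
have := form_seq (adm_blk C (fun _ _ : 'I_1 => at1)) acc
  (fun p => if p.1 then t else scl (r%:C * c) s).
rewrite !sum_bool_pair !big_ord1 !sum_bool_pair !big_ord1 /blk /=.
rewrite !(formsZ _ _ _ adm1) (formsZ _ _ _ at1) forms0 -!inner_lcomb !ReZ.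
rewrite -!/(rip _ _) !rip_norm lcomb_scl rnormZ -/(cmod _) cmodM c1 mulr1 cmodR gtr0_norm//.
have -> : complex.Re (forms theta (scl (r%:C * c) s) t) = r * cmod (forms theta s t).
  by rewrite forms_scll -mulrA hc ReZ.
by rewrite exprMn; lra.
Qed.

(** [theta'] is the operator that [theta] should become on the induced space. As a
    relation, this is stable under linear combinations and passes to block
    matrices. *)
Definition induces (theta : bop H H) (theta' : bop H1 H1) : Prop :=
  admissible theta /\ forall x y, inner H1 (theta' (v x)) (v y) = form theta x y.

Lemma induced_ex theta : admissible theta -> exists theta', induces theta theta'.
Proof.
move=> at1.
have [|T hT] := @bop_of_total_form R H1 H1 _ _ v v (form theta) (rnorm theta)
  tv tv (rnorm_ge0 _); last by exists T.
by move=> s t; apply: forms_bound => //; exact: rnorm_ge0.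
Qed.

Lemma induces1 : induces (bop_id H) (bop_id H1).
Proof. by split => [|x y]; [exact: adm1|rewrite -vE]. Qed.

Lemma induces_comb c t t' u u' : induces t u -> induces t' u' ->
  induces (c *: t + t') (c *: u + u').
Proof.
move=> [at1 tu] [at2 tu']; split; first exact: adm_comb.
by move=> x y; rewrite bop_combE innerDl innerZl tu tu' form_comb.
Qed.

Lemma induces0 : induces 0 0.
Proof.
split => [|x y]; first exact: adm0.
have -> : (0 : bop H1 H1) (v x) = 0 by [].
by rewrite form0 inner0l.
Qed.

Lemma inducesZ c t u : induces t u -> induces (c *: t) (c *: u).
Proof. by move=> tu; rewrite -[c *: t]addr0 -[c *: u]addr0; apply: induces_comb => //; exact: induces0. Qed.

Lemma induces_uniq t u u' : induces t u -> induces t u' -> u = u'.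
Proof.
move=> [_ tu] [_ tu']; apply: (bop_eq_total tv) => x.
by apply: (inner_eq_total tv) => y; rewrite tu tu'.
Qed.

Lemma induces_blk (I : finType) C (z : I -> I -> bop H H) (z' : I -> I -> bop H1 H1) :
  (forall i j, induces (z i j) (z' i j)) -> forall p q, induces (blk C z p q) (blk C z' p q).
Proof.
move=> zz p q; rewrite /blk; case: ifP => _; case: ifP => _.
- exact: inducesZ induces1.
- exact: induces0.
- exact: inducesZ.
- exact: induces0.
Qed.

Lemma induces_forms t u s s' : induces t u ->
  inner H1 (u (lcomb v s)) (lcomb v s') = forms t s s'.
Proof.
move=> [_ tu]; rewrite bop_lcomb inner_lcombl; apply: eq_bigr => p _.
rewrite inner_lcombr; congr (_ * _); apply: eq_bigr => q _.
by rewrite tu.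
Qed.

Lemma induced_accretive (J : finType) (Th : J -> J -> bop H H) (Th' : J -> J -> bop H1 H1) :
  (forall p q, induces (Th p q) (Th' p q)) -> accretive Th -> accretive Th'.
Proof.
move=> ind acc h; apply: (@acc_closure _ _ _ v) => [s|j]; last exact: tv.
have := form_seq (fun p q => (ind p q).1) acc s; congr (0 <= _).
apply: eq_bigr => q _; rewrite rip_suml; apply: eq_bigr => q' _.
by rewrite /rip (induces_forms _ _ (ind q q')).
Qed.

Definition wvec (m : bop H K) (x : sym G) : G :=
  pi (act (bop_id H) m (s_op x) (s_alg x)) (s_vec x).

Lemma wvec_inner m x y : M m ->
  inner G (wvec m x) (wvec m y) = form (bop_comp (adj m) m) x y.
Proof.
move=> Mm; rewrite -act_swap//; last exact: s_in.
rewrite /form; congr (inner G (pi _ _) _); apply: (ci_inj cib).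
have sx := s_in x; have sy := s_in y.
rewrite (actP _ adm1 sy Mm) (actP _ adm1 Mm sx) (actP _ (adm_MM Mm Mm) sy sx).
by rewrite /middle !bop_comp1r !bop_compA.
Qed.

(** The bound is the one of [m^* m] in the induced form, by [wvec_inner]. *)
Lemma ind_W_ex m : M m -> exists W : bop H1 G, forall x, W (v x) = wvec m x.
Proof.
move=> Mm; have am1 := adm_MM Mm Mm.
apply: (@bop_ext R H1 G _ v (wvec m) (Num.sqrt (rnorm (bop_comp (adj m) m)))) => // s.
rewrite -ler_sqr ?nnegrE ?mulr_ge0 ?sqrtr_ge0 ?rnorm_ge0// exprMn sqr_sqrtr ?rnorm_ge0//.
rewrite -rip_norm (le_trans (Re_le_cmod _))//.
have -> : inner G (lcomb (wvec m) s) (lcomb (wvec m) s) = forms (bop_comp (adj m) m) s s.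
  rewrite inner_lcombl; apply: eq_bigr => p _; rewrite inner_lcombr.
  by congr (_ * _); apply: eq_bigr => q _; rewrite wvec_inner.
by rewrite expr2 mulrA; apply: forms_bound => //; exact: rnorm_ge0.
Qed.

Section InducedOps.
Context (W : bop H K -> bop H1 G).
Hypothesis WE : forall m, M m -> forall x, W m (v x) = wvec m x.

Lemma adjWE m (Mm : M m) b k : adj (W m) (pi b k) = v (Sym Mm b k).
Proof.
apply: (inner_eq_total tv) => x; rewrite vE innerC -adjP WE// -innerC.
by rewrite /form /= act_swap//; exact: s_in.
Qed.

Definition ess (bk : B * G) : G := pi bk.1 bk.2.

Lemma ess_W m h : M m -> in_span ess (W m h).
Proof.
move=> Mm e e0; have N1 : 0 < rnorm (W m) + 1 by rewrite ltr_wpDl ?rnorm_ge0.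
have [s hs] := @tv h (e / (rnorm (W m) + 1)) ltac:(by rewrite divr_gt0).
exists [seq (p.1, (act (bop_id H) m (s_op p.2) (s_alg p.2), s_vec p.2)) | p <- s].
have -> : lcomb ess [seq (p.1, (act (bop_id H) m (s_op p.2) (s_alg p.2), s_vec p.2)) | p <- s]
    = W m (lcomb v s).
  rewrite bop_lcomb /lcomb big_map; apply: eq_bigr => p _ /=.
  by rewrite WE.
rewrite -bop_linB (le_trans (opnorm_le _ _))//.
move: hs; rewrite ler_pdivlMr// => hs.
have := rnorm_ge0 (h - lcomb v s); nra.
Qed.

(** Both sides lie in the closed span of the vectors [pi b k], and they have the
    same inner products with these vectors. *)
Lemma W_induced t u m x : induces t u -> M m ->
  W m (u (v x)) = pi (act t m (s_op x) (s_alg x)) (s_vec x).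
Proof.
move=> [at1 tu] Mm; apply/eqP; rewrite -subr_eq0; apply/eqP.
apply: (@orth_span _ _ _ ess).
  move=> e e0; have [s hs] := ess_W (u (v x)) Mm e0.
  exists (s ++ scl (-1) [:: (1, (act t m (s_op x) (s_alg x), s_vec x))]).
  rewrite lcomb_cat lcomb_scl {2}/lcomb big_seq1 /ess /= scale1r scaleN1r.
  by rewrite opprD opprK addrACA addNr addr0.
move=> [b k]; rewrite /ess /= innerBl.
have -> : inner G (W m (u (v x))) (pi b k) = form t x (Sym Mm b k).
  by rewrite -tu -(adjWE Mm) adjP.
by rewrite /form /= subrr.
Qed.

Definition kvec (x : sym K) : H := adj (s_op x) (beta (s_alg x) (s_vec x)).

(** By [W_induced], compressing [Th'] by the [W m] multiplies [pi b] in the way that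
    compressing [Th] by the [m] multiplies [beta b]; so [transfer] also works with
    the two representations exchanged. *)
Lemma reverse_accretive (J : finType) (Th : J -> J -> bop H H) (Th' : J -> J -> bop H1 H1) :
  (forall p q, induces (Th p q) (Th' p q)) -> accretive Th' ->
  forall h, (forall j, in_span kvec (h j)) -> 0 <= \sum_i rip (mxapp Th h i) (h i).
Proof.
move=> ind acc h hk; apply: (@acc_closure _ _ _ kvec) => // s.
have := @fam_to_seq _ J _ (@ssc K) (fun q q' x y => inner H (Th q q' (kvec x)) (kvec y)).
move=> /(_ _ _ s) F; have {F} := F _ _.
have -> : \sum_q \sum_q' complex.Re (\sum_(r <- s q') r.1 *
    ev (fun y => inner H (Th q q' (kvec r.2)) (kvec y)) (s q)) =
    \sum_i rip (mxapp Th (fun j => lcomb kvec (s j)) i) (lcomb kvec (s i)).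
  apply: eq_bigr => q _; rewrite /mxapp rip_suml; apply: eq_bigr => q' _.
  rewrite /rip bop_lcomb inner_lcombl; congr complex.Re; apply: eq_bigr => p _.
  by rewrite inner_lcombr.
apply=> [q q' c d x y|I p x].
  by rewrite /kvec /ssc /= !bop_linZ innerZl innerZr mulrCA.
have := transfer caiB pm bm cip cib
  (t := fun i j => act (Th (p i) (p j)) (s_op (x i)) (s_op (x j))) _
  (compress_accretive p (fun i => W (s_op (x i))) acc)
  (fun i => s_alg (x i)) (fun i => s_vec (x i)).
have tE i j b : pi (act (Th (p i) (p j)) (s_op (x i)) (s_op (x j)) b) =
    bop_comp (middle (W (s_op (x i))) (W (s_op (x j))) (Th' (p i) (p j))) (pi b).
  apply: bop_eq => k; rewrite /middle !bop_compE (adjWE (s_in (x j))).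
  by rewrite (W_induced _ (ind _ _) (s_in (x i))).
move=> /(_ tE); congr (0 <= _); apply: eq_bigr => i _; apply: eq_bigr => j _.
rewrite (actP _ (ind _ _).1 (s_in _) (s_in _)) /middle !bop_compE.
by rewrite rip_adjr.
Qed.

Lemma kvec_alpha a h : in_span kvec (alpha a h).
Proof.
apply/in_spanP.
have aX : closed_span (mul_set (mul_set (adjoint_set M) (range beta)) M) (alpha a).
  by rewrite -hA; exists a.
apply: (@closed_span_map R _ _ (fun T : bop H H => T h) (rnorm h) _ _ _ _ _ _ _ _ aX).
- by [].
- by move=> T; rewrite mulrC; exact: opnorm_le.
- exact: closed_span_subspace.
- exact: closed_span_closed.
move=> _ /mul3P[x [y [z [/adjoint_setP Mx [b _ <-] Mz ->]]]].
by apply: sub_closed_span; exists (Sym Mx b (z h)) => //; rewrite /kvec /= adjK.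
Qed.

(** Apply the accretivity criterion for norms in both directions. On the original
    space the form is only controlled on the closed span of the vectors
    [m^* b k]; an approximate identity of [A] maps every vector into this span
    without increasing its norm. *)
Lemma induced_ci (T : {linear A -> bop H1 H1}) :
  (forall a, induces (alpha a) (T a)) -> completely_isometric (@mxnorm R A) T.
Proof.
move=> Tind n a; rewrite -cia.
apply/eqP; rewrite eq_le; apply/andP; split.
  have C0 := opmx_norm_ge0 (map_mx alpha a).
  apply: opmx_norm_lub => //; apply: blk_bound => //.
  apply: induced_accretive (accretive_blk C0 (opmx_norm_le _)).
  by apply: induces_blk => i j; rewrite !mxE.
have C0 := opmx_norm_ge0 (map_mx T a); set C := opmx_norm (map_mx T a) in C0 *.
apply: opmx_norm_lub => // h.
have acc := accretive_blk C0 (opmx_norm_le (map_mx T a)).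
pose z i j := map_mx alpha a i j.
have zz i j : induces (z i j) (map_mx T a i j) by rewrite /z !mxE.
pose D := \sum_(i < n) \sum_(j < n) rnorm (h j).
have Dpos : 0 <= D.
  by apply: sumr_ge0 => i _; apply: sumr_ge0 => j _; exact: rnorm_ge0.
have G0 : 0 <= C ^+ 2 * sqn h by rewrite mulr_ge0 ?sqr_ge0 ?sqn_ge0.
apply: (sqn_approx G0 Dpos) => k.
have [e [e1 _ eR]] := cai_finite (fun ij : 'I_n * 'I_n => a ij.1 ij.2) caiA (rate_gt0 R k).
pose g j := alpha e (h j).
exists (mxapp z g).
  have gh : sqn g <= sqn h.
    apply: ler_sum => i _; rewrite ler_sqr ?nnegrE ?rnorm_ge0//.
    by rewrite (le_trans (opnorm_le _ _))// ler_piMl ?rnorm_ge0// (ci_rnorm _ cia).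
  apply: (@le_trans _ _ (C ^+ 2 * sqn g)); last by rewrite ler_wpM2l ?sqr_ge0.
  apply: sqn_form_bound1 => // r.
  have := reverse_accretive (induces_blk C zz) acc.
  move=> /(_ (fun p => if p.1 then r%:C *: mxapp z g p.2 else g p.2)).
  rewrite blk_form subr_ge0; apply => -[[] i] /=; last exact: kvec_alpha.
  have lS := closed_span_subspace (range kvec).
  apply/in_spanP; apply: (subspaceZ _ lS); apply: (subspace_sum _ lS) => j.
  by apply/in_spanP; rewrite /z mxE; exact: kvec_alpha.
move=> i.
have -> : mxapp z h i = mxapp z g i - \sum_j alpha (oa_mul A (a i j) e - a i j) (h j).
  rewrite /mxapp -sumrB; apply: eq_bigr => j _.
  by rewrite (linearB alpha) bop_subE am bop_compE /g /z mxE subKr.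
rewrite (le_trans (rnormD _ _))// rnormN lerD2l.
apply: (@le_trans _ _ (\sum_j rnorm (h j) * rate k)).
  elim/big_rec2 : _ => [|j x y _ xy]; first by rewrite rnorm0.
  rewrite (le_trans (rnormD _ _))// lerD// (le_trans (opnorm_le _ _))//.
  rewrite mulrC ler_wpM2l ?rnorm_ge0// (ci_rnorm _ cia).
  exact: (eR (i, j)).
rewrite -mulr_suml ler_wpM2r ?(ltW (rate_gt0 _ _))// /D [leRHS](bigD1 i)//= lerDl.
by apply: sumr_ge0 => l _; apply: sumr_ge0 => j _; exact: rnorm_ge0.
Qed.

Definition elementA a := exists m b m1,
  [/\ M m, M m1 & alpha a = bop_comp (bop_comp (adj m) (beta b)) m1].

Definition elementB b := exists m a m1,
  [/\ M m, M m1 & beta b = middle m m1 (alpha a)].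

Lemma elementA_dense a : closed_span elementA a.
Proof.
have := isometry_span (fun x => ci_rnorm x cia) hA (a := a).
apply: closed_span_min; [exact: closed_span_subspace|exact: closed_span_closed|].
move=> x /mul3P[m [b' [m1 [/adjoint_setP Mm [b _ <-] Mm1 E]]]].
apply: sub_closed_span; exists (adj m), b, m1; split => //.
by rewrite adjK.
Qed.

Lemma elementB_dense b : closed_span elementB b.
Proof.
have := isometry_span (fun x => ci_rnorm x cib) hB (a := b).
apply: closed_span_min; [exact: closed_span_subspace|exact: closed_span_closed|].
move=> x /mul3P[m [a' [m1 [Mm [a _ <-] /adjoint_setP Mm1 E]]]].
apply: sub_closed_span; exists m, a, (adj m1); split => //.
by rewrite /middle adjK.
Qed.

Lemma oa_rnorm_mul (E : operator_algebra R) (a b : E) :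
  rnorm (oa_mul E a b) <= rnorm a * rnorm b.
Proof. by rewrite -lecR rmorphM /= !rnormE oa_norm_mul. Qed.

Section InducedAlgebra.
Context (T : {linear A -> bop H1 H1}).
Hypothesis Tind : forall a, induces (alpha a) (T a).

Lemma T_element a m b m1 : M m -> M m1 ->
  alpha a = bop_comp (bop_comp (adj m) (beta b)) m1 ->
  T a = bop_comp (bop_comp (adj (W m)) (pi b)) (W m1).
Proof.
move=> Mm Mm1 E; apply: (induces_uniq (Tind a)); split; first exact: adm_alpha.
move=> x y; rewrite !bop_compE innerC -adjP -innerC !WE//.
have sx := s_in x; have sy := s_in y.
rewrite /wvec -bop_compE -pm -act_swap//; rewrite /form.
congr (inner G (pi _ _) _); apply: (ci_inj cib).
rewrite (actP _ adm1 sy Mm) bm (actP _ adm1 Mm1 sx) (actP _ (adm_alpha a) sy sx).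
by rewrite /middle !bop_comp1r E !bop_compA.
Qed.

Lemma T_norm a : rnorm (T a) = rnorm a.
Proof. exact: ci_rnorm (induced_ci Tind). Qed.

Lemma W_adjW n m b k : M n -> M m ->
  W n (adj (W m) (pi b k)) = pi (act (bop_id H) n m b) k.
Proof. by move=> Mn Mm; rewrite (adjWE Mm) WE. Qed.

Lemma T_mul_element a a' : elementA a -> elementA a' ->
  T (oa_mul A a a') = bop_comp (T a) (T a').
Proof.
move=> [n [c [n1 [Mn Mn1 Ea]]]] [m [b [m1 [Mm Mm1 Ea']]]].
rewrite (T_element Mn Mn1 Ea) (T_element Mm Mm1 Ea').
rewrite (@T_element _ n (oa_mul B c (act (bop_id H) n1 m b)) m1)//.
  apply: bop_eq => x; rewrite !bop_compE; congr (adj (W n) _).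
  by rewrite W_adjW// pm.
by rewrite am Ea Ea' bm (actP _ adm1 Mn1 Mm) /middle bop_comp1r !bop_compA.
Qed.

Lemma T_mul a a' : T (oa_mul A a a') = bop_comp (T a) (T a').
Proof.
have half x : elementA x -> forall y, T (oa_mul A x y) = bop_comp (T x) (T y).
  move=> ex y; apply/eqP; rewrite -subr_eq0; apply/eqP.
  have := @elementA_dense y; move: y.
  apply: (@closed_span_zero R _ _ (fun y => T (oa_mul A x y) - bop_comp (T x) (T y)) (2 * rnorm x)).
  - move=> c y y'; rewrite linearPr !linearP /= bop_comp_combr scalerBr.
    by rewrite !opprD !addrA; congr (_ + _); rewrite -!addrA; congr (_ + _); rewrite addrC.
  - move=> y; rewrite (le_trans (rnormD _ _))// rnormN T_norm.
    have := oa_rnorm_mul x y; have := opnorm_comp (T x) (T y); rewrite !T_norm; lra.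
  - by move=> y ey; rewrite T_mul_element// subrr.
apply/eqP; rewrite -subr_eq0; apply/eqP.
have := @elementA_dense a; move: a.
apply: (@closed_span_zero R _ _ (fun x => T (oa_mul A x a') - bop_comp (T x) (T a')) (2 * rnorm a')).
- move=> c y y'; rewrite linearPl !linearP /= bop_comp_combl scalerBr.
  by rewrite !opprD !addrA; congr (_ + _); rewrite -!addrA; congr (_ + _); rewrite addrC.
- move=> y; rewrite (le_trans (rnormD _ _))// rnormN T_norm.
  have := oa_rnorm_mul y a'; have := opnorm_comp (T y) (T a'); rewrite !T_norm; lra.
- by move=> y ey; rewrite half// subrr.
Qed.

Lemma W_comb c m m' : M m -> M m' -> W (c *: m + m') = c *: W m + W m'.
Proof.
move=> Mm Mm'; have Mc : M (c *: m + m') by case: tM => -[_ MD] _; exact: MD.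
apply: (bop_eq_total tv) => x; rewrite bop_combE !WE// /wvec.
by rewrite (act_middle_comb _ _ adm1 Mm Mm' (s_in x)) linearP bop_combE.
Qed.

Lemma W_triple m1 m2 m3 : M m1 -> M m2 -> M m3 ->
  bop_comp (bop_comp (W m1) (adj (W m2))) (W m3) =
  W (bop_comp (bop_comp m1 (adj m2)) m3).
Proof.
move=> M1 M2 M3; have M4 := TRO_mul tM M1 M2 M3.
apply: (bop_eq_total tv) => x; rewrite !bop_compE !WE// /wvec W_adjW//.
congr (pi _ _); apply: (ci_inj cib); have sx := s_in x.
rewrite (actP _ adm1 M1 M2) (actP _ adm1 M3 sx) (actP _ adm1 M4 sx).
by rewrite /middle !bop_comp1r !bop_compA.
Qed.

(** Both sides agree on the essential space of [pi] and vanish on its orthogonal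
    complement, by [orth_essential]. Instead of a decomposition of [G], the proof
    uses that the range of the adjoint of their difference [N] lies in this
    complement, so that [N N^* = 0]. *)
Lemma pi_element b m a m1 : M m -> M m1 -> beta b = middle m m1 (alpha a) ->
  pi b = middle (W m) (W m1) (T a).
Proof.
move=> Mm Mm1 E.
have on_ess c x : middle (W m) (W m1) (T a) (pi c x) = pi b (pi c x).
  rewrite /middle !bop_compE (adjWE Mm1) (W_induced _ (Tind a) Mm) /=.
  rewrite -[RHS]bop_compE -pm; congr (pi _ _); apply: (ci_inj cib).
  by rewrite (actP _ (adm_alpha a) Mm Mm1) bm E.
set D := middle (W m) (W m1) (T a) in on_ess *.
pose N := D - pi b.
have N0 c x : N (pi c x) = 0 by rewrite bop_subE on_ess subrr.
suff NN : N = 0 by apply/eqP; rewrite eq_sym -subr_eq0 -/N NN.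
have ortho y c x : inner G (adj N y) (pi c x) = 0.
  by rewrite innerC -adjP N0 inner0l conjc0.
have NadjN y : N (adj N y) = 0.
  rewrite bop_subE (orth_essential caiB pm cip (ortho y)) subr0 /D /middle bop_compE.
  suff -> : adj (W m1) (adj N y) = 0 by rewrite bop_lin0.
  apply: (inner_eq_total tv) => x.
  by rewrite inner0l innerC -adjP -innerC WE// ortho.
rewrite -[N]adjK (_ : adj N = 0) ?adj0//; apply: bop_eq => y.
by apply/rnorm0_eq0/eqP; rewrite -sqrf_eq0 -rip_norm -rip_adjr NadjN rip0l.
Qed.

Definition Wset : set (bop H1 G) := [set W m | m in M].

Lemma Wset_TRO : is_TRO Wset.
Proof.
have [[M0 MD] _] := tM; split.
  split.
    exists 0 => //; have := W_comb (-1) M0 M0.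
    by rewrite scaler0 addr0 scaleN1r addNr.
  move=> c _ _ [m Mm <-] [m' Mm' <-]; exists (c *: m + m'); first exact: MD.
  exact: W_comb.
move=> t /mul3P[x [y [z [[m1 M1 <-] /adjoint_setP [m2 M2 E2] [m3 M3 <-] ->]]]].
rewrite -[y]adjK -E2 W_triple//.
by exists (bop_comp (bop_comp m1 (adj m2)) m3) => //; exact: TRO_mul.
Qed.

Lemma alpha_corner m b m1 : M m -> M m1 ->
  exists a, alpha a = bop_comp (bop_comp (adj m) (beta b)) m1.
Proof.
move=> Mm Mm1.
have : range alpha (bop_comp (bop_comp (adj m) (beta b)) m1).
  rewrite hA; apply: sub_closed_span.
  by apply: mul3; [exact: adjoint_set_adj|exists b|].
by move=> [a _ ha]; exists a.
Qed.

Lemma rep_subspaces (E : operator_algebra R) (L : hilbert R) (u : {linear E -> bop L L}) :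
  Defs.multiplicative (oa_mul E) u -> completely_isometric (@mxnorm R E) u ->
  closed_algebra (range u).
Proof.
move=> um ciu; split; first exact: range_subspace.
  move=> _ [_ [_ [[a _ <-] [b _ <-] ->]]].
  by exists (oa_mul E a b).
exact: isometry_range_closed (fun x => ci_rnorm x ciu).
Qed.

Lemma induced_range :
  range T = closed_span (mul_set (mul_set (adjoint_set Wset) (range pi)) Wset).
Proof.
have [lT _ cT] := rep_subspaces T_mul (induced_ci Tind).
apply/seteqP; split.
  move=> _ [a _ <-].
  apply: (@closed_span_map R _ _ T 1 _ _ _ _ _ _ _ _ (@elementA_dense a)).
  - exact: linearP.
  - by move=> x; rewrite T_norm mul1r.
  - exact: closed_span_subspace.
  - exact: closed_span_closed.
  move=> x [m [b [m1 [Mm Mm1 /(T_element Mm Mm1) ->]]]].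
  apply: sub_closed_span.
  by apply: mul3; [apply: adjoint_set_adj; exists m|exists b|exists m1].
apply: closed_span_min => // t /mul3P[x [y [z [/adjoint_setP [m Mm E] [b _ <-] [m1 Mm1 <-] ->]]]].
have [a ha] := alpha_corner b Mm Mm1.
by exists a => //; rewrite (T_element Mm Mm1 ha) E adjK.
Qed.

Lemma pi_range :
  range pi = closed_span (mul_set (mul_set Wset (range T)) (adjoint_set Wset)).
Proof.
have [lT _ cT] := rep_subspaces pm cip.
apply/seteqP; split.
  move=> _ [b _ <-].
  apply: (@closed_span_map R _ _ pi 1 _ _ _ _ _ _ _ _ (@elementB_dense b)).
  - exact: linearP.
  - by move=> x; rewrite (ci_rnorm _ cip) mul1r.
  - exact: closed_span_subspace.
  - exact: closed_span_closed.
  move=> x [m [a [m1 [Mm Mm1 /(pi_element Mm Mm1) ->]]]].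
  apply: sub_closed_span.
  by apply: mul3; [exists m|exists a|apply: adjoint_set_adj; exists m1].
apply: closed_span_min => // t /mul3P[x [y [z [[m Mm <-] [a _ <-] /adjoint_setP [m1 Mm1 E] ->]]]].
have [b hb] := corner_alpha a Mm Mm1.
by exists b => //; rewrite (pi_element Mm Mm1 hb) /middle E adjK.
Qed.

End InducedAlgebra.

End InducedOps.

End InducedSpace.

(** The representation [pi] of [B] was arbitrary: this is what allows two
    equivalences with a common algebra to be expressed through the same
    representation of that algebra. *)
Theorem induced_TRO : exists (H1 : hilbert R) (T : {linear A -> bop H1 H1}),
  completely_isometric_representation T /\ strongly_TRO_equivalent (range T) (range pi).
Proof.
have [H1 [v [vE tv]]] := kolmogorov ind_kernel.
have /choice[W WM] : forall m, exists W : bop H1 G, M m -> forall x, W (v x) = wvec m x.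
  move=> m; have [Mm|nMm] := pselect (M m); last by exists 0.
  by have [W0 hW0] := ind_W_ex vE tv Mm; exists W0.
have WE m (Mm : M m) x : W m (v x) = wvec m x by exact: WM.
have /choice[T0 T0ind] : forall a, exists T : bop H1 H1, induces v (alpha a) T.
  by move=> a; apply: (induced_ex vE tv); exact: adm_alpha.
have linT : linear T0.
  move=> c a a'; apply: (induces_uniq tv (T0ind _)).
  by rewrite linearP; exact: induces_comb.
pose T : {linear A -> bop H1 H1} := linmap linT.
have Tind a : induces v (alpha a) (T a) by exact: T0ind.
have ciT := induced_ci vE tv WE Tind.
have mT := T_mul vE tv WE Tind.
exists H1, T; split.
  by split => //; split => // n a; rewrite ciT.
split; first exact: rep_subspaces.
  exact: rep_subspaces.
exists (Wset W); split.
- exact: (Wset_TRO vE tv WE).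
- exact: (induced_range vE tv WE Tind).
- exact: (pi_range vE tv WE Tind).
Qed.

End Induced.

(** * Composition of strong TRO equivalences *)

Section Composition.
Context (R : realType).
Implicit Types (H K L : hilbert R).

(** The largest self-adjoint algebra that multiplies [B] into itself on both sides.
    It is unital, and it contains [M M^*] whenever [B = [M A M^*]]. *)
Definition diagonal K (B : set (bop K K)) : set (bop K K) :=
  [set e | forall b, B b -> [/\ B (bop_comp e b), B (bop_comp b e),
     B (bop_comp (adj e) b) & B (bop_comp b (adj e))]].

Definition bridge H K L (M : set (bop H K)) (B : set (bop K K)) (N : set (bop K L)) :=
  mul_set (mul_set N (diagonal B)) M.

Lemma diagonal_id K (B : set (bop K K)) : diagonal B (bop_id K).
Proof. by move=> b Bb; rewrite adj_id !bop_comp1l !bop_comp1r; split. Qed.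

Lemma diagonal_adj K (B : set (bop K K)) e : diagonal B e -> diagonal B (adj e).
Proof. by move=> De b Bb; rewrite adjK; have [] := De b Bb; split. Qed.

Lemma diagonal_comp K (B : set (bop K K)) e e' :
  diagonal B e -> diagonal B e' -> diagonal B (bop_comp e e').
Proof.
move=> De De' b Bb; rewrite adj_comp.
have [x1 x2 x3 x4] := De b Bb; have [y1 y2 y3 y4] := De' b Bb.
split.
- by rewrite bop_compA; have [] := De _ y1.
- by rewrite -bop_compA; have [] := De' _ x2.
- by rewrite bop_compA; have [] := De' _ x3.
- by rewrite -bop_compA; have [] := De _ y4.
Qed.

Lemma adjoint_bridge H K L (M : set (bop H K)) (B : set (bop K K)) (N : set (bop K L)) :
  adjoint_set (bridge M B N) = bridge (adjoint_set N) B (adjoint_set M).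
Proof.
apply/seteqP; split => x.
  move=> /adjoint_setP/mul3P[n [e [m [Nn De Mm E]]]].
  rewrite -[x]adjK E !adj_comp -bop_compA; apply: mul3.
  - exact: adjoint_set_adj.
  - exact: diagonal_adj.
  - exact: adjoint_set_adj.
move=> /mul3P[m [e [n [/adjoint_setP Mm De /adjoint_setP Nn ->]]]].
apply/adjoint_setP; rewrite !adj_comp -bop_compA; apply: mul3 => //.
exact: diagonal_adj.
Qed.

Lemma adjoint_lin_span H K (X : set (bop H K)) :
  adjoint_set (lin_span X) = lin_span (adjoint_set X).
Proof.
have sub (H' K' : hilbert R) (Y : set (bop H' K')) :
    adjoint_set (lin_span Y) `<=` lin_span (adjoint_set Y).
  move=> x /adjoint_setP; rewrite -{2}[x]adjK; move: (adj x) => y.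
  apply: (@lin_span_min _ _ Y [set y | lin_span (adjoint_set Y) (adj y)]).
    have lS := lin_span_subspace (adjoint_set Y).
    split; first by rewrite /= adj0; exact: lS.1.
    by move=> c u u' Su Su'; rewrite /= adj_comb; exact: lS.2.
  by move=> u Yu; apply: sub_lin_span; exact: adjoint_set_adj.
apply/seteqP; split; first exact: sub.
move=> x Xx; apply/adjoint_setP; rewrite -[X]adjoint_setK; apply: sub.
by apply/adjoint_setP; rewrite adjK.
Qed.

Lemma corner_diagonal H K (A : set (bop H H)) (B : set (bop K K)) (M : set (bop H K)) m1 m2 :
  is_TRO M -> B = closed_span (mul_set (mul_set M A) (adjoint_set M)) ->
  M m1 -> M m2 -> diagonal B (bop_comp m1 (adj m2)).
Proof.
move=> tM hB M1 M2 b Bb; rewrite adj_comp adjK; split.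
- exact (corner_mull tM hB M1 M2 Bb).
- exact (corner_mulr tM hB M1 M2 Bb).
- exact (corner_mull tM hB M2 M1 Bb).
- exact (corner_mulr tM hB M2 M1 Bb).
Qed.

Section Half.
Context (H K L : hilbert R) (A : set (bop H H)) (B : set (bop K K)) (C : set (bop L L)).
Context (M : set (bop H K)) (N : set (bop K L)).
Hypotheses (cA : closed_algebra A)
  (hA : A = closed_span (mul_set (mul_set (adjoint_set M) B) M))
  (hB : B = closed_span (mul_set (mul_set (adjoint_set N) C) N)).

(** Elements [m^* e^* n^* c n e m] come back to [A] through [n^* c n] in [B]; those with
    [e = 1] already generate [A]. *)
Lemma bridge_corner :
  A = closed_span (mul_set (mul_set (adjoint_set (lin_span (bridge M B N))) C)
    (lin_span (bridge M B N))).
Proof.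
set P := lin_span _; have lP : linear_subspace P by exact: lin_span_subspace.
have [lA mA kA] := cA.
apply/seteqP; split.
  rewrite {1}hA; set D := closed_span (mul_set (mul_set (adjoint_set P) C) P).
  have lD : linear_subspace D by exact: closed_span_subspace.
  have kD : closed D by exact: closed_span_closed.
  apply: (closed_span_min lD kD) => t /mul3P[x [b [m [/adjoint_setP Mx Bb Mm ->]]]].
  rewrite hB in Bb.
  apply: (@closed_span_map R _ _ (fun b => bop_comp (bop_comp x b) m)
    (rnorm x * rnorm m) _ D _ _ lD kD _ _ Bb).
  - by move=> c u u'; rewrite bop_comp_combr bop_comp_combl.
  - move=> u; rewrite (le_trans (opnorm_comp _ _))// mulrAC ler_wpM2r ?rnorm_ge0//.
    exact: opnorm_comp.
  move=> u /mul3P[y [c [n [/adjoint_setP Ny Cc Nn ->]]]].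
  have PP n' m' : N n' -> M m' -> P (bop_comp n' m').
    move=> Nn' Mm'; apply: sub_lin_span; rewrite -(bop_comp1r n').
    by apply: mul3 => //; exact: diagonal_id.
  apply: sub_closed_span.
  have -> : bop_comp (bop_comp x (bop_comp (bop_comp y c) n)) m =
      bop_comp (bop_comp (adj (bop_comp (adj y) (adj x))) c) (bop_comp n m).
    by rewrite adj_comp !adjK !bop_compA.
  by apply: mul3 => //; [apply: adjoint_set_adj|]; exact: PP.
apply: closed_span_min => // t /mul3P[x [c [p [/adjoint_setP Px Cc Pp ->]]]].
rewrite -[x]adjK; move: (adj x) Px => {x} q Pq.
have core q' p' : bridge M B N q' -> bridge M B N p' ->
    A (bop_comp (bop_comp (adj q') c) p').
  move=> /mul3P[n1 [e1 [m1 [N1 D1 M1 ->]]]] /mul3P[n2 [e2 [m2 [N2 D2 M2 ->]]]].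
  have B0 : B (bop_comp (bop_comp (adj n1) c) n2).
    by rewrite hB; apply: sub_closed_span; apply: mul3 => //; exact: adjoint_set_adj.
  have [_ B1 _ _] := D2 _ B0; have [_ _ B2 _] := D1 _ B1.
  have -> : bop_comp (bop_comp (adj (bop_comp (bop_comp n1 e1) m1)) c)
      (bop_comp (bop_comp n2 e2) m2) =
    bop_comp (bop_comp (adj m1) (bop_comp (adj e1)
      (bop_comp (bop_comp (bop_comp (adj n1) c) n2) e2))) m2.
    by rewrite !adj_comp !bop_compA.
  rewrite hA; apply: sub_closed_span; apply: mul3 => //.
  exact: adjoint_set_adj.
move: q Pq; apply: lin_span_min.
  split => [|k u u' Su Su'] /=.
    have -> : bop_comp (bop_comp (adj (0 : bop H L)) c) p = 0.
      by rewrite adj0; apply: bop_eq => y; rewrite !bop_compE.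
    exact: lA.1.
  by rewrite adj_comb !bop_comp_combl; exact: lA.2.
move=> q' q'X; move: p Pp; apply: lin_span_min.
  split => [|k u u' Su Su'] /=.
    have -> : bop_comp (bop_comp (adj q') c) (0 : bop H L) = 0.
      by apply: bop_eq => y; rewrite bop_compE bop_lin0.
    exact: lA.1.
  by rewrite bop_comp_combr; exact: lA.2.
by move=> p' p'X; exact: core.
Qed.

End Half.

(** In a triple product of elements [n e m], the factors [m m^*] and [n^* n] in the
    middle belong to the diagonal of [B]. *)
Lemma strongly_TRO_trans H K L (A : set (bop H H)) (B : set (bop K K)) (C : set (bop L L)) :
  strongly_TRO_equivalent A B -> strongly_TRO_equivalent B C -> strongly_TRO_equivalent A C.
Proof.
move=> [cA cB [M [tM hA hBM]]] [_ cC [N [tN hBN hC]]]; split => //.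
have tN' := TRO_adjoint tN.
have hBN' : B = closed_span (mul_set (mul_set (adjoint_set N) C) (adjoint_set (adjoint_set N))).
  by rewrite adjoint_setK.
have NN n1 n2 : N n1 -> N n2 -> diagonal B (bop_comp (adj n1) n2).
  move=> /adjoint_set_adj N1 /adjoint_set_adj N2.
  by have := corner_diagonal tN' hBN' N1 N2; rewrite adjK.
exists (lin_span (bridge M B N)); split.
- split; first exact: lin_span_subspace.
  move=> t /mul3P[x [y [z [Px /adjoint_setP Py Pz ->]]]].
  rewrite -[y]adjK; move: (adj y) Py => {}y Py.
  have core x' y' z' : bridge M B N x' -> bridge M B N y' -> bridge M B N z' ->
      bridge M B N (bop_comp (bop_comp x' (adj y')) z').
    move=> /mul3P[n1 [e1 [m1 [N1 D1 M1 ->]]]] /mul3P[n2 [e2 [m2 [N2 D2 M2 ->]]]].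
    move=> /mul3P[n3 [e3 [m3 [N3 D3 M3 ->]]]].
    pose e := bop_comp (bop_comp e1 (bop_comp m1 (adj m2)))
      (bop_comp (adj e2) (bop_comp (bop_comp (adj n2) n3) e3)).
    have -> : bop_comp (bop_comp (bop_comp (bop_comp n1 e1) m1)
        (adj (bop_comp (bop_comp n2 e2) m2))) (bop_comp (bop_comp n3 e3) m3) =
        bop_comp (bop_comp n1 e) m3.
      by rewrite /e !adj_comp !bop_compA.
    apply: mul3 => //; apply: diagonal_comp.
      by apply: diagonal_comp => //; exact (corner_diagonal tM hBM M1 M2).
    apply: diagonal_comp; first exact: diagonal_adj.
    by apply: diagonal_comp => //; exact: NN.
  have lP := lin_span_subspace (bridge M B N).
  move: x Px; apply: lin_span_min.
    split => [|k u u' Su Su'] /=; last by rewrite !bop_comp_combl; exact: lP.2.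
    have -> : bop_comp (bop_comp (0 : bop H L) (adj y)) z = 0.
      by apply: bop_eq => w; rewrite !bop_compE.
    exact: lP.1.
  move=> x' Xx'; move: y Py; apply: lin_span_min.
    split => [|k u u' Su Su'] /=.
      have -> : bop_comp (bop_comp x' (adj (0 : bop H L))) z = 0.
        by rewrite adj0; apply: bop_eq => w; rewrite !bop_compE; exact: bop_lin0.
      exact: lP.1.
    by rewrite adj_comb bop_comp_combr !bop_comp_combl; exact: lP.2.
  move=> y' Xy'; move: z Pz; apply: lin_span_min.
    split => [|k u u' Su Su'] /=; last by rewrite bop_comp_combr; exact: lP.2.
    have -> : bop_comp (bop_comp x' (adj y')) (0 : bop H L) = 0.
      by apply: bop_eq => w; rewrite bop_compE bop_lin0.
    exact: lP.1.
  by move=> z' Xz'; apply: sub_lin_span; exact: core.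
- exact: bridge_corner cA hA hBN.
- have := @bridge_corner L K H C B A (adjoint_set N) (adjoint_set M) cC.
  rewrite -adjoint_bridge -adjoint_lin_span !adjoint_setK; exact.
Qed.

Lemma strongly_TRO_refl H (A : set (bop H H)) :
  closed_algebra A -> strongly_TRO_equivalent A A.
Proof.
move=> cA; have [lA mA kA] := cA; split => //.
pose M : set (bop H H) := [set c *: bop_id H | c in setT].
have adjM c : adj (c *: bop_id H) = conjc c *: bop_id H.
  by rewrite -[c *: _]addr0 adj_comb adj_id adj0 addr0.
have mulM c d x : bop_comp (bop_comp (c *: bop_id H) x) (d *: bop_id H) = (c * d) *: x.
  apply: bop_eq => y; rewrite !bop_compE !bop_scaleE bop_linZ scalerA.
  by [].
have aM : adjoint_set M = M.
  apply/seteqP; split => x.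
    by move=> /adjoint_setP[c _ E]; exists (conjc c) => //; rewrite -adjM E adjK.
  by move=> [c _ <-]; apply/adjoint_setP; exists (conjc c) => //; rewrite adjM.
have MAM : A = closed_span (mul_set (mul_set M A) M).
  apply/seteqP; split => [x Ax|].
    apply: sub_closed_span; rewrite -[x]scale1r -[1]mul1r -mulM.
    by apply: mul3 => //; exists 1.
  apply: closed_span_min => // t /mul3P[x [a [y [[c _ <-] Aa [d _ <-] ->]]]].
  by rewrite mulM; exact: subspaceZ.
exists M; rewrite aM; split => //; split.
  split; first by exists 0 => //; rewrite scale0r.
  by move=> c _ _ [d _ <-] [e _ <-]; exists (c * d + e) => //; rewrite scalerDl scalerA.
rewrite aM => t /mul3P[x [y [z [[c _ <-] [d _ <-] [e _ <-] ->]]]].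
by rewrite mulM scalerA; exists (c * e * d).
Qed.

End Composition.

(** * Strong Delta-equivalence *)

Theorem corollary2p13 (R : realType) :
  (forall A : operator_algebra R,
     has_contractive_approximate_identity A ->
     strongly_Delta_equivalent A A) /\
  (forall A B : operator_algebra R,
     has_contractive_approximate_identity A ->
     has_contractive_approximate_identity B ->
     strongly_Delta_equivalent A B -> strongly_Delta_equivalent B A) /\
  (forall A B C : operator_algebra R,
     has_contractive_approximate_identity A ->
     has_contractive_approximate_identity B ->
     has_contractive_approximate_identity C ->
     strongly_Delta_equivalent A B -> strongly_Delta_equivalent B C ->
     strongly_Delta_equivalent A C).
Proof.
split; [move=> A _|split; [move=> A B _ _|move=> A B C caiA caiB _]].
- have [H [u [um ciu]]] := oa_embedding A.
  have ru : completely_isometric_representation u.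
    by split => //; split => // n a; rewrite ciu.
  exists H, H, u, u; split => //.
  by apply: strongly_TRO_refl; exact: rep_subspaces.
- move=> [H [K [u [w [ru rw uw]]]]].
  by exists K, H, w, u; split => //; exact: strongly_TRO_sym.
move=> [H [K [alpha [beta [[[am _] cia] [[bm _] cib] [_ _ [M [tM hA hB]]]]]]]].
move=> [G [L [pi [gamma [[[pm _] cip] rgamma PC]]]]].
have [H1 [T [rT TP]]] := induced_TRO caiA caiB am bm pm cia cib cip tM hA hB.
exists H1, L, T, gamma; split => //.
exact: strongly_TRO_trans TP PC.
Qed.
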